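(* Let $r\ge 1$ be an integer, let $p_1,\ldots,p_r\in\mathbb{P}^2$ be very general points, let $X=\mathrm{Bl}_{p_1,\ldots,p_r}\mathbb{P}^2$, and for $\mu\in\mathbb{R}$ let $L(\mu)=\mu H-\sum_{i=1}^rE_i$, an $\mathbb{R}$-divisor on $X$. Then: \begin{enumerate} \item For any $r$, $L(\mu)$ admits a weakly submaximal curve for all $\mu\ge\sqrt{r+1}$. \item If $r=10$, then $L(\mu)$ admits a weakly submaximal curve for all $\mu\ge \frac{77}{24}$. \item If $r=11$, then $L(\mu)$ admits a weakly submaximal curve for all $\mu\ge 4-\frac{\sqrt3}{3}$. \item If $r=13$, then $L(\mu)$ admits a weakly submaximal curve for all $\mu\ge\frac16(26-\sqrt{13})$. \end{enumerate}
   Context: We work over $\mathbb{C}$. $X=\mathrm{Bl}_{p_1,\ldots,p_r}\mathbb{P}^2$ is the blow up of $\mathbb{P}^2$ at $r$ very general points; $E_i$ is the exceptional divisor over $p_i$, and $H$ is the pull-back to $X$ of $\mathcal{O}_{\mathbb{P}^2}(1)$ (so $H^2=1$, $H\cdot E_i=0$, $E_i^2=-1$, $E_i\cdot E_j=0$ for $i\neq j$). Thus $L(\mu)^2=\mu^2-r$. For an $\mathbb{R}$-divisor $L$ on $X$ with $L^2\ge0$, a weakly submaximal curve for $L$ is an irreducible and reduced curve $C\subset X$ such that, for some point $x\in C$, $\frac{L\cdot C}{\mathrm{mult}_xC}\le\sqrt{L^2}$. We say that $L$ admits a weakly submaximal curve if such a pair $(C,x)$ exists. *)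

(* Defs.v *)
From mathcomp Require Import all_boot all_order all_algebra.
From mathcomp Require Import mpoly.
From mathcomp Require Import complex reals.

Set Implicit Arguments.
Unset Strict Implicit.
Unset Printing Implicit Defensive.
Import Order.TTheory GRing.Theory Num.Theory.
Local Open Scope ring_scope.

(* The base field is C = R[i] for R : realType.  A point of P^n is given by   *)
(* homogeneous coordinates, i.e. by a nonzero row vector; two vectors give    *)
(* the same point when they span the same line.                               *)
Definition proj_point (R : realType) (n : nat) := {v : 'rV[R[i]]_n.+1 | v != 0}.

Definition same_point (R : realType) (n : nat) (u v : proj_point R n) : bool :=
  (val u == val v)%MS.

(* First index of a nonzero coordinate: selects a standard affine chart.      *)
Definition pivot (R : realType) (n : nat) (v : proj_point R n) : 'I_n.+1 :=
  odflt ord0 [pick j | val v 0 j != 0].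

(* ---------------------- very general configurations ----------------------- *)

(* The r-tuple p in (P^2)^r as the point (p_1, ..., p_r) of C^(3r).           *)
Definition config_coord (R : realType) (r : nat) (p : 'I_r -> proj_point R 2) :
    'I_(r * 3) -> R[i] :=
  fun k => mxvec (\matrix_(i < r, j < 3) val (p i) 0 j) 0 k.

(* G is homogeneous, of some degree a i, in each of the r groups of three     *)
(* variables.                                                                 *)
Definition multihomog (R : realType) (r : nat) (G : {mpoly R[i][r * 3]}) : Prop :=
  exists a : 'I_r -> nat, forall m : 'X_{1.. r * 3}, m \in msupp G ->
    forall i : 'I_r, (\sum_(j < 3) m (mxvec_index i j))%N = a i.

Definition zariski_closed (R : realType) (r : nat)
    (Z : ('I_r -> proj_point R 2) -> Prop) : Prop :=
  exists S : {mpoly R[i][r * 3]} -> Prop,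
    (forall G, S G -> multihomog G) /\
    (forall p, Z p <-> forall G, S G -> G.@[config_coord p] = 0).

(* P holds for very general p_1, ..., p_r: it holds off a countable union of  *)
(* proper closed subsets of (P^2)^r.                                          *)
Definition for_very_general (R : realType) (r : nat)
    (P : ('I_r -> proj_point R 2) -> Prop) : Prop :=
  exists Z : nat -> ('I_r -> proj_point R 2) -> Prop,
    (forall k, zariski_closed (Z k) /\ exists p, ~ Z k p) /\
    (forall p, (forall k, ~ Z k p) -> P p).

(* --------------------------- plane multiplicity --------------------------- *)

(* Order of vanishing at the origin of g <> 0: the least degree of a monomial *)
(* of g (all these degrees are < msize g).                                    *)
Definition order0 (K : nzRingType) (n : nat) (g : {mpoly K[n]}) : nat :=
  \big[minn/msize g]_(m <- msupp g) mdeg m.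

(* The standard affine chart A^n of P^n around q, translated so that q is the *)
(* origin: the pivot coordinate is kept fixed, and the n other ones become    *)
(* q_k + X_k'.                                                                *)
Definition affine_chart (R : realType) (n : nat) (q : proj_point R n) :
    n.+1.-tuple {mpoly R[i][n]} :=
  [tuple (if unlift (pivot q) k is Some k' then (val q 0 k)%:MP + 'X_k'
          else (val q 0 k)%:MP) | k < n.+1].

Definition plane_mult (R : realType) (F : {mpoly R[i][3]}) (q : proj_point R 2) :
    nat :=
  order0 (F \mPo affine_chart q).

(* ----------------------- points of the blow-up X -------------------------- *)

(* X = (P^2 \ {p_1, ..., p_r}) + E_1 + ... + E_r, where E_i is the projective *)
(* line of tangent directions of P^2 at p_i; a direction is given by its      *)
(* coordinates in affine_chart (p i).                                         *)
Inductive blowup_point (R : realType) (r : nat) (p : 'I_r -> proj_point R 2) :=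
| OffExc (q : proj_point R 2) (_ : forall i, ~~ same_point q (p i))
| OnExc (i : 'I_r) (s : proj_point R 1).

(* The chart of the blow-up of A^2 at the origin, centred at the point of the *)
(* exceptional curve in direction s.  For s = (1, s_1) it is the map          *)
(* (u, v) |-> (u, u (s_1 + v)), with u = X_0 and v = X_1; the exceptional     *)
(* curve is u = 0 and the point is u = v = 0.                                 *)
Definition blowup_chart (R : realType) (s : proj_point R 1) :
    2.-tuple {mpoly R[i][2]} :=
  [tuple (if unlift (pivot s) k is Some _
          then 'X_ord0 * ((val s 0 k)%:MP + 'X_ord_max)
          else val s 0 k *: 'X_ord0) | k < 2].

(* The pull-back to X of the homogeneous polynomial F, in local coordinates   *)
(* of X centred at x.                                                         *)
Definition local_pullback (R : realType) (r : nat) (p : 'I_r -> proj_point R 2)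
    (F : {mpoly R[i][3]}) (x : blowup_point p) : {mpoly R[i][2]} :=
  match x with
  | OffExc q _ => F \mPo affine_chart q
  | OnExc i s => (F \mPo affine_chart (p i)) \mPo blowup_chart s
  end.

(* ------------------------ effective divisors on X ------------------------- *)

(* Effective divisors on X are the zero divisors of the nonzero sections of   *)
(* the line bundles O_X(d H + sum_i e_i E_i).  Such a section is the same as  *)
(* a form F of degree d on P^2 having multiplicity at least - e_i at p_i: the *)
(* divisor is the pull-back of {F = 0}, plus sum_i e_i E_i.  For instance E_i *)
(* is (0, (0, .., 1, .., 0), 1), and the strict transform of {F = 0} is       *)
(* (deg F, (- mult_{p_i} F)_i, F).                                            *)
Record effective_divisor (R : realType) (r : nat) (p : 'I_r -> proj_point R 2) :=
  EffectiveDivisor {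
    hdeg : nat;
    ecoef : 'I_r -> int;
    dpoly : {mpoly R[i][3]};
    dpoly_neq0 : dpoly != 0;
    dpoly_homog : dpoly \is hdeg.-homog;
    ecoef_bound : forall i, - ecoef i <= (plane_mult dpoly (p i))%:Z
  }.

Definition zero_divisor (R : realType) (r : nat) (p : 'I_r -> proj_point R 2)
    (D : effective_divisor p) : Prop :=
  hdeg D = 0%N /\ forall i, ecoef D i = 0.

Definition sum_divisor (R : realType) (r : nat) (p : 'I_r -> proj_point R 2)
    (D D1 D2 : effective_divisor p) : Prop :=
  [/\ hdeg D = (hdeg D1 + hdeg D2)%N,
      forall i, ecoef D i = ecoef D1 i + ecoef D2 i
    & dpoly D = dpoly D1 * dpoly D2].

(* X being a smooth surface, the irreducible and reduced curves on it are the *)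
(* prime divisors: the nonzero effective divisors that are not a sum of two   *)
(* nonzero effective divisors.                                                *)
Definition integral_curve (R : realType) (r : nat) (p : 'I_r -> proj_point R 2)
    (C : effective_divisor p) : Prop :=
  ~ zero_divisor C /\
  forall D1 D2, sum_divisor C D1 D2 -> zero_divisor D1 \/ zero_divisor D2.

(* Multiplicity at x.  Near a point of E_i the divisor has local equation     *)
(* u^(e_i) times the pull-back of F, where u = 0 is the equation of E_i; the  *)
(* order at the origin of this product is the sum below.  The point x lies on *)
(* D exactly when this is positive.                                           *)
Definition mult_at (R : realType) (r : nat) (p : 'I_r -> proj_point R 2)
    (D : effective_divisor p) (x : blowup_point p) : int :=
  (order0 (local_pullback (dpoly D) x))%:Z +
  (if x is OnExc i _ then ecoef D i else 0).

(* ------------------------- intersection numbers --------------------------- *)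

(* The class h H + sum_i e_i E_i with real coefficients.                      *)
Record divisor_class (R : realType) (r : nat) :=
  DivisorClass { coefH : R; coefE : 'I_r -> R }.

(* The bilinear form with H^2 = 1, H.E_i = 0, E_i^2 = -1, E_i.E_j = 0.        *)
Definition intersection (R : realType) (r : nat) (A B : divisor_class R r) : R :=
  coefH A * coefH B - \sum_(i < r) coefE A i * coefE B i.

Definition class_of (R : realType) (r : nat) (p : 'I_r -> proj_point R 2)
    (D : effective_divisor p) : divisor_class R r :=
  DivisorClass (hdeg D)%:R (fun i => (ecoef D i)%:~R).

Definition admits_weakly_submaximal (R : realType) (r : nat)
    (p : 'I_r -> proj_point R 2) (L : divisor_class R r) : Prop :=
  0 <= intersection L L /\
  exists (C : effective_divisor p) (x : blowup_point p),
    [/\ integral_curve C,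
        0 < mult_at C x
      & intersection L (class_of C) / (mult_at C x)%:~R
          <= Num.sqrt (intersection L L)].

Definition Lmu (R : realType) (r : nat) (mu : R) : divisor_class R r :=
  DivisorClass mu (fun _ => -1).

(* Main.v *)
(*
  For mu >= sqrt(r+1) an exceptional curve E_i is weakly submaximal.  Otherwise,
  put s = sqrt(mu^2 - r).  It is enough to find a nonzero effective divisor D and
  a point x with L(mu).D <= s mult_x(D): both sides are additive, so the
  inequality holds for some component C of D, and if mult_x(C) = 0 then
  L(mu).C <= 0 and any point of C will do.

  Writing (d; m_1, .., m_r) for d H - sum_i m_i E_i, the divisors used are the
  cubic (3; 1^9, 0) when r = 10 and mu >= 13/4 (with x any of its points), and
  members of the pencils (10; 4, 3^9) for r = 10, (4; 2, 1^10) for r = 11 and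
  (4; 1^13) for r = 13 that are singular at some x in X.  These classes are
  effective by a dimension count, at arbitrary distinct points p_i.

  A pencil <F, G> in a class D on X has a singular member as soon as
  c_2(J^1(D)) = 3 D^2 + 2 K_X.D + e(X) > 0.  Indeed, by a dimension count, the
  map P |-> P /\ F /\ G from J^1(D) (x) B to O(3 D + K_X + B) is not onto on
  global sections, however positive B is.  The cokernels form a nonzero finitely
  generated graded module, which has a point q in its support.  If q is not one
  of the p_i then F and G have dependent 1-jets at q; if q = p_i, the same
  argument applied to leading forms at p_i gives a point of E_i at which a member
  of the pencil is singular.
*)

(* In each pencil class the dimension count guarantees only two independent forms, while a double
   point at a prescribed place costs three conditions. The singular point therefore cannot be
   chosen; it has to be found, and it may lie on some [E_i].

   Bundles on X are replaced by spaces of forms of large degree with order conditions in charts at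
   the [p_i], and [c_2] appears as what remains in a difference of binomial coefficients once all
   terms in the twist cancel.

   A point q of the support is excluded in the manner of Nakayama's lemma. If the minors of the two
   gradients do not all vanish at q, every element of the target is a Jacobian determinant plus an
   element of the ideal of q times the target, against the choice of q. At q = [p_i] the same is
   done with leading forms, and this is what shapes the twist: binary forms without common zero
   generate everything only from some degree on, so the order b of the twist along the [E_i] must
   exceed that degree. *)
From HB Require Import structures.
Require Import Defs.
From mathcomp Require Import all_boot all_order all_algebra.
From mathcomp Require Import mpoly complex reals ring lra zify spectral boolp.

Set Implicit Arguments.
Unset Strict Implicit.
Unset Printing Implicit Defensive.
Import Order.TTheory GRing.Theory Num.Theory.
Local Open Scope ring_scope.

(** * Orders of vanishing *)

(* Unlike a lower bound on [order0], this holds for [f = 0], where [order0] is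
   the junk value 0. *)
Definition ord_ge (K : nzRingType) (n k : nat) (f : {mpoly K[n]}) : Prop :=
  forall m : 'X_{1..n}, (mdeg m < k)%N -> f@_m = 0.

Section Order.
Variables (K : idomainType) (n : nat).
Implicit Types (f g : {mpoly K[n]}) (k : nat).

Lemma ord_ge0n f : ord_ge 0 f. Proof. by []. Qed.

Lemma ord_ge_zero k : ord_ge k (0 : {mpoly K[n]}).
Proof. by move=> m _; rewrite mcoeff0. Qed.

Lemma ord_ge_lin k c f g : ord_ge k f -> ord_ge k g -> ord_ge k (c *: f + g).
Proof. by move=> hf hg m hm; rewrite mcoeffD mcoeffZ hf ?hg // mulr0 addr0. Qed.

Lemma ord_geZ k c f : ord_ge k f -> ord_ge k (c *: f).
Proof. by move=> hf m hm; rewrite mcoeffZ hf ?mulr0. Qed.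

Lemma ord_geD k f g : ord_ge k f -> ord_ge k g -> ord_ge k (f + g).
Proof. by move=> hf hg m hm; rewrite mcoeffD hf ?hg ?addr0. Qed.

Lemma ord_geN k f : ord_ge k f -> ord_ge k (- f).
Proof. by move=> hf m hm; rewrite mcoeffN hf ?oppr0. Qed.

Lemma ord_geB k f g : ord_ge k f -> ord_ge k g -> ord_ge k (f - g).
Proof. by move=> hf hg; apply/ord_geD/ord_geN. Qed.

Lemma ord_ge_sum (I : Type) (s : seq I) (P : pred I) k (F : I -> {mpoly K[n]}) :
  (forall i, P i -> ord_ge k (F i)) -> ord_ge k (\sum_(i <- s | P i) F i).
Proof.
by move=> h; elim/big_ind: _ => //; [exact: ord_ge_zero | exact: ord_geD].
Qed.

Lemma ord_ge_le j k f : (j <= k)%N -> ord_ge k f -> ord_ge j f.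
Proof. by move=> jk hf m hm; apply/hf/(leq_trans hm). Qed.

Lemma ord_geM j k f g : ord_ge j f -> ord_ge k g -> ord_ge (j + k) (f * g).
Proof.
move=> hf hg m hm; rewrite mcoeffM big1 // => -[m1 m2] /= /eqP e.
have hm' : (mdeg m1 + mdeg m2 < j + k)%N by rewrite -mdegD -e.
have [h1|h1] := ltnP (mdeg m1) j; first by rewrite hf ?mul0r.
by rewrite hg ?mulr0 //; lia.
Qed.

Lemma ord_geMl k f g : ord_ge k g -> ord_ge k (f * g).
Proof. by move=> hg; rewrite -[k]add0n; apply: ord_geM. Qed.

Lemma ord_geMr k f g : ord_ge k f -> ord_ge k (f * g).
Proof. by move=> hg; rewrite mulrC; apply: ord_geMl. Qed.

Lemma ord_geXm m : ord_ge (mdeg m) ('X_[m] : {mpoly K[n]}).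
Proof. by move=> m' hm'; rewrite mcoeffX; case: eqP hm' => // ->; rewrite ltnn. Qed.

Lemma ord_geX i : ord_ge 1 ('X_i : {mpoly K[n]}).
Proof. by rewrite -(mdeg1 i); apply: ord_geXm. Qed.

Lemma ord_geXn k f : ord_ge 1 f -> ord_ge k (f ^+ k).
Proof.
move=> hf; elim: k => [|k IH]; first exact: ord_ge0n.
by rewrite exprS -add1n; apply: ord_geM.
Qed.

Lemma ord_ge_deriv k i f : ord_ge k.+1 f -> ord_ge k f^`M(i).
Proof. by move=> hf m hm; rewrite mcoeff_deriv hf ?mul0rn // mdegD mdeg1 addn1 ltnS. Qed.

Lemma ord_ge1P f : ord_ge 1 f <-> f@_0%MM = 0.
Proof.
split=> [h|h m]; first by apply: h; rewrite mdeg0.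
by rewrite ltnS leqn0 mdeg_eq0 => /eqP ->.
Qed.

Lemma order0_geP k f : f != 0 -> (k <= order0 f)%N <-> ord_ge k f.
Proof.
move=> f0; have -> : (k <= order0 f)%N = all (fun m => (k <= mdeg m)%N) (msupp f).
  have leq_bigmin (s : seq 'X_{1..n}) x :
      (k <= \big[minn/x]_(m <- s) mdeg m)%N
      = (k <= x)%N && all (fun m => (k <= mdeg m)%N) s.
    by elim: s => [|m s IH]; rewrite ?big_nil ?andbT // big_cons leq_min IH andbCA.
  (* The minimum in [order0] starts at [msize f], which exceeds the degree of the leading monomial
     and so never decides. *)
  rewrite /order0 leq_bigmin; apply/andb_idl => /allP h.
  apply: leq_trans (h _ (mlead_supp f0)) _.
  by rewrite -(mlead_deg f0).
split=> [/allP h m|h].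
  by apply: contraTeq; rewrite -mcoeff_msupp -leqNgt; apply: h.
by apply/allP => m; rewrite mcoeff_msupp leqNgt; apply: contraNN => /h ->.
Qed.

Lemma mcoeff_pihomog k f m : (pihomog mdeg k f)@_m = if mdeg m == k then f@_m else 0.
Proof.
rewrite pihomogE raddf_sum /= big_mkcond /=.
have z m' : m' != m -> (if mdeg m' == k then (f@_m' *: 'X_[m'])@_m else 0) = 0.
  by move=> ne; rewrite mcoeffZ mcoeffX (negPf ne) mulr0 if_same.
case: (boolP (m \in msupp f)) => hm.
  rewrite (bigD1_seq m) ?msupp_uniq //= big1 => [|m' /z //].
  by rewrite mcoeffZ mcoeffX eqxx mulr1 addr0.
rewrite (memN_msupp_eq0 hm) if_same big_seq big1 // => m' hm'.
by apply: z; apply: contraNneq hm => <-.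
Qed.

Lemma pihomog_lin k a c f g : pihomog mdeg k (a *: f + c *: g) =
  a *: pihomog mdeg k f + c *: pihomog mdeg k g.
Proof.
apply/mpolyP => m; rewrite mcoeff_pihomog !mcoeffD !mcoeffZ !mcoeff_pihomog.
by case: eqP => // _; rewrite !mulr0 addr0.
Qed.

Lemma pihomog_ord k l f : (k < l)%N -> ord_ge l f -> pihomog mdeg k f = 0.
Proof.
move=> kl hf; apply/mpolyP=> m; rewrite mcoeff_pihomog mcoeff0.
by case: eqP => // e; rewrite hf ?e.
Qed.

Lemma ord_geS k f : ord_ge k f -> pihomog mdeg k f = 0 -> ord_ge k.+1 f.
Proof.
move=> hf h0 m; rewrite ltnS leq_eqVlt => /orP[e|]; last exact: hf.
by have := mcoeff_pihomog k f m; rewrite e h0 mcoeff0.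
Qed.

Lemma homog_ord k f : f \is k.-homog -> ord_ge k f.
Proof. by move=> hf m hm; apply: dhomog_nemf_coeff hf _; rewrite /= ltn_eqF. Qed.

Lemma ord_ge_pihomog k f : ord_ge k (pihomog mdeg k f).
Proof. exact/homog_ord/pihomogP. Qed.

Lemma ord_geB_pihomog k f : ord_ge k f -> ord_ge k.+1 (f - pihomog mdeg k f).
Proof.
move=> hf; apply: ord_geS; first exact/ord_geB/ord_ge_pihomog.
by rewrite pihomogB pihomog_id subrr.
Qed.

Lemma pihomogM k l f g : ord_ge k f -> ord_ge l g ->
  pihomog mdeg (k + l) (f * g) = pihomog mdeg k f * pihomog mdeg l g.
Proof.
move=> hf hg; have := ord_geB_pihomog hf; have := ord_geB_pihomog hg.
set f0 := pihomog _ _ f; set g0 := pihomog _ _ g => hg' hf'.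
have -> : f * g = f0 * g0 + ((f - f0) * g + f0 * (g - g0)) by ring.
rewrite pihomogD pihomog_dE; last by apply: dhomogM; exact: pihomogP.
rewrite (@pihomog_ord _ (k + l).+1) ?addr0 //; apply: ord_geD.
  by rewrite -addSn; apply: ord_geM.
by rewrite -addnS; apply: ord_geM => //; apply: ord_ge_pihomog.
Qed.

Lemma pihomog_deriv k i f : pihomog mdeg k f^`M(i) = (pihomog mdeg k.+1 f)^`M(i).
Proof.
apply/mpolyP=> m; rewrite mcoeff_pihomog !mcoeff_deriv mcoeff_pihomog.
by rewrite mdegD mdeg1 addn1 eqSS; case: eqP => // _; rewrite mul0rn.
Qed.

(** Lowest-degree forms multiply, and their product is nonzero over an integral domain. *)
Lemma order0M f g : f != 0 -> g != 0 -> order0 (f * g) = (order0 f + order0 g)%N.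
Proof.
move=> f0 g0; have fg0 : f * g != 0 by rewrite mulf_neq0.
have hf := proj1 (order0_geP _ f0) (leqnn _).
have hg := proj1 (order0_geP _ g0) (leqnn _).
apply/eqP; rewrite eqn_leq; apply/andP; split; last first.
  by apply/(order0_geP _ fg0); exact: ord_geM.
have lead (h : {mpoly K[n]}) : h != 0 -> pihomog mdeg (order0 h) h != 0.
  move=> h0; apply/eqP => /(ord_geS (proj1 (order0_geP _ h0) (leqnn _))).
  by move/(order0_geP _ h0); rewrite ltnn.
rewrite leqNgt; apply/negP => /(order0_geP _ fg0) h.
have := mulf_neq0 (lead _ f0) (lead _ g0).
by rewrite -pihomogM // (@pihomog_ord _ _ _ _ h) ?eqxx.
Qed.

(** [u] is a unit of the local ring at the origin: the lowest form of [u * f] is that of [f] times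
    the constant term of [u]. *)
Lemma ord_ge_cancel k f u : u@_0%MM != 0 -> ord_ge k (u * f) -> ord_ge k f.
Proof.
move=> u0; elim: k f => // k IH f h; have hf := IH _ (ord_ge_le (leqnSn k) h).
apply: ord_geS => //.
have := @pihomogM 0 k u f (ord_ge0n u) hf; rewrite add0n (pihomog_ord (ltnSn k) h).
move=> /esym /eqP; rewrite mulf_eq0 => /orP[/eqP e|/eqP //].
have := mcoeff_pihomog 0 u 0%MM; rewrite e mdeg0 eqxx mcoeff0 => e'.
by rewrite -e' eqxx in u0.
Qed.
End Order.

Section Field.
Variables (K : fieldType) (n : nat).
Implicit Types (f g u : {mpoly K[n]}) (k : nat).

(** Geometric series in [1 - u / u(0)], cut off after [N] terms. *)
Lemma local_inverse N u : u@_0%MM != 0 -> exists v, ord_ge N (1 - u * v).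
Proof.
set c := u@_0%MM => c0; pose w := 1 - c^-1 *: u.
have hw : ord_ge 1 w.
  by apply/ord_ge1P; rewrite mcoeffB mcoeff1 eqxx mcoeffZ mulVf ?subrr.
exists (c^-1 *: \sum_(i < N) w ^+ i).
have -> : 1 - u * (c^-1 *: \sum_(i < N) w ^+ i) = w ^+ N; last exact: ord_geXn.
rewrite -scalerAr scalerAl.
have -> : c^-1 *: u = 1 - w by rewrite /w subKr.
by rewrite -[1 - w]opprB mulNr -subrX1 opprK addrC subrK.
Qed.

Definition trunc N f : {mpoly K[n]} := \sum_(k < N) pihomog mdeg k f.

Lemma mcoeff_trunc N f m : (trunc N f)@_m = if (mdeg m < N)%N then f@_m else 0.
Proof.
rewrite /trunc raddf_sum /=; case: ltnP => h.
  rewrite (bigD1 (Ordinal h)) //= mcoeff_pihomog eqxx big1 ?addr0 // => i ne.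
  by rewrite mcoeff_pihomog; case: eqP => // e; rewrite -val_eqE /= e eqxx in ne.
by rewrite big1 // => i _; rewrite mcoeff_pihomog; case: eqP => // e; have := ltn_ord i; lia.
Qed.

Lemma ord_ge_trunc N f : ord_ge N (f - trunc N f).
Proof. by move=> m hm; rewrite mcoeffB mcoeff_trunc hm subrr. Qed.

Lemma msize_trunc N f : (msize (trunc N f) <= N)%N.
Proof.
rewrite msizeE; apply/bigmax_leqP_seq => m; rewrite mcoeff_msupp mcoeff_trunc.
by case: ltnP; rewrite ?eqxx.
Qed.
End Field.

(** * Nonzero polynomials have nonzero values *)

Section NonVanishing.
Variable K : numDomainType.

Lemma poly_nonroot (p : {poly K}) : p != 0 -> exists x, p.[x] != 0.
Proof.
move=> p0; pose s := [seq (i%:R : K) | i <- iota 0 (size p)].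
have us : uniq s.
  by rewrite map_inj_uniq ?iota_uniq // => i j /eqP; rewrite eqr_nat => /eqP.
case: (boolP (all (root p) s)) => [h|/allPn[x _ hx]]; last by exists x.
by have := max_poly_roots p0 h us; rewrite size_map size_iota ltnn.
Qed.

Lemma muni_neq0 n (f : {mpoly K[n.+1]}) : f != 0 -> muni f != 0.
Proof.
move=> f0; pose restr (m : 'X_{1..n.+1}) : 'X_{1..n} :=
  [multinom (m (widen_ord (leqnSn n) i) : nat) | i < n].
have restr_inj m m' : restr m = restr m' -> m ord_max = m' ord_max -> m = m'.
  move=> e e'; apply/mnmP => i; have [->//|ne] := eqVneq i ord_max.
  have hi : (i < n)%N.
    have := ltn_ord i; rewrite ltnS leq_eqVlt => /orP[/eqP eM|//].
    by case/eqP: ne; apply: val_inj.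
  move/mnmP/(_ (Ordinal hi)): e; rewrite !mnmE.
  by have -> : widen_ord (leqnSn n) (Ordinal hi) = i by apply: val_inj.
set M := mlead f; apply: contra_neq (_ : f@_M != 0); last by rewrite mleadc_eq0.
move=> e; have : (muni f)`_(M ord_max)@_(restr M) = 0 by rewrite e coef0 mcoeff0.
rewrite muniE coef_sum raddf_sum (bigD1_seq M) ?mlead_supp ?msupp_uniq //=.
rewrite coefZ coefXn eqxx mulr1 mcoeffZ mcoeffX eqxx mulr1 big1 ?addr0 // => m ne.
rewrite coefZ coefXn; case: eqP => [e'|_]; last by rewrite mulr0 mcoeff0.
rewrite mulr1 mcoeffZ mcoeffX; case: eqP => [e''|_]; last by rewrite mulr0.
by rewrite (restr_inj m M) ?eqxx // in ne.
Qed.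

Lemma mpoly_nonroot n (f : {mpoly K[n]}) : f != 0 -> exists v, f.@[v] != 0.
Proof.
elim: n f => [|n IH] f f0.
  exists (fun=> 0); move: f0; rewrite (nvar0_mpolyC f) mevalC.
  by apply: contraNneq => ->.
have /IH[w hw] : lead_coef (muni f) != 0 by rewrite lead_coef_eq0 muni_neq0.
have /poly_nonroot[x hx] : map_poly (meval w) (muni f) != 0.
  by apply: contraNneq hw => e; rewrite -coef_map e coef0.
exists (fun i => oapp w x (unlift ord_max i)); apply: contraNneq hx => <-; apply/eqP.
rewrite muniE rmorph_sum horner_sum mevalE; apply: eq_bigr => m _ /=.
rewrite map_polyZ map_polyXn hornerZ hornerXn /= mevalZ mevalX -mulrA; congr (_ * _).
rewrite big_ord_recr /= unlift_none /=; congr (_ * _); apply: eq_bigr => i _.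
rewrite mnmE.
have -> : widen_ord (leqnSn n) i = lift ord_max i.
  by apply: val_inj; rewrite /= /bump leqNgt ltn_ord.
by rewrite liftK.
Qed.
End NonVanishing.

(** * Affine charts and interpolation *)

Section Degree.
Variables (K : idomainType) (n : nat).
Implicit Types (f g : {mpoly K[n]}).

Definition deg_le d f : Prop := forall m : 'X_{1..n}, (d < mdeg m)%N -> f@_m = 0.

Lemma deg_leP d f : deg_le d f <-> (msize f <= d.+1)%N.
Proof.
split=> h.
  rewrite msizeE; apply/bigmax_leqP_seq => m; rewrite mcoeff_msupp ltnS leqNgt => hm _.
  by apply: contraNN hm => /h ->.
by move=> m hm; apply: memN_msupp_eq0; apply: msize_mdeg_ge; apply: leq_trans h _.
Qed.

Lemma deg_leD d f g : deg_le d f -> deg_le d g -> deg_le d (f + g).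
Proof. by move=> hf hg m hm; rewrite mcoeffD hf ?hg ?addr0. Qed.

Lemma deg_leZ d c f : deg_le d f -> deg_le d (c *: f).
Proof. by move=> hf m hm; rewrite mcoeffZ hf ?mulr0. Qed.

Lemma deg_le_sum d (I : Type) (s : seq I) (P : pred I) (F : I -> {mpoly K[n]}) :
  (forall i, P i -> deg_le d (F i)) -> deg_le d (\sum_(i <- s | P i) F i).
Proof.
move=> h; elim/big_ind: _ => //; last exact: deg_leD.
by move=> m _; rewrite mcoeff0.
Qed.

Lemma deg_leM d e f g : deg_le d f -> deg_le e g -> deg_le (d + e) (f * g).
Proof.
move=> hf hg m hm; rewrite mcoeffM big1 // => -[m1 m2] /= /eqP e'.
have hm' : (d + e < mdeg m1 + mdeg m2)%N by rewrite -mdegD -e'.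
have [h1|h1] := ltnP d (mdeg m1); first by rewrite hf ?mul0r.
by rewrite hg ?mulr0 //; lia.
Qed.

Lemma deg_le1 : deg_le 0 (1 : {mpoly K[n]}).
Proof. by apply/deg_leP; rewrite msize1. Qed.

Lemma deg_leXn d k f : deg_le d f -> deg_le (d * k) (f ^+ k).
Proof.
move=> hf; elim: k => [|k IH]; first by rewrite muln0; apply: deg_le1.
by rewrite exprS mulnS; apply: deg_leM.
Qed.

Lemma deg_le_prod (I : Type) (s : seq I) (e : I -> nat) (F : I -> {mpoly K[n]}) :
  (forall i, deg_le (e i) (F i)) -> deg_le (\sum_(i <- s) e i) (\prod_(i <- s) F i).
Proof.
by move=> h; elim/big_rec2: _ => [|i d f _]; [exact: deg_le1 | apply: deg_leM].
Qed.

Lemma homog_deg_le d f : f \is d.-homog -> deg_le d f.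
Proof. by move=> hf m hm; apply: dhomog_nemf_coeff hf _; rewrite /= gtn_eqF. Qed.

Lemma dhomog_prod_seq (I : Type) (s : seq I) (P : pred I) (e : I -> nat)
    (F : I -> {mpoly K[n]}) : (forall i, P i -> F i \is (e i).-homog) ->
  \prod_(i <- s | P i) F i \is (\sum_(i <- s | P i) e i).-homog.
Proof.
move=> h; elim/big_rec2: _ => [|i d f hi]; [exact: dhomog1 | apply: dhomogM; exact: h].
Qed.

Lemma dhomogXU i : ('X_i : {mpoly K[n]}) \is 1.-homog.
Proof. by rewrite dhomogX /= mdeg1. Qed.

Lemma meval_homog d f (t : K) (x : 'I_n -> K) : f \is d.-homog ->
  f.@[fun i => t * x i] = t ^+ d * f.@[x].
Proof.
move=> /dhomogP hf; rewrite !mevalE mulr_sumr [LHS]big_seq [RHS]big_seq.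
apply: eq_bigr => m /hf hm; rewrite mulrCA; congr (_ * _).
under eq_bigr do rewrite exprMn.
by rewrite big_split /= -hm /= mdegE -prodrXr.
Qed.

Lemma meval_at0 f : f.@[fun=> 0] = f@_0%MM.
Proof.
rewrite {2}[f]mpolyE mevalE raddf_sum; apply: eq_bigr => m _ /=.
rewrite mcoeffZ mcoeffX; congr (_ * _); case: eqP => [->|ne].
  by rewrite big1 // => i _; rewrite mnm0E expr0.
have [i hi] : exists i, m i != 0%N.
  apply/existsP; rewrite -negb_forall; apply: contra_notN ne => /forallP h.
  by apply/mnmP => i; rewrite mnm0E; apply/eqP.
by rewrite (bigD1 i) //= expr0n (negPf hi) mul0r.
Qed.

Lemma scale_mpolyC (c a : K) : c *: a%:MP_[n] = (c * a)%:MP.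
Proof. by apply/mpolyP => m; rewrite mcoeffZ !mcoeffC mulrA. Qed.

Lemma comp_mpolyXi k (t : n.-tuple {mpoly K[k]}) i : 'X_i \mPo t = tnth t i.
Proof. by rewrite comp_mpolyXU -tnth_nth. Qed.
End Degree.

Section Chart.
Variables (K : numFieldType) (n : nat).
Implicit Types (k : 'I_n.+1) (v : 'I_n.+1 -> K) (F G : {mpoly K[n.+1]}).

(** [affine_chart] with the pivot and the vector as free parameters, so that it also serves for
    directions and for vectors that are not packaged as a [proj_point]. *)
Definition chart k v : n.+1.-tuple {mpoly K[n]} :=
  [tuple (if unlift k i is Some j then (v i)%:MP + 'X_j else (v i)%:MP) | i < n.+1].

Lemma chart_pivot k v : 'X_k \mPo chart k v = (v k)%:MP.
Proof. by rewrite comp_mpolyXi tnth_mktuple unlift_none. Qed.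

Lemma chart_lift k v j : 'X_(lift k j) \mPo chart k v = (v (lift k j))%:MP_[n] + 'X_j.
Proof. by rewrite comp_mpolyXi tnth_mktuple liftK. Qed.

Lemma chart_coef0 k v F : (F \mPo chart k v)@_0%MM = F.@[v].
Proof.
rewrite -meval_at0 comp_mpoly_meval; apply: meval_eq => i.
by rewrite tnth_mktuple; case: unliftP => [j|] _; rewrite ?mevalD ?mevalC ?mevalXU ?addr0.
Qed.

Lemma chart_deg d k v F : F \is d.-homog -> deg_le d (F \mPo chart k v).
Proof.
move=> /dhomogP hF; rewrite comp_mpolyEX big_seq; apply: deg_le_sum => m /hF /= <-.
apply: deg_leZ; rewrite comp_mpolyX mdegE; apply: deg_le_prod => i.
rewrite -[X in deg_le X _]mul1n; apply: deg_leXn.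
have hC : deg_le 1 ((v i)%:MP_[n]).
  by apply/deg_leP; rewrite msizeC; case: eqP.
rewrite tnth_mktuple; case: unliftP => [j _|_] //.
by apply: deg_leD => //; apply/homog_deg_le/dhomogXU.
Qed.

(** A hyperplane through [v], normalised to become the local coordinate ['X_j] in the chart. *)
Definition ell k v (j : 'I_n) : {mpoly K[n.+1]} :=
  'X_(lift k j) - (v (lift k j) / v k) *: 'X_k.

Lemma ell_homog k v j : ell k v j \is 1.-homog.
Proof. by rewrite dhomogD ?dhomogN ?dhomogZ ?dhomogXU. Qed.

(** Homogenisation at [v]: ['X_j] goes to [ell k v j] and 1 to ['X_k / v k]. The exponent
    [d - mdeg m] is a truncated subtraction, so the result has degree [d] under [deg_le d f]. *)
Definition hom k v d (f : {mpoly K[n]}) : {mpoly K[n.+1]} :=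
  \sum_(m <- msupp f) f@_m *:
    ((\prod_j ell k v j ^+ m j) * ((v k)^-1 *: 'X_k) ^+ (d - mdeg m)).

Lemma hom_homog k v d f : deg_le d f -> hom k v d f \is d.-homog.
Proof.
move=> /deg_leP hf; rewrite /hom big_seq; apply: rpred_sum => m hm; apply: rpredZ.
have md : (mdeg m <= d)%N by exact: leq_trans (msize_mdeg_lt hm) hf.
have -> : d = (mdeg m + (1 * (d - mdeg m)))%N by lia.
apply: dhomogM; last first.
  by rewrite mul1n addnC subnK // -[X in X.-homog]mul1n; apply/dhomogMn/rpredZ/dhomogXU.
rewrite mdegE; apply: dhomog_prod_seq => j _.
by rewrite -[X in X.-homog]mul1n; apply/dhomogMn/ell_homog.
Qed.

Section Fixed.
Variables (k : 'I_n.+1) (v : 'I_n.+1 -> K).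
Hypothesis vk : v k != 0.

Lemma ell_chart j : ell k v j \mPo chart k v = 'X_j.
Proof.
rewrite comp_mpolyB comp_mpolyZ chart_lift chart_pivot scale_mpolyC divfK //.
by rewrite addrAC subrr add0r.
Qed.

Lemma homK d f : hom k v d f \mPo chart k v = f.
Proof.
rewrite /hom raddf_sum [RHS]mpolyE; apply: eq_bigr => m _ /=.
rewrite comp_mpolyZ rmorphM rmorphXn rmorph_prod /= comp_mpolyZ chart_pivot.
rewrite scale_mpolyC mulVf // mpolyC1 expr1n mulr1 mpolyXE_id; congr (_ *: _).
by apply: eq_bigr => j _; rewrite rmorphXn /= ell_chart.
Qed.

(** The chart reaches every point outside ['X_k = 0]: a point where [F * 'X_k] is nonzero is
    rescaled until its coordinate [k] equals [v k]. *)
Lemma chart_inj d F : F \is d.-homog -> F \mPo chart k v = 0 -> F = 0.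
Proof.
move=> hF e; apply: contraTeq isT => F0.
have /mpoly_nonroot[x] : F * 'X_k != 0.
  by rewrite mulf_neq0 // -msize_poly_eq0 msizeX.
rewrite mevalM mevalXU mulf_eq0 negb_or => /andP[Fx xk].
pose w := fun j => v k / x k * x (lift k j) - v (lift k j).
have := meval0 w; rewrite -e comp_mpoly_meval.
rewrite (@meval_eq _ _ _ (fun i => (v k / x k) * x i)); last first.
  move=> i; rewrite tnth_mktuple; case: unliftP => [j ->|->].
    by rewrite mevalD mevalC mevalXU /w addrC subrK.
  by rewrite mevalC divfK.
rewrite (meval_homog _ _ hF) => /eqP.
by rewrite mulf_eq0 expf_eq0 mulf_eq0 invr_eq0 (negPf vk) (negPf xk) andbF (negPf Fx).
Qed.

Lemma chart_eq d F G : F \is d.-homog -> G \is d.-homog ->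
  F \mPo chart k v = G \mPo chart k v -> F = G.
Proof.
move=> hF hG e; apply/eqP; rewrite -subr_eq0; apply/eqP; apply: (@chart_inj d).
  by rewrite dhomogD ?dhomogN.
by rewrite comp_mpolyB e subrr.
Qed.
End Fixed.

Definition nonprop (u w : 'I_n.+1 -> K) := exists a b, u a * w b != u b * w a.

Lemma nonprop_sym u w : nonprop u w -> nonprop w u.
Proof.
by move=> [a [b h]]; exists a, b; rewrite mulrC [w b * _]mulrC eq_sym.
Qed.

Lemma separating_form u w : nonprop u w ->
  exists l : {mpoly K[n.+1]}, [/\ l \is 1.-homog, l.@[u] = 0 & l.@[w] != 0].
Proof.
move=> [a [b h]]; exists (u a *: 'X_b - u b *: 'X_a); split.
- by rewrite dhomogD ?dhomogN ?dhomogZ ?dhomogXU.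
- by rewrite mevalB !mevalZ !mevalXU mulrC subrr.
- by rewrite mevalB !mevalZ !mevalXU subr_eq0.
Qed.

(* Product of powers of lines through the other points, corrected at [i] by a
   truncated inverse of its local equation. *)
Lemma interpolation (I : finType) (k : I -> 'I_n.+1) (v : I -> 'I_n.+1 -> K) N d
    (g : I -> {mpoly K[n]}) :
  (forall i, v i (k i) != 0) -> (forall i j, i != j -> nonprop (v i) (v j)) ->
  (#|I| * N <= d)%N ->
  exists2 F, F \is d.-homog & forall i, ord_ge N (F \mPo chart (k i) (v i) - g i).
Proof.
move=> vk np hd.
have loc i : exists F, [/\ F \is d.-homog, ord_ge N (F \mPo chart (k i) (v i) - g i)
    & forall j, j != i -> ord_ge N (F \mPo chart (k j) (v j))].
  have /fin_all_exists[l hl] j : exists l : {mpoly K[n.+1]},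
      [/\ l \is 1.-homog, l.@[v j] = 0 & j != i -> l.@[v i] != 0].
    have [->|ji] := eqVneq j i; first by exists 0; rewrite dhomog0 meval0.
    by have [l [? ? ?]] := separating_form (np j i ji); exists l.
  pose P := \prod_(j | j != i) l j ^+ N.
  have hP : P \is (#|I|.-1 * N).-homog.
    rewrite -(@cardC1 I i) -sum_nat_const; apply: dhomog_prod_seq => j _.
    by rewrite -[X in X.-homog]mul1n; apply: dhomogMn; case: (hl j).
  have I0 : (0 < #|I|)%N by apply/card_gt0P; exists i.
  have [w hw] : exists w, ord_ge N (1 - (P \mPo chart (k i) (v i)) * w).
    apply: local_inverse; rewrite chart_coef0 rmorph_prod /=.
    apply/prodf_neq0 => j ji; rewrite rmorphXn expf_neq0 //=; by case: (hl j) => _ _ ->.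
  pose Q := trunc N (g i * w); exists (P * hom (k i) (v i) (d - #|I|.-1 * N) Q); split.
  - have -> : d = (#|I|.-1 * N + (d - #|I|.-1 * N))%N by nia.
    apply: dhomogM => //; rewrite addKn; apply: hom_homog; apply/deg_leP.
    by apply: leq_trans (msize_trunc _ _) _; nia.
  - rewrite rmorphM /= homK //; set p := P \mPo _ in hw *.
    have -> : p * Q - g i = - (p * (g i * w - Q)) - (1 - p * w) * g i by ring.
    apply: ord_geB; last exact: ord_geMr.
    by apply/ord_geN/ord_geMl/ord_ge_trunc.
  - move=> j ji; rewrite rmorphM /=; apply: ord_geMr.
    rewrite /P (bigD1 j) //= rmorphM /= rmorphXn /=; apply/ord_geMr/ord_geXn/ord_ge1P.
    by rewrite chart_coef0; case: (hl j).
have [F hF] := fin_all_exists loc.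
exists (\sum_i F i); first by apply: rpred_sum => i _; case: (hF i).
move=> i; rewrite (bigD1 i) //= raddfD /= addrAC; apply: ord_geD; first by case: (hF i).
by rewrite raddf_sum /=; apply: ord_ge_sum => j ji; case: (hF j) => _ _; apply; rewrite eq_sym.
Qed.
End Chart.

(** * Forms in the ideal of a point *)

Section Decomposition.
Variable K : numFieldType.

(** Each monomial is charged to one variable dividing it, which lowers order and degree by one
    simultaneously. Both bounds are kept because the pieces are homogenised again afterwards. *)
Lemma local_decomp n (f : {mpoly K[n]}) k d : ord_ge k.+1 f -> deg_le d.+1 f ->
  exists2 h : 'I_n -> {mpoly K[n]}, forall j, ord_ge k (h j) /\ deg_le d (h j)
    & f = \sum_j 'X_j * h j.
Proof.
move=> of_ df; pose ix (m : 'X_{1..n}) := [pick j | m j != 0%N].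
pose h j := \sum_(m <- msupp f | ix m == Some j) f@_m *: 'X_[m - U_(j)].
have ixP m j : ix m == Some j -> (U_(j) <= m)%MM.
  by rewrite /ix; case: pickP => // j' hj' /eqP[<-]; rewrite lep1mP.
have dg m j : ix m == Some j -> mdeg m = (mdeg (m - U_(j))).+1.
  by move=> /ixP hm; rewrite -{1}(submK hm) mdegD mdeg1 addn1.
exists h => [j|].
  split.
    rewrite /h big_seq_cond; apply: ord_ge_sum => m /andP[hm hj].
    apply/ord_geZ/(ord_ge_le _ (@ord_geXm _ _ _)).
    rewrite -ltnS -(dg _ _ hj) leqNgt; apply: contraTN hm => /of_.
    by rewrite mcoeff_msupp => ->; rewrite eqxx.
  rewrite /h big_seq_cond; apply: deg_le_sum => m /andP[hm hj].
  apply/deg_leZ/deg_leP; rewrite msizeX -(dg _ _ hj).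
  by rewrite leqNgt; apply: contraTN hm => /df; rewrite mcoeff_msupp => ->; rewrite eqxx.
rewrite {1}[f]mpolyE.
transitivity (\sum_(m <- msupp f) \sum_(j | ix m == Some j) f@_m *: 'X_[m]).
  rewrite [LHS]big_seq [RHS]big_seq; apply: eq_bigr => m hm.
  have: exists j, m j != 0%N.
    apply/existsP; rewrite -negb_forall; apply: contraTN hm => /forallP z.
    have -> : m = 0%MM by apply/mnmP => i; rewrite mnm0E; apply/eqP.
    by rewrite mcoeff_msupp negbK; apply/eqP/of_; rewrite mdeg0.
  rewrite /ix; case: pickP => [j hj _|hn [j hj]]; last by rewrite hn in hj.
  by rewrite (eq_bigl (pred1 j)) ?big_pred1_eq // => j'; rewrite eq_sym.
rewrite (exchange_big_dep xpredT) //=; apply: eq_bigr => j _.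
rewrite mulr_sumr; apply: eq_bigr => m /ixP hm.
by rewrite -scalerAr -mpolyXD addmC submK.
Qed.

Lemma homog_decomp n k (v : 'I_n.+1 -> K) d l F : v k != 0 -> F \is d.+1.-homog ->
  ord_ge l.+1 (F \mPo chart k v) ->
  exists2 h : 'I_n -> {mpoly K[n.+1]},
    forall j, h j \is d.-homog /\ ord_ge l (h j \mPo chart k v)
    & F = \sum_j ell k v j * h j.
Proof.
move=> vk hF oF; have [h hh e] := local_decomp oF (chart_deg k v hF).
exists (fun j => hom k v d (h j)) => [j|].
  by have [? ?] := hh j; rewrite homK // hom_homog.
apply: (chart_eq vk hF); first apply: rpred_sum => j _.
  by apply: (@dhomogM _ _ _ 1 _ d); [exact: ell_homog | case: (hh j) => _; apply: hom_homog].
by rewrite e raddf_sum; apply: eq_bigr => j _ /=; rewrite rmorphM /= ell_chart // homK.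
Qed.
End Decomposition.

(** * A graded Nullstellensatz *)

Section Subspaces.
Variables (K : fieldType) (V : vectType K).

(** Vectors satisfying [P] are adjoined as long as one lies outside the current subspace; its
    codimension bounds the number of steps. *)
Lemma vspace_of_prop (P : V -> Prop) : P 0 ->
  (forall c u v, P u -> P v -> P (c *: u + v)) ->
  exists U : {vspace V}, forall v, v \in U <-> P v.
Proof.
move=> P0 Plin.
have grow k (U : {vspace V}) : (forall v, v \in U -> P v) ->
    (\dim {:V} - \dim U <= k)%N -> exists U' : {vspace V}, forall v, v \in U' <-> P v.
  elim: k U => [|k IH] U hU hk; have [[v [Pv vU]]|hn] :=
      EM (exists v, P v /\ v \notin U).
  - have /subvP/(_ v (memvf v)) : (fullv <= U)%VS.
      by rewrite -(geq_leqif (dimv_leqif_sup (subvf U))); lia.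
    by rewrite (negPf vU).
  - by exists U => v; split=> [/hU //|Pv]; apply/negPn/negP => nU; apply: hn; exists v.
  - apply: (IH (U + <[v]>)%VS) => [w /memv_addP[u uU [_ /vlineP[c ->] ->]]|].
      by rewrite addrC; apply: Plin => //; apply: hU.
    have : (\dim U < \dim (U + <[v]>))%N.
      rewrite (ltn_leqif (dimv_leqif_sup (addvSl U _))) subv_add subvv /=.
      by rewrite -memvE.
    by lia.
  - by exists U => v; split=> [/hU //|Pv]; apply/negPn/negP => nU; apply: hn; exists v.
by apply: (grow _ 0%VS _ (leqnn _)) => v; rewrite memv0 => /eqP ->.
Qed.

(** Such an endomorphism stands in for the projection onto the quotient by [U]. *)
Lemma lker_exists (U : {vspace V}) : exists f : 'End(V), lker f = U.
Proof.
exists (\1 - projv U)%VF; apply/vspaceP => v.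
rewrite memv_ker add_lfunE opp_lfunE id_lfunE subr_eq0.
apply/eqP/idP => [->|vU]; first exact: memv_proj.
by rewrite projv_id.
Qed.
End Subspaces.

(** * Maps from [T/A] to [T'/A'] *)

Section Quotients.
Variables (K : numClosedFieldType) (V W : vectType K).
Variables (T A : {vspace V}) (T' A' : {vspace W}).
Hypotheses (AT : (A <= T)%VS) (AT' : (A' <= T')%VS).

Section OneMap.
Variable f : 'Hom(V, W).
Hypotheses (fT : (f @: T <= T')%VS) (fA : (f @: A <= A')%VS).
Hypothesis surj : (T' <= A' + f @: T)%VS.

(** [U/A] is the kernel of the map that [f] induces from [T/A] onto [T'/A']. *)
Lemma quotient_dim : exists U : {vspace V}, [/\ (A <= U)%VS, (U <= T)%VS,
  forall v, v \in T -> f v \in A' -> v \in U & (\dim T' + \dim U = \dim T + \dim A')%N].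
Proof.
have [p hp] := lker_exists A'.
exists (T :&: lker (p \o f))%VS; split.
- rewrite subv_cap AT; apply/subvP => v vA; rewrite memv_ker comp_lfunE -memv_ker hp.
  by apply: (subvP fA); apply: memv_img.
- exact: capvSl.
- by move=> v vT; rewrite memv_cap vT memv_ker comp_lfunE -memv_ker hp.
have := limg_ker_dim (p \o f) T; have := limg_ker_dim p T'.
rewrite hp (capv_idPr AT') limg_comp.
have -> : (p @: T')%VS = (p @: (f @: T))%VS.
  apply/eqP; rewrite eqEsubv (limgS p fT) andbT.
  apply: subv_trans (limgS p surj) _; rewrite limgD subv_add subvv andbT.
  by apply/subvP => _ /memv_imgP[v vA ->]; rewrite -hp memv_ker in vA; rewrite (eqP vA) mem0v.
by lia.
Qed.

Lemma quotient_le : (\dim T' + \dim A <= \dim T + \dim A')%N.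
Proof.
by have [U [AU _ _ <-]] := quotient_dim; rewrite leq_add2l dimvS.
Qed.

Lemma quotient_inj v : (\dim T' + \dim A = \dim T + \dim A')%N ->
  v \in T -> f v \in A' -> v \in A.
Proof.
have [U [AU UT hU <-]] := quotient_dim => /eqP; rewrite eqn_add2l => e vT fv.
by rewrite (eqP (_ : A == U)) ?hU // eqEdim AU -(eqP e) leqnn.
Qed.
End OneMap.

(** On a complement [C] of [A] in [T], [g] can be divided by [f] modulo [A'] because [f] is onto;
    over an algebraically closed field the matrix of this division has an eigenvector. *)
Lemma quotient_eigen (f g : 'Hom(V, W)) v0 :
  (f @: T <= T')%VS -> (f @: A <= A')%VS -> (g @: T <= T')%VS ->
  (T' <= A' + f @: T)%VS -> (\dim T' + \dim A = \dim T + \dim A')%N ->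
  v0 \in T -> v0 \notin A ->
  exists c, exists v, [/\ v \in T, v \notin A & g v - c *: f v \in A'].
Proof.
move=> fT fA gT surj eqd v0T v0A.
have [p hp] := lker_exists A'.
pose C := ((\1 - projv A)%VF @: T)%VS.
have prE v : (\1 - projv A)%VF v = v - projv A v.
  by rewrite add_lfunE opp_lfunE id_lfunE.
have CT : (C <= T)%VS.
  apply/subvP => _ /memv_imgP[v vT ->]; rewrite prE rpredB //.
  exact/(subvP AT)/memv_proj.
have CA v : v \in C -> v \in A -> v = 0.
  case/memv_imgP => w wT ->; rewrite prE => h.
  have := projv_id h; rewrite linearB /= (projv_id (memv_proj A w)) subrr => e.
  by rewrite -e.
have dC : (0 < \dim C)%N.
  rewrite lt0n dimv_eq0; apply: contraNneq v0A => C0.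
  have : (\1 - projv A)%VF v0 \in C by apply: memv_img.
  rewrite C0 memv0 prE subr_eq0 => /eqP ->; exact: memv_proj.
pose F := (p \o f \o projv C)%VF.
have FC v : v \in C -> F v = p (f v) by move=> vC; rewrite !comp_lfunE projv_id.
have limF v : v \in T -> p (g v) \in limg F.
  move=> vT; have /(subvP surj)/memv_addP[a aA' [_ /memv_imgP[t tT ->] ->]] :
    g v \in T' by apply: (subvP gT); apply: memv_img.
  rewrite linearD /= (_ : p a = 0) ?add0r; last by apply/eqP; rewrite -memv_ker hp.
  have tC : t - projv A t \in C by rewrite -prE; apply: memv_img.
  have -> : p (f t) = F (t - projv A t); last by apply: memv_img; apply: memvf.
  rewrite FC // !linearB /= (_ : p (f (projv A t)) = 0) ?subr0 //.
  apply/eqP; rewrite -memv_ker hp; apply: (subvP fA); apply: memv_img; exact: memv_proj.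
pose E v := projv C ((F^-1)%VF (p (g v))).
have EC v : E v \in C by apply: memv_proj.
have FE v : v \in C -> p (f (E v)) = p (g v).
  move=> vC; rewrite -FC //.
  have -> : F (E v) = F ((F^-1)%VF (p (g v))).
    by rewrite /E /F !comp_lfunE (projv_id (memv_proj C _)).
  exact/limg_lfunVK/limF/(subvP CT).
pose b := vbasis C.
pose M := \matrix_(i < \dim C, j < \dim C) coord b j (E b`_i).
have [c /eigenvalueP[u /matrixP uM u0]] := eigenvalue_closed M dC.
have bC i : (i < \dim C)%N -> b`_i \in C.
  by move=> hi; apply: vbasis_mem; apply: mem_nth; rewrite size_tuple.
pose z := \sum_i u 0 i *: b`_i.
have zC : z \in C by apply: rpred_sum => i _; apply/rpredZ/bC.
have z_neq0 : z != 0.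
  apply: contra_neq u0 => z0; apply/rowP => i; rewrite mxE.
  have /freeP := basis_free (vbasisP C); exact.
have p_lin : p (g z) = c *: p (f z).
  rewrite /z !linear_sum /=.
  have -> : \sum_i p (g (u 0 i *: b`_i)) = \sum_i u 0 i *: p (f (E b`_i)).
    by apply: eq_bigr => i _; rewrite !linearZ /= FE ?bC.
  have -> : \sum_i u 0 i *: p (f (E b`_i)) = \sum_i \sum_j (u 0 i * M i j) *: p (f b`_j).
    apply: eq_bigr => i _; rewrite {1}(coord_vbasis (EC b`_i)) !linear_sum /=.
    by apply: eq_bigr => j _; rewrite !linearZ /= scalerA mxE mulrC.
  rewrite exchange_big /=; apply: eq_bigr => j _.
  have := uM 0 j; rewrite !mxE => e.
  by rewrite !linearZ /= scalerA [u 0 j * c]mulrC -e scaler_suml.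
exists c, z; split; first exact: (subvP CT).
  by apply: contraNN z_neq0 => /(CA z zC) ->.
by rewrite -hp memv_ker linearB linearZ /= p_lin subrr.
Qed.
End Quotients.

Lemma nonincreasing_stable (d : nat -> nat) n0 :
  (forall n, (n0 <= n)%N -> (d n.+1 <= d n)%N) ->
  exists2 n1, (n0 <= n1)%N & forall n, (n1 <= n)%N -> d n = d n1.
Proof.
move=> hd; move: {2}(d n0) (leqnn (d n0)) => b.
elim: b n0 hd => [|b IH] n0 hd hb; have [[n [hn dn]]|h] :=
    EM (exists n, (n0 <= n)%N /\ (d n < d n0)%N).
- by move: dn; rewrite ltnNge (leq_trans hb).
- exists n0 => // n hn; apply/eqP; rewrite eqn_leq; apply/andP; split.
    elim: n hn => [|n IHn]; first by rewrite leqn0 => /eqP ->.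
    rewrite leq_eqVlt => /orP[/eqP <- //|]; rewrite ltnS => hn.
    exact: leq_trans (hd _ hn) (IHn hn).
  by rewrite leqNgt; apply/negP => dn; apply: h; exists n.
- have [n1 h1 h2] := IH n (fun m hm => hd m (leq_trans hn hm)) (leq_trans dn hb).
  by exists n1 => //; apply: leq_trans h1.
- exists n0 => // n hn; apply/eqP; rewrite eqn_leq; apply/andP; split.
    elim: n hn => [|n IHn]; first by rewrite leqn0 => /eqP ->.
    rewrite leq_eqVlt => /orP[/eqP <- //|]; rewrite ltnS => hn.
    exact: leq_trans (hd _ hn) (IHn hn).
  by rewrite leqNgt; apply/negP => dn; apply: h; exists n.
Qed.

(** * Points in the support of a graded module *)

Section GradedModules.
Variables (K : numClosedFieldType) (N delta : nat).
Local Notation S := {mpoly K[N.+1]}.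
Implicit Types (T A : nat -> S -> Prop) (l : S).

(** A graded module is presented as [T/A] with both terms of this kind. The offset [delta] separates
    the index from the degree of the forms: for Jacobian determinants the index is the degree of the
    entries of [P]. *)
Record graded_sub T : Prop := GradedSub {
  gs_homog : forall n f, T n f -> f \is (n + delta).-homog;
  gs_zero : forall n, T n 0;
  gs_lin : forall n c f g, T n f -> T n g -> T n (c *: f + g);
  gs_var : forall n i f, T n f -> T n.+1 ('X_i * f) }.

Definition linear_form j c k : S := 'X_j - c *: 'X_k.

Lemma linear_form_homog j c k : linear_form j c k \is 1.-homog.
Proof. by rewrite dhomogD ?dhomogN ?dhomogZ ?dhomogXU. Qed.

Section Closure.
Variables (T : nat -> S -> Prop) (hT : graded_sub T).

Lemma gsD n f g : T n f -> T n g -> T n (f + g).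
Proof. by move=> hf hg; rewrite -[f]scale1r; apply: gs_lin. Qed.

Lemma gsZ n c f : T n f -> T n (c *: f).
Proof. by move=> hf; rewrite -[_ *: _]addr0; apply: gs_lin => //; apply: gs_zero. Qed.

Lemma gsN n f : T n f -> T n (- f).
Proof. by move=> hf; rewrite -scaleN1r; apply: gsZ. Qed.

Lemma gs_sum n (I : Type) (s : seq I) (F : I -> S) :
  (forall i, T n (F i)) -> T n (\sum_(i <- s) F i).
Proof. by move=> h; elim/big_ind: _ => //; [exact: gs_zero | exact: gsD]. Qed.

Lemma gs_linear_form n j c k f : T n f -> T n.+1 (linear_form j c k * f).
Proof.
move=> hf; rewrite mulrBl -scalerAl; apply: gsD; first exact: gs_var.
by apply: gsN; apply: gsZ; apply: gs_var.
Qed.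

Lemma gs_vspace n : exists U : {vspace dhomog N.+1 K (n + delta)},
  forall p, p \in U <-> T n (val p).
Proof.
apply: (@vspace_of_prop _ _ (fun p : dhomog N.+1 K (n + delta) => T n (val p))).
  exact: (gs_zero hT).
by move=> c u v hu hv; apply: (gs_lin hT).
Qed.
End Closure.

(** The submodule [A + l T]; dividing [T] by it makes [l] act as zero on [T/A]. In index 0 there is
    nothing below to multiply by [l]. *)
Definition shift l T A n (f : S) : Prop :=
  if n is n'.+1 then exists a g, [/\ A n a, T n' g & f = a + l * g] else A n f.

Definition gsub_of A T := forall n f, A n f -> T n f.

Lemma shift_graded j c k T A : graded_sub T -> graded_sub A -> gsub_of A T ->
  let B := shift (linear_form j c k) T A in
  [/\ graded_sub B, gsub_of B T & gsub_of A B].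
Proof.
move=> hT hA AT B; have BT : gsub_of B T.
  case=> [|n] f /=; first exact: AT.
  by move=> [a [g [ha hg ->]]]; apply: (gsD hT); [exact: AT | exact: gs_linear_form].
have AB : gsub_of A B.
  case=> [|n] f hf //=; exists f, 0; split=> //; first exact: gs_zero.
  by rewrite mulr0 addr0.
split=> //; split.
- by move=> n f /BT; apply: gs_homog.
- by move=> n; apply: AB; apply: gs_zero.
- case=> [|n] d f g /=; first exact: gs_lin.
  move=> [a [u [ha hu ->]]] [b [w [hb hw ->]]]; exists (d *: a + b), (d *: u + w).
  by split; [exact: gs_lin | exact: gs_lin | rewrite scalerDr mulrDr -scalerAr addrACA].
- move=> n i f; case: n => [hf|n /=].
    by apply: AB; apply: gs_var.
  move=> [a [g [ha hg ->]]]; exists ('X_i * a), ('X_i * g).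
  by split; [exact: gs_var | exact: gs_var | rewrite mulrDr mulrCA].
Qed.

Section Step.
Variables (T A : nat -> S -> Prop).
Hypotheses (hT : graded_sub T) (hA : graded_sub A) (AT : gsub_of A T).

Definition onto_from l n0 := forall n, (n0 <= n)%N -> forall f, T n.+1 f ->
  exists a g, [/\ A n.+1 a, T n g & f = a + l * g].

Definition proper_from (B : nat -> S -> Prop) n0 :=
  forall n, (n0 <= n)%N -> exists2 f, T n f & ~ B n f.

Definition mul_form l (hl : l \is 1.-homog) d (p : dhomog N.+1 K d) :
  dhomog N.+1 K d.+1 := DHomog (dhomogM hl (dhomog_is_dhomog p)).

Lemma mul_form_linear l (hl : l \is 1.-homog) d : linear (mul_form hl (d := d)).
Proof.
by move=> c u v; apply: val_inj; rewrite /= mulrDr -scalerAr.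
Qed.

Lemma mul_hom l d : l \is 1.-homog ->
  exists h : 'Hom(dhomog N.+1 K d, dhomog N.+1 K d.+1), forall p, val (h p) = l * val p.
Proof.
move=> hl; pose L := GRing.isLinear.Build _ _ _ _ _ (mul_form_linear hl (d := d)).
pose M : {linear _ -> _} := HB.pack (mul_form hl (d := d)) L.
by exists (linfun M) => p; rewrite lfunE.
Qed.

(** Since ['X_k] acts surjectively, the dimensions of [T/A] decrease to a constant, from where
    ['X_k] is bijective. An eigenvector of ['X_i / 'X_k] in one index, multiplied by powers of
    ['X_k], gives nonzero classes killed by ['X_i - c 'X_k] in all later indices. *)
Lemma eigen_step k i n0 : onto_from 'X_k n0 -> proper_from A n0 ->
  exists c n1, (n0 <= n1)%N /\ proper_from (shift (linear_form i c k) T A) n1.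
Proof.
move=> sur pr.
pose UT n := sval (cid (gs_vspace hT n)); pose UA n := sval (cid (gs_vspace hA n)).
have inT n p : p \in UT n <-> T n (val p) := svalP (cid (gs_vspace hT n)) p.
have inA n p : p \in UA n <-> A n (val p) := svalP (cid (gs_vspace hA n)) p.
have lift n f : T n f -> exists p : dhomog N.+1 K (n + delta), val p = f.
  by move=> /(gs_homog hT) hf; exists (DHomog hf).
have AT' n : (UA n <= UT n)%VS by apply/subvP => p /inA h; apply/inT/AT.
have img (B : nat -> S -> Prop) (U : forall n, {vspace dhomog N.+1 K (n + delta)})
    j c n (h : 'Hom(dhomog N.+1 K (n + delta), dhomog N.+1 K (n.+1 + delta))) :
    graded_sub B -> (forall n p, p \in U n <-> B n (val p)) ->
    (forall p, val (h p) = linear_form j c k * val p) -> (h @: U n <= U n.+1)%VS.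
  move=> hB hU hh; apply/subvP => _ /memv_imgP[p /hU hp ->]; apply/hU; rewrite hh.
  exact: gs_linear_form.
have XkE : 'X_k = linear_form k 0 k by rewrite /linear_form scale0r subr0.
have [x hx] : exists x : forall n, 'Hom(dhomog N.+1 K (n + delta), dhomog N.+1 K (n.+1 + delta)),
    forall n p, val (x n p) = linear_form k 0 k * val p.
  exists (fun n => sval (cid (mul_hom (n + delta) (linear_form_homog k 0 k)))) => n.
  exact: (svalP (cid (mul_hom (n + delta) (linear_form_homog k 0 k)))).
have surU n : (n0 <= n)%N -> (UT n.+1 <= UA n.+1 + x n @: UT n)%VS.
  move=> hn; apply/subvP => p /inT /(sur n hn)[a [g [ha hg e]]].
  have [a' ea] := lift _ _ (AT ha); have [g' eg] := lift _ _ hg.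
  have -> : p = a' + x n g' by apply: val_inj; rewrite e /= hx ea eg -XkE.
  by rewrite memv_add ?memv_img //; [apply/inA; rewrite ea | apply/inT; rewrite eg].
have xT n := img _ _ _ _ _ (x n) hT inT (hx n).
have xA n := img _ _ _ _ _ (x n) hA inA (hx n).
pose d n := (\dim (UT n) - \dim (UA n))%N.
have dn n : (n0 <= n)%N -> (d n.+1 <= d n)%N.
  move=> hn; have := quotient_le (AT' n) (AT' n.+1) (xT n) (xA n) (surU n hn).
  by have := dimvS (AT' n); have := dimvS (AT' n.+1); rewrite /d; lia.
have [n1 h01 dc] := nonincreasing_stable dn.
have dimE n : (n1 <= n)%N ->
    (\dim (UT n.+1) + \dim (UA n) = \dim (UT n) + \dim (UA n.+1))%N.
  move=> hn; have := dc _ hn; rewrite -(dc _ (leqW hn)) /d.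
  by have := dimvS (AT' n); have := dimvS (AT' n.+1); lia.
have [f0 Tf0 Af0] := pr n1 h01; have [v0 e0] := lift _ _ Tf0.
have [y hy] := mul_hom (n1 + delta) (linear_form_homog i 0 k).
have [||c [v [vT vA hv]]] := @quotient_eigen _ _ _ _ _ _ _ (AT' n1) (x n1) y v0
  (xT n1) (xA n1) (img _ _ _ _ _ y hT inT hy) (surU n1 h01) (dimE n1 (leqnn _)).
- by apply/inT; rewrite e0.
- by apply/negP => /inA; rewrite e0.
have chain m : exists p, [/\ p \in UT (m + n1)%N, p \notin UA (m + n1)%N
    & A (m + n1).+1 (linear_form i c k * val p)].
  elim: m => [|m [p [pT pA hp]]].
    exists v; split=> //; have /inA := hv; rewrite raddfB /= linearZ /= hy hx.
    by rewrite /linear_form !scale0r !subr0 mulrBl -scalerAl scalerN.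
  have hm : (n1 <= m + n1)%N by exact: leq_addl.
  exists (x _ p); split; first by apply: (subvP (xT _)); apply: memv_img.
    apply: contraNN pA; apply: (quotient_inj (AT' _) (AT' _) (xT _) (xA _)) => //.
      exact/surU/(leq_trans h01).
    exact: dimE.
  by rewrite hx mulrCA; apply: gs_linear_form.
exists c, n1.+1; split; first exact: leqW.
case=> // n hn; have := chain (n - n1)%N; rewrite subnK // => -[p [pT pA hp]].
(* If ['X_i - c 'X_k] were onto here, equality of dimensions would make it injective, but it kills
   the nonzero class of [p]. *)
apply: contrapT => none.
have [h hh] := mul_hom (n + delta) (linear_form_homog i c k).
have hT' := img _ _ _ _ _ h hT inT hh; have hA' := img _ _ _ _ _ h hA inA hh.
case/negP: pA; apply: (quotient_inj (AT' _) (AT' n.+1) hT' hA') => //.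
- apply/subvP => q /inT qT; have [a [g [ha hg e]]] : shift (linear_form i c k) T A n.+1 (val q).
    by apply: contrapT => nq; apply: none; exists (val q).
  have [a' ea] := lift _ _ (AT ha); have [g' eg] := lift _ _ hg.
  have -> : q = a' + h g' by apply: val_inj; rewrite e /= hh ea eg.
  by rewrite memv_add ?memv_img //; [apply/inA; rewrite ea | apply/inT; rewrite eg].
- exact: dimE.
- by apply/inA; rewrite hh.
Qed.

(** From [n0] on, [T] is generated by multiplying by variables, so surjectivity of ['X_k] in one
    index passes to the next. *)
Lemma onto_from_point n0 n1 k :
  (forall n, (n0 <= n)%N -> forall f, T n.+1 f ->
     exists2 g, forall i, T n (g i) & f = \sum_i 'X_i * g i) ->
  (n0 <= n1)%N ->
  (forall f, T n1.+1 f -> exists a g, [/\ A n1.+1 a, T n1 g & f = a + 'X_k * g]) ->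
  onto_from 'X_k n1.
Proof.
move=> gen h01 h1; suff h m f : T (m + n1).+1 f ->
    exists a g, [/\ A (m + n1).+1 a, T (m + n1)%N g & f = a + 'X_k * g].
  by move=> n hn f; have := h (n - n1)%N f; rewrite subnK.
elim: m f => // m IH f hf.
have [g hg ->] := gen (m + n1).+1 (leq_trans h01 (leqW (leq_addl _ _))) f hf.
have /choice[a /choice[b hab]] i := IH _ (hg i).
exists (\sum_i 'X_i * a i), (\sum_i 'X_i * b i); split.
- by apply: (gs_sum hA) => i; apply: gs_var => //; case: (hab i).
- by apply: (gs_sum hT) => i; apply: gs_var => //; case: (hab i).
- rewrite mulr_sumr -big_split; apply: eq_bigr => i _ /=.
  by have [_ _ ->] := hab i; rewrite mulrDr mulrCA.
Qed.
End Step.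

(* A finitely generated graded module T/A that is nonzero in all large degrees
   has a point q in its support.  The ideal of q is built one variable at a
   time, each new coordinate being an eigenvalue. *)
Theorem graded_point T A n0 : graded_sub T -> graded_sub A -> gsub_of A T ->
  (forall n, (n0 <= n)%N -> forall f, T n.+1 f ->
     exists2 g, forall i, T n (g i) & f = \sum_i 'X_i * g i) ->
  proper_from T A n0 ->
  exists (q : 'I_N.+1 -> K) n, [/\ exists i, q i != 0, (n0 <= n)%N &
    exists2 f, T n.+1 f & ~ exists a g, [/\ A n.+1 a, forall i j, T n (g i j) &
      f = a + \sum_i \sum_j (q i *: 'X_j - q j *: 'X_i) * g i j]].
Proof.
move=> hT hA0 AT0 gen pr0.
(* Invariant after [i] variables: [T/A1] is nonzero in all large indices, and either all these
   variables act as zero on it, or there is a pivot ['X_k] acting surjectively such that each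
   earlier ['X_j] acts as [c j] times ['X_k]. *)
have main i : (i <= N.+1)%N -> exists A1 n1, [/\ graded_sub A1, gsub_of A1 T, gsub_of A A1,
    (n0 <= n1)%N /\ proper_from T A1 n1 &
    (forall j : 'I_N.+1, (j < i)%N -> forall n, (n1 <= n)%N -> forall g, T n g ->
       A1 n.+1 ('X_j * g))
    \/ (exists (k : 'I_N.+1) c, [/\ (k < i)%N, c k = 1, onto_from T A1 'X_k n1 &
       forall j : 'I_N.+1, (j < i)%N -> forall n, (n1 <= n)%N -> forall g, T n g ->
         A1 n.+1 (linear_form j (c j) k * g)])].
  elim: i => [|i IH] hi; first by exists A, n0; split=> //; left.
  have [A1 [n1 [h1 A1T AA1 [n01 pr1] hyp]]] := IH (ltnW hi).
  pose o := Ordinal hi; have case_j (j : 'I_N.+1) : (j < i.+1)%N -> j = o \/ (j < i)%N.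
    by rewrite ltnS leq_eqVlt => /orP[/eqP e|]; [left; apply: val_inj | right].
  case: hyp => [hL|[k [c [ki ck onto hR]]]].
    (* If ['X_o] is onto in a single index it can serve as the pivot; if it is onto in none, killing
       it keeps the quotient nonzero. *)
    have [[n2 [n12 h2]]|none] := EM (exists n2, (n1 <= n2)%N /\ forall f, T n2.+1 f ->
        exists a g, [/\ A1 n2.+1 a, T n2 g & f = a + 'X_o * g]).
      exists A1, n2; split=> //; first by split=> [|n hn];
        [exact: leq_trans n12 | apply: pr1; apply: leq_trans hn].
      right; exists o, (fun j => (j == o)%:R); split=> //; first by rewrite eqxx.
        exact: (onto_from_point hT h1 gen (leq_trans n01 n12)).
      move=> j /case_j[->|ji] n hn g hg.
        by rewrite /linear_form eqxx scale1r subrr mul0r; apply: gs_zero.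
      have -> : (j == o) = false by apply/eqP => e; rewrite e ltnn in ji.
      rewrite /linear_form scale0r subr0; apply: hL => //; exact: leq_trans hn.
    have XoE : 'X_o = linear_form o 0 o by rewrite /linear_form scale0r subr0.
    have [hB BT AB] := shift_graded o 0 o hT h1 A1T; rewrite -XoE in hB BT AB.
    exists (shift 'X_o T A1), n1.+1; split=> //.
    - by move=> n f /AA1; apply: AB.
    - split; first exact: leqW.
      case=> // n hn; apply: contrapT => nf; apply: none; exists n; split=> // f Tf.
      by apply: contrapT => h; apply: nf; exists f.
    - left=> j /case_j[->|ji] n hn g hg; last by apply: AB; apply: hL => //; apply: ltnW.
      by exists 0, g; rewrite add0r; split=> //; apply: gs_zero.
  have [c' [n2 [n12 pr2]]] := eigen_step hT h1 A1T o onto pr1.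
  have [hB BT AB] := shift_graded o c' k hT h1 A1T.
  exists (shift (linear_form o c' k) T A1), n2; split=> //.
  - by move=> n f /AA1; apply: AB.
  - by split=> //; apply: leq_trans n12.
  right; exists k, (fun j => if j == o then c' else c j); split.
  - exact: ltnW.
  - by case: eqP => // e; rewrite e ltnn in ki.
  - move=> n hn f Tf; have [a [g [ha hg ->]]] := onto n (leq_trans n12 hn) f Tf.
    by exists a, g; split=> //; apply: AB.
  - move=> j /case_j[->|ji] n hn g hg.
      by rewrite eqxx; exists 0, g; rewrite add0r; split=> //; apply: gs_zero.
    have -> : (j == o) = false by apply/eqP => e; rewrite e ltnn in ji.
    by apply: AB; apply: hR => //; apply: leq_trans hn.
have [A1 [n1 [h1 A1T AA1 [n01 pr1] hyp]]] := main N.+1 (leqnn _).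
have [f Tf Af] := pr1 n1.+1 (leqW (leqnn _)).
case: hyp => [hL|[k [c [_ ck _ hR]]]].
  (* Without a pivot every variable acts as zero, and generation of [T] would put [f] in [A1]. *)
  case: Af; have [g hg ->] := gen n1 n01 f Tf.
  by apply: (gs_sum h1) => i; apply: hL.
exists c, n1; split=> //; first by exists k; rewrite ck oner_neq0.
exists f => // -[a [g [ha hg e]]]; apply: Af; rewrite e; apply: (gsD h1); first exact: AA1.
apply: (gs_sum h1) => i; apply: (gs_sum h1) => j.
have -> : (c i *: 'X_j - c j *: 'X_i) * g i j =
    linear_form j (c j) k * (c i *: g i j) - linear_form i (c i) k * (c j *: g i j).
  rewrite /linear_form -!mul_mpolyC; ring.
apply: (gsD h1); last apply: (gsN h1); apply: hR => //; exact: gsZ.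
Qed.
End GradedModules.

(** * Ideals of points *)

Section PointIdeals.
Variable K : numFieldType.

Lemma homog_var_decomp n d (f : {mpoly K[n]}) : f \is d.+1.-homog ->
  exists2 g : 'I_n -> {mpoly K[n]}, forall i, g i \is d.-homog & f = \sum_i 'X_i * g i.
Proof.
move=> hf; have [g hg ->] := local_decomp (homog_ord hf) (homog_deg_le hf).
exists g => // i; have [og dg] := hg i; apply/dhomogP => m; rewrite mcoeff_msupp => hm.
apply/eqP; rewrite eqn_leq; apply/andP; split; rewrite leqNgt; apply: contraNN hm.
  by move=> /dg ->.
by move=> /og ->.
Qed.

(** Up to the factor [q k], [ell k q j] is the Koszul form with indices [k] and [j]. This brings
    decompositions along [ell] into the shape of [graded_point]; only the row [i = k] is filled. *)
Lemma ell_koszul n k (q : 'I_n.+1 -> K) (P : {mpoly K[n.+1]} -> Prop) h :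
  q k != 0 -> P 0 -> (forall c f, P f -> P (c *: f)) -> (forall j, P (h j)) ->
  exists2 g, forall i j, P (g i j) &
    \sum_j ell k q j * h j = \sum_i \sum_j (q i *: 'X_j - q j *: 'X_i) * g i j.
Proof.
move=> qk P0 Pz Ph.
pose g i j := if i == k then oapp (fun j' => (q k)^-1 *: h j') 0 (unlift k j) else 0.
exists g => [i j|].
  by rewrite /g; case: eqP => // _; case: unliftP => [j' _|_] /=; [apply: Pz | ].
rewrite (bigD1 k) //= [X in _ = _ + X]big1 ?addr0 => [|i ik]; last first.
  by rewrite big1 // => j _; rewrite /g (negPf ik) mulr0.
rewrite (bigD1_ord k) //= {1}/g unlift_none eqxx mulr0 add0r; apply: eq_bigr => j _.
rewrite /g eqxx liftK /= -scalerAr scalerAl; congr (_ * _).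
by rewrite /ell scalerBr !scalerA mulVf // scale1r [_^-1 * _]mulrC.
Qed.

Section Points.
Variables (I : finType) (k : I -> 'I_3) (v : I -> 'I_3 -> K) (kappa : I -> nat) (M : nat).
Hypotheses (vk : forall i, v i (k i) != 0)
  (np : forall i j, i != j -> nonprop (v i) (v j)) (kM : forall i, (kappa i <= M)%N).
Local Notation loc i F := (F \mPo chart (k i) (v i)).

(* The components at [i0] are corrected by a Koszul syzygy of the two forms
   [ell], one of which is a unit at each of the other points. *)
Lemma point_decomp i0 d f : (#|I| * M <= d)%N -> f \is d.+2.-homog ->
  (forall i, ord_ge (kappa i) (loc i f)) -> ord_ge (kappa i0).+1 (loc i0 f) ->
  exists2 h : 'I_2 -> {mpoly K[3]},
    forall j, h j \is d.+1.-homog /\ forall i, ord_ge (kappa i) (loc i (h j))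
    & f = \sum_j ell (k i0) (v i0) j * h j.
Proof.
move=> hd hf oF oF0; have [h hh e] := homog_decomp (vk i0) hf oF0.
move: e; rewrite big_ord_recl big_ord1.
set l1 := ell _ _ ord0; set l2 := ell _ _ _; set h1 := h ord0; set h2 := h _ => e.
have [[hh1 oh1] [hh2 oh2]] : (h1 \is d.+1.-homog /\ ord_ge (kappa i0) (loc i0 h1))
  /\ (h2 \is d.+1.-homog /\ ord_ge (kappa i0) (loc i0 h2)) by split; apply: hh.
have target i : exists g, if i == i0 then g = 0 else
    forall c, ord_ge M (loc i c - g) -> ord_ge (kappa i) (loc i (h1 + l2 * c)) /\
      ord_ge (kappa i) (loc i (h2 - l1 * c)).
  case: (eqVneq i i0) => [_|ii0]; first by exists 0.
  have eqi c : loc i l1 * loc i (h1 + l2 * c) + loc i l2 * loc i (h2 - l1 * c) = loc i f.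
    rewrite e -!rmorphM -rmorphD /=; congr (_ \mPo _); ring.
  (* Where [l1] is a unit, [c] close to [h2 / l1] makes [h2 - l1 * c] vanish to high order, and then
     [l1 * (h1 + l2 * c)] inherits the order of [f]. In the other case [l2] is a unit and the roles
     are exchanged. *)
  have [u1|u1] := eqVneq (loc i l1)@_0%MM 0; last first.
    have [w hw] := local_inverse M u1; exists (loc i h2 * w) => c hc.
    have o2 : ord_ge (kappa i) (loc i (h2 - l1 * c)).
      apply: ord_ge_le (kM i) _; rewrite rmorphB rmorphM /=.
      have -> : loc i h2 - loc i l1 * loc i c = loc i h2 * (1 - loc i l1 * w)
          - loc i l1 * (loc i c - loc i h2 * w) by ring.
      by apply: ord_geB; apply: ord_geMl.
    split=> //; apply: (ord_ge_cancel u1); rewrite -[X in ord_ge _ X](addrK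
       (loc i l2 * loc i (h2 - l1 * c))) eqi.
    by apply: ord_geB => //; apply: ord_geMl.
  (* The lines [l1] and [l2] meet only at [v i0]. *)
  have u2 : (loc i l2)@_0%MM != 0.
    apply/negP => /eqP u2; have [a [b /eqP]] := np ii0; apply.
    move: u1 u2; rewrite !chart_coef0 /l1 /l2 /ell !mevalB !mevalZ !mevalXU.
    set w := v i0; set z := v i; set kk := k i0 => u1 u2.
    have prop x : z x = w x / w kk * z kk.
      case: (unliftP kk x) => [j ->|->]; last by rewrite divff ?mul1r ?vk.
      have [->|->] : j = ord0 \/ j = lift ord0 ord0.
        by case: j => -[|[|]] //= hj; [left|right]; apply: val_inj.
      - by apply/eqP; rewrite -subr_eq0; apply/eqP.
      - by apply/eqP; rewrite -subr_eq0; apply/eqP.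
    by rewrite (prop a) (prop b); ring.
  have [w hw] := local_inverse M u2; exists (- (loc i h1 * w)) => c hc.
  have o1 : ord_ge (kappa i) (loc i (h1 + l2 * c)).
    apply: ord_ge_le (kM i) _; rewrite rmorphD rmorphM /=.
    have -> : loc i h1 + loc i l2 * loc i c = loc i h1 * (1 - loc i l2 * w)
        + loc i l2 * (loc i c - - (loc i h1 * w)) by ring.
    by apply: ord_geD; apply: ord_geMl.
  split=> //; apply: (ord_ge_cancel u2); rewrite -[X in ord_ge _ X](addKr
     (loc i l1 * loc i (h1 + l2 * c))) eqi.
  by apply: ord_geD => //; apply/ord_geN/ord_geMl.
have [g hg] := fin_all_exists target.
have [c hc oc] := interpolation (N := M) g vk np hd.
have [hl1 hl2] : l1 \is 1.-homog /\ l2 \is 1.-homog by split; apply: ell_homog.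
have oh i : ord_ge (kappa i) (loc i (h1 + l2 * c)) /\ ord_ge (kappa i) (loc i (h2 - l1 * c)).
  have := hg i; case: eqP => [->|_ h']; last exact: h' (oc i).
  move=> g0; have := oc i0; rewrite g0 subr0 => /(ord_ge_le (kM i0)) oc0.
  rewrite rmorphD rmorphB !rmorphM /=.
  by split; [apply: ord_geD | apply: ord_geB] => //; apply: ord_geMl.
exists (fun j => if j == ord0 then h1 + l2 * c else h2 - l1 * c) => [j|].
  split=> [|i]; last by case: (oh i); case: ifP.
  case: ifP => _; rewrite dhomogD ?dhomogN //; exact: (dhomogM hl2 hc) || exact: (dhomogM hl1 hc).
rewrite big_ord_recl big_ord1 /= e -/l1 -/l2; ring.
Qed.
End Points.

Section MorePoints.
Variables (I : finType) (k : I -> 'I_3) (v : I -> 'I_3 -> K) (kappa : I -> nat) (M : nat).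
Hypotheses (vk : forall i, v i (k i) != 0)
  (np : forall i j, i != j -> nonprop (v i) (v j)) (kM : forall i, (kappa i <= M)%N).
Local Notation loc i F := (F \mPo chart (k i) (v i)).

Section ExtraPoint.
Variables (kq : 'I_3) (q : 'I_3 -> K).
Hypotheses (qk : q kq != 0) (nq : forall i, nonprop (v i) q).

Let ko (o : option I) := oapp k kq o.
Let vo (o : option I) := oapp v q o.

Let vko o : vo o (ko o) != 0. Proof. by case: o => [i|]; [exact: vk | exact: qk]. Qed.

Let npo o o' : o != o' -> nonprop (vo o) (vo o').
Proof.
by case: o o' => [i|] [j|] //= h; [exact: np | exact/nonprop_sym/nq].
Qed.

(** [q] joins the configuration with required order 0, so the condition of [point_decomp] at [q] is
    order 1, that is, vanishing there. *)
Lemma vanishing_decomp d f : (#|I|.+1 * M <= d)%N -> f \is d.+2.-homog ->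
  (forall i, ord_ge (kappa i) (loc i f)) -> f.@[q] = 0 ->
  exists2 h : 'I_2 -> {mpoly K[3]},
    forall j, h j \is d.+1.-homog /\ forall i, ord_ge (kappa i) (loc i (h j))
    & f = \sum_j ell kq q j * h j.
Proof.
move=> hd hf oF fq.
have [||||h hh ->] := @point_decomp (option I) ko vo (oapp kappa 0%N) M vko npo _ None d f _ hf.
- by case=> //=.
- by rewrite card_option.
- by case=> [i|] //=; apply: oF.
- by apply/ord_ge1P; rewrite chart_coef0.
exists h => // j; have [? oh] := hh j; split=> // i; exact: (oh (Some i)).
Qed.

Lemma interpolation_extra d N : (0 < N)%N -> (#|I|.+1 * N <= d)%N ->
  exists f, [/\ f \is d.-homog, f.@[q] = 1 & forall i, ord_ge N (loc i f)].
Proof.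
move=> N0 hd; have [|f hf of_] := @interpolation K 2 (option I) ko vo N d
  (fun o => if o is Some _ then 0 else 1) vko npo; first by rewrite card_option.
exists f; split=> // [|i]; last by have := of_ (Some i); rewrite subr0.
have /(ord_ge_le N0)/ord_ge1P := of_ None.
by rewrite mcoeffB mcoeff1 eqxx chart_coef0 => /eqP; rewrite subr_eq0 => /eqP.
Qed.
End ExtraPoint.

Lemma exists_nonprop : exists q, (exists j, q j != 0) /\ forall i, nonprop (v i) q.
Proof.
pose l i : {mpoly K[3]} :=
  v i (k i) *: 'X_(lift (k i) ord0) - v i (lift (k i) ord0) *: 'X_(k i).
have l0 i : l i != 0.
  apply: contraNneq (vk i) => /(congr1 (mcoeff U_(lift (k i) ord0))).
  rewrite mcoeffB !mcoeffZ !mcoeffXU eqxx mulr1 mcoeff0.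
  by rewrite (negPf (neq_lift _ _)) mulr0 subr0 => ->.
have : 'X_ord0 * \prod_i l i != 0.
  by apply: mulf_neq0; [rewrite -msize_poly_eq0 msizeX | apply/prodf_neq0 => i _].
case/mpoly_nonroot => q; rewrite mevalM mevalXU mulf_eq0 negb_or rmorph_prod.
move=> /andP[q0 /prodf_neq0 hq]; exists q; split; first by exists ord0.
move=> i; exists (k i), (lift (k i) ord0); have := hq i isT.
by rewrite /l /= mevalB !mevalZ !mevalXU subr_eq0.
Qed.

(** At an auxiliary point [q], a multiple of one variable corrects the value of [f] to zero; the
    rest lies in the ideal of [q], whose generators are combinations of the variables. This provides
    the generation hypothesis of [graded_point]. *)
Lemma ord_var_decomp d f : (0 < M)%N -> (#|I|.+1 * M <= d)%N -> f \is d.+2.-homog ->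
  (forall i, ord_ge (kappa i) (loc i f)) ->
  exists2 g : 'I_3 -> {mpoly K[3]},
    forall j, g j \is d.+1.-homog /\ forall i, ord_ge (kappa i) (loc i (g j))
    & f = \sum_j 'X_j * g j.
Proof.
move=> M0 hd hf oF; have [q [[kq qk] nq]] := exists_nonprop.
have [u [hu uq ou]] := interpolation_extra qk nq M0 (leqW hd).
pose c := f.@[q] / q kq.
have hXu : 'X_kq * u \is d.+2.-homog by apply: (@dhomogM _ _ _ 1 _ d.+1); rewrite ?dhomogXU.
have oku i : ord_ge (kappa i) (loc i u) by apply: ord_ge_le (kM i) (ou i).
have [|||h hh e] := vanishing_decomp qk nq hd (_ : f - c *: ('X_kq * u) \is d.+2.-homog).
- by rewrite dhomogD ?dhomogN ?dhomogZ.
- move=> i; rewrite comp_mpolyB comp_mpolyZ rmorphM /=.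
  by apply: ord_geB => //; apply/ord_geZ/ord_geMl.
- by rewrite mevalB mevalZ mevalM mevalXU uq mulr1 divfK ?subrr.
have [|||g hg eg] := @ell_koszul 2 kq q (fun f => f \is d.+1.-homog /\
    forall i, ord_ge (kappa i) (loc i f)) h qk.
- by split=> [|i]; rewrite ?dhomog0 ?comp_mpoly0; last exact: ord_ge_zero.
- by move=> a f' [h1 h2]; split=> [|i]; rewrite ?dhomogZ ?comp_mpolyZ; last exact: ord_geZ.
- exact: hh.
exists (fun j => (j == kq)%:R *: (c *: u) + \sum_i (q i *: g i j - q i *: g j i)) => [j|].
  split=> [|i].
    rewrite dhomogD ?dhomogZ //; apply: rpred_sum => x _.
    by rewrite dhomogD ?dhomogN ?dhomogZ //; [case: (hg x j) | case: (hg j x)].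
  rewrite comp_mpolyD; apply: ord_geD.
    by rewrite !comp_mpolyZ; apply: ord_geZ; apply: ord_geZ; apply: oku.
  rewrite (raddf_sum (comp_mpoly (chart (k i) (v i)))) /=.
  apply: ord_ge_sum => x _; rewrite comp_mpolyB !comp_mpolyZ.
  by apply: ord_geB; apply: ord_geZ; [case: (hg x j) | case: (hg j x)].
have -> : f = c *: ('X_kq * u) + \sum_j ell kq q j * h j by rewrite -e addrC subrK.
under [RHS]eq_bigr do rewrite mulrDr.
rewrite big_split /=; congr (_ + _).
  rewrite (bigD1 kq) //= eqxx scale1r scalerAr big1 ?addr0 // => j /negPf ->.
  by rewrite scale0r mulr0.
rewrite eg; under [RHS]eq_bigr do rewrite mulr_sumr.
have -> : \sum_j \sum_i 'X_j * (q i *: g i j - q i *: g j i) =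
    \sum_i \sum_j ('X_j * (q i *: g i j)) - \sum_j \sum_i ('X_j * (q i *: g j i)).
  rewrite [X in _ = X - _]exchange_big /= -sumrB; apply: eq_bigr => j _.
  by rewrite -sumrB; apply: eq_bigr => i _; rewrite mulrBr.
rewrite -sumrB; apply: eq_bigr => i _; rewrite -sumrB; apply: eq_bigr => j _.
rewrite -!mul_mpolyC; ring.
Qed.
End MorePoints.
End PointIdeals.

(** * Binary forms without common zero *)

Section Binary.
Variable K : numClosedFieldType.

(** A point in the support of the quotient by the ideal of the [G t] would be a common zero of them.
    The projective line in question will be an exceptional curve. *)
Lemma binary_generation (G : 'I_3 -> {mpoly K[2]}) (e : 'I_3 -> nat) D :
  (forall t, G t \is (e t).-homog) -> (forall t, (e t <= D)%N) ->
  (forall q, (exists i, q i != 0) -> exists t, (G t).@[q] != 0) ->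
  exists n0, forall n, (n0 <= n)%N -> forall H, H \is (n + D).-homog ->
    exists2 a : 'I_3 -> {mpoly K[2]}, forall t, a t \is (n + (D - e t)).-homog
      & H = \sum_t a t * G t.
Proof.
move=> hG eD ncz.
pose T n (f : {mpoly K[2]}) := f \is (n + D).-homog.
pose A n f := exists2 a : 'I_3 -> {mpoly K[2]}, forall t, a t \is (n + (D - e t)).-homog
  & f = \sum_t a t * G t.
have gT : graded_sub D T.
  split=> //; rewrite /T.
  - by move=> n; rewrite dhomog0.
  - by move=> n c f g hf hg; rewrite dhomogD ?dhomogZ.
  - by move=> n i f hf; apply: (@dhomogM _ _ _ 1); rewrite ?dhomogXU.
have AT : gsub_of A T.
  move=> n f [a ha ->]; apply: rpred_sum => t _.
  have -> : (n + D = n + (D - e t) + e t)%N by have := eD t; lia.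
  exact: dhomogM.
have gA : graded_sub D A.
  split.
  - by move=> n f /AT.
  - by move=> n; exists (fun=> 0) => [t|]; rewrite ?dhomog0 // big1 // => t _; rewrite mul0r.
  - move=> n c f g [a ha ->] [b hb ->]; exists (fun t => c *: a t + b t) => [t|].
      by rewrite dhomogD ?dhomogZ.
    by rewrite scaler_sumr -big_split; apply: eq_bigr => t _; rewrite mulrDl -scalerAl.
  - move=> n i f [a ha ->]; exists (fun t => 'X_i * a t) => [t|].
      by apply: (@dhomogM _ _ _ 1); rewrite ?dhomogXU.
    by rewrite mulr_sumr; apply: eq_bigr => t _; rewrite mulrA.
have gen n f : T n.+1 f -> exists2 g, forall i, T n (g i) & f = \sum_i 'X_i * g i.
  by move=> /homog_var_decomp.
have [[n0 h0]|none] := EM (exists n0, forall H, T n0 H -> A n0 H).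
  exists n0 => n hn; rewrite -(subnK hn); elim: (n - n0)%N => [|m IH] H; first exact: h0.
  move=> /gen[g /= hg ->]; apply: (gs_sum gA) => i; exact: (gs_var gA i (IH _ (hg i))).
have [n _|q [n [[s qs] _ [f Tf]]]] := @graded_point K 1 D T A 0%N gT gA AT (fun n _ => @gen n) _.
  by apply: contrapT => h; apply: none; exists n => H TH; apply: contrapT => nA; apply: h; exists H.
case; have [t Gt] := ncz q (ex_intro _ s qs).
(* Since [G t] is nonzero at [q], subtracting a multiple of [u] from [f] leaves a form in the ideal
   of [q]. *)
pose u := 'X_s ^+ (n.+1 + (D - e t)) * G t.
have Au c : A n.+1 (c *: u).
  exists (fun x => if x == t then c *: 'X_s ^+ (n.+1 + (D - e t)) else 0) => [x|].
    case: eqP => [->|_]; last exact: dhomog0.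
    by rewrite dhomogZ // -[X in X.-homog]mul1n; apply/dhomogMn/dhomogXU.
  rewrite (bigD1 t) //= eqxx big1 ?addr0 => [|x /negPf -> //]; last by rewrite mul0r.
  by rewrite -scalerAl.
pose c := f.@[q] / u.@[q].
have uq : u.@[q] != 0 by rewrite mevalM rmorphXn /= mevalXU mulf_neq0 // expf_neq0.
have [||h hh eh] := @homog_decomp K 1 s q (n + D)%N 0 (f - c *: u) qs.
- by rewrite dhomogD ?dhomogN //; exact: (AT _ _ (Au c)).
- by apply/ord_ge1P; rewrite chart_coef0 mevalB mevalZ divfK ?subrr.
have [|||g hg eg] := @ell_koszul K 1 s q (T n) h qs.
- exact: (gs_zero gT n).
- by move=> a f'; apply: (gsZ gT).
- by move=> j; case: (hh j).
by exists (c *: u), g; split=> //; rewrite -eg -eh addrC subrK.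
Qed.
End Binary.

(** * Derivatives and determinants *)

Section Calculus.
Variable K : idomainType.

Lemma mderivXU n (i j : 'I_n) : ('X_i : {mpoly K[n]})^`M(j) = (i == j)%:R.
Proof.
rewrite mderivX mnm1E; case: eqP => [->|_]; last by rewrite scale0r.
have -> : (U_(j) - U_(j) = 0 :> 'X_{1..n})%MM by apply/mnmP => x; rewrite mnmBE subnn mnm0E.
by rewrite mpolyX0 scale1r.
Qed.

(** The Euler operator multiplies each monomial by its degree. Read coefficientwise, this also
    applies to local equations, which are not homogeneous. *)
Lemma euler_coef n (f : {mpoly K[n]}) m :
  (\sum_i 'X_i * f^`M(i))@_m = f@_m *+ mdeg m.
Proof.
elim/mpolyind: f m => [|c m' f _ _ IH] m.
  by rewrite mcoeff0 mul0rn big1 ?mcoeff0 // => i _; rewrite mderiv0 mulr0.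
have -> : \sum_i 'X_i * (c *: 'X_[m'] + f)^`M(i) =
    c *: \sum_i 'X_i * ('X_[m'])^`M(i) + \sum_i 'X_i * f^`M(i).
  rewrite scaler_sumr -big_split; apply: eq_bigr => i _.
  by rewrite mderivD mderivZ mulrDr -scalerAr.
rewrite !mcoeffD IH mulrnDl !mcoeffZ -mulrnAr; congr (_ * _ + _).
have -> : \sum_i 'X_i * ('X_[m'])^`M(i) = (mdeg m')%:R *: ('X_[m'] : {mpoly K[n]}).
  rewrite mdegE natr_sum scaler_suml; apply: eq_bigr => i _.
  rewrite mderivX -scalerAr; have [->|mi] := eqVneq (m' i) 0%N; first by rewrite !scale0r.
  by rewrite -mpolyXD addmC submK // lep1mP.
by rewrite mcoeffZ mcoeffX mulr_natl; case: eqP => [->|_]; rewrite ?mul0rn.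
Qed.

Lemma euler n d (f : {mpoly K[n]}) : f \is d.-homog -> \sum_i 'X_i * f^`M(i) = d%:R *: f.
Proof.
move=> hf; apply/mpolyP => m; rewrite euler_coef mcoeffZ mulr_natl.
have [e|ne] := eqVneq (mdeg m) d; first by rewrite e.
by rewrite (dhomog_nemf_coeff hf ne) !mul0rn.
Qed.

Lemma deriv_homog n d (f : {mpoly K[n]}) i : f \is d.+1.-homog -> f^`M(i) \is d.-homog.
Proof.
move=> hf; apply/dhomogP => m; rewrite mcoeff_msupp mcoeff_deriv => h; apply/eqP.
apply: contraNT h => ne; rewrite (dhomog_nemf_coeff hf) ?mul0rn //.
by rewrite /= mdegD mdeg1 addn1 eqSS.
Qed.
End Calculus.

Section Charts.
Variables (K : numFieldType) (n : nat).

Lemma chart_deriv k (v : 'I_n.+1 -> K) (F : {mpoly K[n.+1]}) j :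
  (F \mPo chart k v)^`M(j) = F^`M(lift k j) \mPo chart k v.
Proof.
pose P (G : {mpoly K[n.+1]}) := (G \mPo chart k v)^`M(j) = G^`M(lift k j) \mPo chart k v.
have PM G H : P G -> P H -> P (G * H).
  by move=> hG hH; rewrite /P rmorphM /= !mderivM rmorphD !rmorphM /= hG hH.
have P1 : P 1 by rewrite /P comp_mpoly1 -(mpolyC1 n) -(mpolyC1 n.+1) !mderivC comp_mpoly0.
have PX i : P 'X_i.
  rewrite /P mderivXU; case: (unliftP k i) => [j' ->|->].
    rewrite chart_lift mderivD mderivC add0r mderivXU (inj_eq lift_inj).
    by case: eqP => _; rewrite ?comp_mpoly1 ?comp_mpoly0.
  by rewrite chart_pivot mderivC (negPf (neq_lift _ _)) comp_mpoly0.
elim/mpolyind: F => [|c m F _ _ IH]; first by rewrite comp_mpoly0 !mderiv0 comp_mpoly0.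
rewrite comp_mpolyD !mderivD comp_mpolyD IH; congr (_ + _).
rewrite comp_mpolyZ !mderivZ comp_mpolyZ; congr (_ *: _); rewrite -/(P _) mpolyXE_id.
elim/big_ind: _ => // i _; elim: (m i) => // l IHl; rewrite exprS; exact: PM.
Qed.
End Charts.

(** * Determinants of order three *)

Section Determinants.
Variable R : comNzRingType.
Local Notation o0 := (ord0 : 'I_3).
Local Notation o1 := (lift ord0 ord0 : 'I_3).
Local Notation o2 := (lift ord0 (lift ord0 ord0) : 'I_3).
Implicit Types u v w y : 'I_3 -> R.

(** The cross product; with cyclic indices no sign is left over in [det3]. *)
Definition minor v w (t : 'I_3) : R :=
  match val t with
  | 0 => v o1 * w o2 - v o2 * w o1
  | 1 => v o2 * w o0 - v o0 * w o2
  | _ => v o0 * w o1 - v o1 * w o0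
  end.

Definition det3 u v w : R := \sum_t u t * minor v w t.

Lemma det3E u v w : det3 u v w =
  u o0 * (v o1 * w o2 - v o2 * w o1) + u o1 * (v o2 * w o0 - v o0 * w o2)
  + u o2 * (v o0 * w o1 - v o1 * w o0).
Proof. by rewrite /det3 !big_ord_recl big_ord0 addr0 addrA. Qed.

Definition contract y (k : 'I_3) u (t : 'I_3) : R :=
  oapp (fun j => u (lift k j)) (\sum_x y x * u x) (unlift ord0 t).

(** A change of basis of determinant [(-1)^k y_k]. With [y] the homogeneous coordinates in the
    chart, it turns a gradient into a value, by Euler's relation, and two affine derivatives. *)
Lemma det3_contract y k u v w :
  det3 (contract y k u) (contract y k v) (contract y k w) = (-1) ^+ k * y k * det3 u v w.
Proof.
have c0 z : contract y k z o0 = y o0 * z o0 + y o1 * z o1 + y o2 * z o2.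
  by rewrite /contract unlift_none /= !big_ord_recl big_ord0 addr0 addrA.
have c1 z : contract y k z o1 = z (lift k ord0) by rewrite /contract liftK.
have c2 z : contract y k z o2 = z (lift k (lift ord0 ord0)) by rewrite /contract liftK.
rewrite !det3E !c0 !c1 !c2; case: k c0 c1 c2 => -[|[|[|//]]] hk _ _ _.
- have -> : Ordinal hk = o0 by apply: val_inj.
  by rewrite expr0; ring.
- have -> : Ordinal hk = o1 by apply: val_inj.
  have -> : lift o1 ord0 = o0 by apply: val_inj.
  have -> : lift o1 (lift ord0 ord0) = o2 by apply: val_inj.
  have -> : (-1) ^+ o1 = -1 :> R by rewrite /= /bump /= expr1.
  by ring.
- have -> : Ordinal hk = o2 by apply: val_inj.
  have -> : lift o2 ord0 = o0 by apply: val_inj.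
  have -> : lift o2 (lift ord0 ord0) = o1 by apply: val_inj.
  have -> : (-1) ^+ o2 = 1 :> R by rewrite /= /bump /= sqrrN expr1n.
  by ring.
Qed.

Lemma det3_scale_shift (c : R) u v w (a b : R) :
  let f z t := if t == o0 then c * z o0 - (a * z o1 + b * z o2) else z t in
  det3 (f u) (f v) (f w) = c * det3 u v w.
Proof.
move=> f; have f0 z : f z o0 = c * z o0 - (a * z o1 + b * z o2) by [].
have [f1 f2] : (forall z, f z o1 = z o1) /\ (forall z, f z o2 = z o2) by [].
by rewrite !det3E !f0 !f1 !f2; ring.
Qed.

Lemma eq_det3 u u' v v' w w' : u =1 u' -> v =1 v' -> w =1 w' -> det3 u v w = det3 u' v' w'.
Proof. by move=> hu hv hw; rewrite !det3E !hu !hv !hw. Qed.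

End Determinants.

Lemma minor_dependent (F : fieldType) (v w : 'I_3 -> F) : (forall t, minor v w t = 0) ->
  exists a b, (a != 0) || (b != 0) /\ forall x, a * v x + b * w x = 0.
Proof.
move=> h; have hxy x y : v x * w y = v y * w x.
  have := (h ord0, h (lift ord0 ord0), h (lift ord0 (lift ord0 ord0))); rewrite /minor /=.
  move=> [[/eqP h0 /eqP h1] /eqP h2]; rewrite subr_eq0 in h0; rewrite subr_eq0 in h1.
  rewrite subr_eq0 in h2.
  have c (z : 'I_3) : [\/ z = ord0, z = lift ord0 ord0 | z = lift ord0 (lift ord0 ord0)].
    by case: z => -[|[|[|//]]] hz; [apply: Or31 | apply: Or32 | apply: Or33]; apply: val_inj.
  by case: (c x) => ->; case: (c y) => ->; rewrite ?(eqP h0) ?(eqP h1) ?(eqP h2) // mulrC.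
have [/existsP[x wx]|/existsPn w0] := boolP [exists x, w x != 0].
  exists (w x), (- v x); rewrite wx; split=> // y.
  by rewrite mulNr hxy mulrC subrr.
by exists 0, 1; rewrite oner_neq0 orbT; split=> // x; move/negPn/eqP: (w0 x) => ->; rewrite mul0r mulr0 addr0.
Qed.

(** * Counting conditions *)

Section Dimensions.
Variable K : fieldType.

Lemma lfun_exists (V W : vectType K) (f : V -> W) : linear f ->
  exists h : 'Hom(V, W), forall u, h u = f u.
Proof.
move=> lf; pose L := GRing.isLinear.Build _ _ _ _ f lf.
pose M : {linear V -> W} := HB.pack f L.
by exists (linfun M) => p; rewrite lfunE.
Qed.

Lemma conditions_dim (V : vectType K) (J : finType) (phi : J -> V -> K) :
  (forall j c u w, phi j (c *: u + w) = c * phi j u + phi j w) ->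
  exists U : {vspace V}, [/\ forall u, u \in U <-> forall j, phi j u = 0,
    (\dim {:V} <= \dim U + #|J|)%N &
    (forall t : J -> K, exists u, forall j, phi j u = t j) ->
      (\dim U + #|J| = \dim {:V})%N].
Proof.
move=> lphi; have [|h hh] := @lfun_exists V 'rV[K]_#|J| (fun u => \row_i phi (enum_val i) u).
  by move=> c u w; apply/rowP => i; rewrite !mxE lphi.
have dJ : \dim {:'rV[K]_#|J|} = #|J| by rewrite dimvf /dim /= mul1n.
have := limg_ker_dim h fullv; rewrite capfv => dh.
exists (lker h); split.
- move=> u; rewrite memv_ker hh; split=> [/eqP/rowP e j|e].
    by have := e (enum_rank j); rewrite !mxE enum_rankK.
  by apply/eqP/rowP => i; rewrite !mxE e.
- by rewrite -dh leq_add2l -[X in (_ <= X)%N]dJ dimvS ?subvf.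
- move=> sur; rewrite -dh; congr (_ + _)%N; rewrite -[LHS]dJ; congr (\dim _).
  apply/vspaceP => r; rewrite memvf; apply/esym.
  have [u hu] := sur (fun j => r 0 (enum_rank j)).
  apply/memv_imgP; exists u; rewrite ?memvf // hh; apply/rowP => i.
  by rewrite mxE hu enum_valK.
Qed.

(** Pairs [j <= i < k], indexing the monomials [X_0^j X_1^(i-j)] of degree less than [k]. *)
Definition tri k := {i : 'I_k & 'I_i.+1}.

Lemma card_tri k : #|{: tri k}| = 'C(k.+1, 2).
Proof.
rewrite card_tagged sumnE big_map big_enum /= -triangular_sum big_mkord.
rewrite big_ord_recl add0n; apply: eq_bigr => i _; by rewrite card_ord.
Qed.

Definition tri_mon k (t : tri k) : 'X_{1..2} :=
  [multinom (if i == ord0 then tagged t : nat else tag t - tagged t)%N | i < 2].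

Lemma tri_ordP k (f : {mpoly K[2]}) : ord_ge k f <-> forall t : tri k, f@_(tri_mon t) = 0.
Proof.
split=> [h [i j]|h m hm].
  by apply: h; rewrite mdegE big_ord_recl big_ord1 !mnmE /=; have := ltn_ord i;
    have := ltn_ord j; lia.
have hj : (m ord0 < (Ordinal hm).+1)%N by rewrite ltnS /= mdegE (bigD1 ord0) //= leq_addr.
have := h (existT _ (Ordinal hm) (Ordinal hj)); suff -> : tri_mon (existT _ (Ordinal hm) (Ordinal hj)) = m by [].
apply/mnmP => i; rewrite mnmE /=; case: eqP => [-> //|ne].
have -> : i = lift ord0 ord0 by case: i ne => -[|[|//]] hi ne; [case: ne|]; apply: val_inj.
by rewrite mdegE big_ord_recl big_ord1 addKn.
Qed.

Lemma card_tri_sum (I : finType) (kappa : I -> nat) :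
  #|{: {i : I & tri (kappa i)}}| = (\sum_i 'C((kappa i).+1, 2))%N.
Proof.
by rewrite card_tagged sumnE big_map big_enum; apply: eq_bigr => i _; rewrite card_tri.
Qed.
End Dimensions.

Lemma forms_dim (K : numFieldType) (I : finType) (k : I -> 'I_3) (v : I -> 'I_3 -> K)
    (kappa : I -> nat) d : exists U : {vspace dhomog 3 K d},
  (forall u, u \in U <-> forall i, ord_ge (kappa i) (val u \mPo chart (k i) (v i))) /\
  ('C(d + 2, d) <= \dim U + \sum_i 'C((kappa i).+1, 2))%N.
Proof.
pose phi (j : {i : I & tri (kappa i)}) (u : dhomog 3 K d) :=
  (val u \mPo chart (k (tag j)) (v (tag j)))@_(tri_mon (tagged j)).
have [|U [hU dU _]] := conditions_dim (phi := phi).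
  by move=> j c u w; rewrite /phi /= comp_mpolyD comp_mpolyZ mcoeffD mcoeffZ.
exists U; split=> [u|]; last by rewrite -card_tri_sum; move: dU; rewrite dimvf.
rewrite hU; split=> [h i|h [i t]]; first by apply/tri_ordP => t; exact: (h (existT _ i t)).
exact: (proj1 (tri_ordP _ _) (h i)).
Qed.

(** * Singular members of pencils *)

Section LocalFrame.
Variables (K : numFieldType) (k : 'I_3) (v : 'I_3 -> K) (mu e : nat).
Local Notation loc F := (F \mPo chart k v).
Local Notation y x := (loc ('X_x : {mpoly K[3]})).
Local Notation o0 := (ord0 : 'I_3).
Implicit Types (U W : 'I_3 -> {mpoly K[2]}) (P Q R : 'I_3 -> {mpoly K[3]}).

(* For U = grad H, with H of degree e+1 and local equation h, the entries are
   (e+1) ((mu+1) h - X_0 d_0 h - X_1 d_1 h), d_0 h and d_1 h: this frame of the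
   bundle of 1-jets on the plane is adapted to sections with a point of
   multiplicity mu+1. *)
Definition frame U (t : 'I_3) : {mpoly K[2]} :=
  if unlift o0 t is Some j then U (lift k j)
  else mu.+1%:R * (\sum_x y x * U x) - e.+1%:R * (\sum_(j < 2) 'X_j * U (lift k j)).

Definition lframe P := frame (fun x => loc (P x)).

Lemma frame_lift U j : frame U (lift o0 j) = U (lift k j).
Proof. by rewrite /frame liftK. Qed.

Lemma frame0 U : frame U o0 =
  mu.+1%:R * (\sum_x y x * U x) - e.+1%:R * (\sum_(j < 2) 'X_j * U (lift k j)).
Proof. by rewrite /frame unlift_none. Qed.

Lemma ord3P (Pr : 'I_3 -> Prop) : Pr o0 -> (forall j, Pr (lift o0 j)) -> forall t, Pr t.
Proof. by move=> h0 h1 t; case: (unliftP o0 t) => [j ->|->]. Qed.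

Lemma frame_lin a U W t : frame (fun x => a * U x + W x) t = a * frame U t + frame W t.
Proof.
elim/ord3P: t => [|j]; last by rewrite !frame_lift.
rewrite !frame0 !big_ord_recl !big_ord0; ring.
Qed.

Lemma frame_ord N U t : (forall x, ord_ge N (U x)) -> ord_ge N (frame U t).
Proof.
move=> h; elim/ord3P: t => [|j]; last by rewrite frame_lift.
by rewrite frame0; apply: ord_geB; apply: ord_geMl; apply: ord_ge_sum => x _; apply: ord_geMl.
Qed.

Lemma lframe_lin a P Q t : lframe (fun x => a * P x + Q x) t = loc a * lframe P t + lframe Q t.
Proof.
rewrite /lframe -frame_lin; congr (frame _ _).
by apply/funext => x; rewrite rmorphD rmorphM.
Qed.

Lemma lframe_mul a P t : lframe (fun x => a * P x) t = loc a * lframe P t.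
Proof.
have -> : (fun x => a * P x) = (fun x => a * P x + 0) by apply/funext => x; rewrite addr0.
rewrite (lframe_lin a P (fun=> 0)) [X in _ + X](_ : _ = 0) ?addr0 //.
elim/ord3P: t => [|j]; last by rewrite /lframe frame_lift comp_mpoly0.
rewrite /lframe frame0 !big1 ?mulr0 ?subr0 // => x _; by rewrite comp_mpoly0 mulr0.
Qed.

Hypothesis vk : v k != 0.

(** A triangular system: the entries other than [k] are prescribed directly, and the remaining one
    carries the coefficient [(mu+1) v_k], invertible in characteristic zero. *)
Lemma frame_onto (tau : 'I_3 -> {mpoly K[2]}) : exists U, forall t, frame U t = tau t.
Proof.
pose s := (mu.+1%:R^-1 : K)%:MP_[2] * (tau o0 + e.+1%:R * (\sum_(j < 2) 'X_j * tau (lift o0 j)))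
  - \sum_(j < 2) y (lift k j) * tau (lift o0 j).
exists (fun x => oapp (fun j => tau (lift o0 j)) ((v k)^-1%:MP * s) (unlift k x)) => t.
elim/ord3P: t => [|j]; last by rewrite frame_lift liftK.
rewrite frame0 (bigD1_ord k) //= unlift_none /= chart_pivot mulrA -rmorphM divff // rmorph1 mul1r.
under eq_bigr do rewrite liftK /=.
under [X in _ - _ * X]eq_bigr do rewrite liftK /=.
rewrite /s addrNK mulrA.
have -> : mu.+1%:R * (mu.+1%:R^-1 : K)%:MP_[2] = 1.
  by rewrite -(mpolyC_nat 2 K) -rmorphM mulfV ?pnatr_eq0 // rmorph1.
by rewrite mul1r addrK.
Qed.

(** The frame differs from the gradient by a matrix of constant nonzero determinant, so the order of
    the Jacobian determinant can be read off in the frame. *)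
Lemma det3_lframe : exists2 eps : K, eps != 0 & forall P Q R,
  det3 (lframe P) (lframe Q) (lframe R) = eps%:MP * loc (det3 P Q R).
Proof.
exists (mu.+1%:R * ((-1) ^+ k * v k)).
  by rewrite !mulf_neq0 ?pnatr_eq0 // expf_neq0 // oppr_eq0 oner_neq0.
move=> P Q R; pose c (Z : 'I_3 -> {mpoly K[3]}) :=
  contract (fun x => y x) k (fun x => loc (Z x)).
pose f z (t : 'I_3) := if t == o0 then mu.+1%:R * z o0 -
  (e.+1%:R * 'X_ord0 * z (lift ord0 ord0) + e.+1%:R * 'X_(lift ord0 ord0)
    * z (lift ord0 (lift ord0 ord0))) else z t : {mpoly K[2]}.
have E Z : lframe Z =1 f (c Z).
  apply: ord3P => [|j]; last by rewrite /lframe frame_lift /f lift_eqF /c /contract liftK.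
  rewrite /lframe frame0 /f eqxx /c /contract unlift_none !liftK /= !big_ord_recl !big_ord0; ring.
rewrite (eq_det3 (E P) (E Q) (E R)) det3_scale_shift det3_contract chart_pivot.
have -> : det3 (fun x => loc (P x)) (fun x => loc (Q x)) (fun x => loc (R x)) = loc (det3 P Q R).
  by rewrite !det3E !comp_mpolyD !rmorphM /= !comp_mpolyB !rmorphM.
by rewrite !rmorphM /= rmorphXn /= rmorphN1 mpolyC_nat !mulrA.
Qed.

Section Gradient.
Variable H : {mpoly K[3]}.
Hypotheses (hH : H \is e.+1.-homog) (oH : ord_ge mu.+1 (loc H)).
Let grad x := H^`M(x).

Lemma lframe_grad_lift j : lframe grad (lift o0 j) = (loc H)^`M(j).
Proof. by rewrite /lframe frame_lift chart_deriv. Qed.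

(** The homogeneous Euler relation contributes [(e+1)(mu+1)] and the affine Euler operator [e+1]
    times the degree; they cancel exactly in degree [mu+1]. *)
Lemma lframe_grad0_coef m : (lframe grad o0)@_m =
  e.+1%:R * ((mu.+1%:R - (mdeg m)%:R) * (loc H)@_m).
Proof.
rewrite /lframe frame0.
have -> : \sum_x y x * loc (grad x) = loc (\sum_x 'X_x * grad x).
  by rewrite rmorph_sum; apply: eq_bigr => x _; rewrite rmorphM.
rewrite (euler hH) comp_mpolyZ.
under eq_bigr do rewrite -chart_deriv.
rewrite -!(mpolyC_nat 2 K) mcoeffB !mcoeffCM euler_coef mcoeffZ -mulr_natr; ring.
Qed.

(** The first entry loses its form of degree [mu+1], and the derivatives drop one order. The bounds
    [mu+2], [mu], [mu] add up to [3(mu+1) - 1], the order at the point imposed by the class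
    [3 D + K_X]. *)
Lemma lframe_grad_ord t : ord_ge (mu + (t == o0).*2) (lframe grad t).
Proof.
elim/ord3P: t => [|j].
  have -> : (mu + (o0 == o0).*2 = mu.+2)%N by rewrite eqxx addn2.
  move=> m; rewrite ltnS leq_eqVlt lframe_grad0_coef => /orP[/eqP ->|hm].
    by rewrite subrr mul0r mulr0.
  by rewrite oH ?mulr0.
by rewrite lift_eqF addn0 lframe_grad_lift; apply: ord_ge_deriv.
Qed.

Lemma lframe_grad_lead0 : pihomog mdeg mu.+2 (lframe grad o0) =
  - e.+1%:R *: pihomog mdeg mu.+2 (loc H).
Proof.
apply/mpolyP => m; rewrite mcoeffZ !mcoeff_pihomog lframe_grad0_coef.
case: eqP => [->|_]; last by rewrite mulr0.
by rewrite -[mu.+2]addn1 natrD; ring.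
Qed.

Lemma lframe_grad_lead j : pihomog mdeg mu (lframe grad (lift o0 j)) =
  (pihomog mdeg mu.+1 (loc H))^`M(j).
Proof. by rewrite lframe_grad_lift pihomog_deriv. Qed.
End Gradient.
End LocalFrame.

Lemma two_bin2 n : ('C(n.+1, 2) * 2 = n.+1 * n)%N.
Proof. by rewrite mulnC -mul_bin_diag bin1. Qed.

Lemma tri_mon_inj k : injective (@tri_mon k).
Proof.
move=> [i j] [i' j'] e.
have ei : i = i'.
  move/(congr1 (@mdeg 2)): e; rewrite !mdegE !big_ord_recl !big_ord0 !mnmE /= => e.
  by apply: val_inj => /=; have := ltn_ord j; have := ltn_ord j'; lia.
case: _ / ei in j' e *; congr existT; apply: val_inj.
by move/mnmP/(_ ord0): e; rewrite !mnmE.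
Qed.

Section Pencil.
Variables (K : numClosedFieldType) (I : finType) (k : I -> 'I_3) (v : I -> 'I_3 -> K).
Variables (mu : I -> nat) (e : nat) (F G : {mpoly K[3]}).
Hypotheses (vk : forall i, v i (k i) != 0)
  (np : forall i j, i != j -> nonprop (v i) (v j)).
Hypotheses (hF : F \is e.+1.-homog) (hG : G \is e.+1.-homog).
Local Notation loc i H := (H \mPo chart (k i) (v i)).
Hypotheses (oF : forall i, ord_ge (mu i).+1 (loc i F)) (oG : forall i, ord_ge (mu i).+1 (loc i G)).
Local Notation o0 := (ord0 : 'I_3).
Local Notation grad H := (fun x => H^`M(x)).
Local Notation L i P := (lframe (k i) (v i) (mu i) e P).

(** Interpolation composed with the inverse of the frame. It shows that the conditions defining
    [source] are independent in large degree, and it produces sections with given leading forms. *)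
Lemma lframe_onto N n (tau : I -> 'I_3 -> {mpoly K[2]}) : (#|I| * N <= n)%N ->
  exists P : 'I_3 -> {mpoly K[3]}, (forall x, P x \is n.-homog) /\
    forall i t, ord_ge N (L i P t - tau i t).
Proof.
move=> hn; have /choice[U hU] i := frame_onto (mu i) e (vk i) (tau i).
have /fin_all_exists2[P hP oP] x := interpolation (N := N) (fun i => U i x) vk np hn.
exists P; split=> // i t; rewrite -hU.
have -> : L i P t - frame (k i) (v i) (mu i) e (U i) t =
    frame (k i) (v i) (mu i) e (fun x => (- 1) * U i x + loc i (P x)) t.
  by rewrite frame_lin mulN1r addrC.
by apply: frame_ord => x; rewrite mulN1r addrC; apply: oP.
Qed.

(* Let D be the class of the pencil on X and B = n' H - b sum_i E_i with n' large.
   Then [source] is H^0(J^1(D) (x) B), [target] is H^0(3 D + K_X + B), and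
   [jacobian] is the image of P |-> P /\ F /\ G, whose cokernel is supported at
   the singular points of the members of the pencil. *)
Section Weights.
Variable b : nat.
Definition weight i (t : 'I_3) := (b + (mu i + (t == o0).*2))%N.
Definition target_ord i := (b + (3 * mu i + 2))%N.

Definition source n (P : 'I_3 -> {mpoly K[3]}) :=
  (forall x, P x \is n.-homog) /\ forall i t, ord_ge (weight i t) (L i P t).

Definition target n (f : {mpoly K[3]}) :=
  f \is (n + 2 * e).-homog /\ forall i, ord_ge (target_ord i) (loc i f).

Definition jacobian n (f : {mpoly K[3]}) :=
  exists2 P, source n P & f = det3 P (grad F) (grad G).

Lemma source_lin n (c : K) P Q : source n P -> source n Q ->
  source n (fun x => c *: P x + Q x).
Proof.
move=> [hP oP] [hQ oQ]; split=> [x|i t]; first by rewrite dhomogD ?dhomogZ.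
have -> : (fun x => c *: P x + Q x) = (fun x => c%:MP * P x + Q x).
  by apply/funext => x; rewrite mul_mpolyC.
rewrite (lframe_lin (k i) (v i) (mu i) e (c%:MP) P Q t).
by apply: ord_geD; [apply: ord_geMl; exact: (oP i t) | exact: (oQ i t)].
Qed.

Lemma det3_lin (R' : comNzRingType) (c : R') (u u' w z : 'I_3 -> R') :
  det3 (fun x => c * u x + u' x) w z = c * det3 u w z + det3 u' w z.
Proof. by rewrite !det3E; ring. Qed.

Lemma minor_homog t : minor (grad F) (grad G) t \is (2 * e).-homog.
Proof.
have h x y : F^`M(x) * G^`M(y) \is (2 * e).-homog.
  by rewrite mul2n -addnn; apply: dhomogM; apply: deriv_homog.
by rewrite /minor; case: (val t) => [|[|n]]; rewrite dhomogD ?dhomogN.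
Qed.

Lemma jacobian_target n f : jacobian n f -> target n f.
Proof.
move=> [P [hP oP] ->]; split=> [|i].
  by apply: rpred_sum => t _; apply: dhomogM => //; apply: minor_homog.
have [eps eps0 he] := det3_lframe (mu i) e (vk i).
apply: (@ord_ge_cancel _ _ _ _ (eps%:MP)); first by rewrite mcoeffC eqxx mulr1.
rewrite -he det3E; have := oP i; rewrite /weight => {}oP.
have hf := lframe_grad_ord hF (@oF i); have hg := lframe_grad_ord hG (@oG i).
(* [x], [y], [z] exhaust the indices, so the extra 2 of the first entry is counted and the orders
   reach [target_ord i]. *)
have o x y z m : (forall t, (t == x) || (t == y) || (t == z)) ->
    m = target_ord i -> 
    ord_ge m (L i P x * (L i (grad F) y * L i (grad G) z)).
  move=> hx ->; apply: (ord_ge_le _ (ord_geM (oP x) (ord_geM (hf y) (hg z)))).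
  rewrite /target_ord; have := hx o0; rewrite ![o0 == _]eq_sym.
  by case: (x == o0); case: (y == o0); case: (z == o0) => // _; lia.
have o' x y z : (forall t, (t == x) || (t == y) || (t == z)) ->
    ord_ge (target_ord i) (L i P x * (L i (grad F) y * L i (grad G) z
       - L i (grad F) z * L i (grad G) y)).
  move=> hx; rewrite mulrBr; apply: ord_geB; apply: o => // t.
  by rewrite orbAC; apply: hx.
by apply: ord_geD; first (apply: ord_geD); apply: o' => -[[|[|[|]]] //= ?].
Qed.

Lemma target_graded : graded_sub (2 * e) target.
Proof.
split.
- by move=> n f [].
- by move=> n; split=> [|i]; rewrite ?dhomog0 ?comp_mpoly0; last exact: ord_ge_zero.
- move=> n c f g [hf of_] [hg og]; split=> [|i]; first by rewrite dhomogD ?dhomogZ.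
  by rewrite comp_mpolyD comp_mpolyZ; apply: ord_ge_lin.
- move=> n x f [hf of_]; split=> [|i]; first by apply: (@dhomogM _ _ _ 1); rewrite ?dhomogXU.
  by rewrite rmorphM; apply: ord_geMl.
Qed.

Lemma jacobian_graded : graded_sub (2 * e) jacobian.
Proof.
split.
- by move=> n f /jacobian_target[].
- move=> n; exists (fun=> 0); last by rewrite det3E; ring.
  split=> [x|i t]; first exact: dhomog0.
  by apply: frame_ord => x; rewrite comp_mpoly0; apply: ord_ge_zero.
- move=> n c f g [P hP ->] [Q hQ ->]; exists (fun x => c *: P x + Q x); first exact: source_lin.
  have -> : (fun x => c *: P x + Q x) = (fun x => c%:MP * P x + Q x).
    by apply/funext => x; rewrite mul_mpolyC.
  by rewrite det3_lin mul_mpolyC.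
- move=> n x f [P [hP oP] ->]; exists (fun y => 'X_x * P y + 0).
    split=> [y|i t]; first by rewrite addr0; apply: (@dhomogM _ _ _ 1); rewrite ?dhomogXU.
    rewrite (lframe_lin _ _ _ _ _ P (fun=> 0)); apply: ord_geD; first exact: ord_geMl.
    by apply: frame_ord => y; rewrite comp_mpoly0; apply: ord_ge_zero.
  by rewrite (det3_lin _ P (fun=> 0)) [X in _ + X](_ : _ = 0) ?addr0 // det3E; ring.
Qed.

Lemma det3_grad_kernel (u w : {mpoly K[3]}) :
  det3 (fun x => u * F^`M(x) + w * G^`M(x)) (grad F) (grad G) = 0.
Proof. by rewrite !det3E; ring. Qed.

(** Cramer's rule: a nonzero minor times [u], or times [w], is a combination of the vanishing
    expressions. *)
Lemma grad_combination_eq0 (u w : {mpoly K[3]}) t : minor (grad F) (grad G) t != 0 ->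
  (forall x, u * F^`M(x) + w * G^`M(x) = 0) -> u = 0 /\ w = 0.
Proof.
move=> M0 h; have z (c : {mpoly K[3]}) : c * minor (grad F) (grad G) t = 0 -> c = 0.
  by move/eqP; rewrite mulf_eq0 (negPf M0) orbF => /eqP.
have E x y : u * (F^`M(x) * G^`M(y) - F^`M(y) * G^`M(x)) = 0
    /\ w * (F^`M(x) * G^`M(y) - F^`M(y) * G^`M(x)) = 0.
  have hx := h x; have hy := h y; split.
    have -> : u * (F^`M(x) * G^`M(y) - F^`M(y) * G^`M(x)) =
      (u * F^`M(x) + w * G^`M(x)) * G^`M(y) - (u * F^`M(y) + w * G^`M(y)) * G^`M(x) by ring.
    by rewrite hx hy !mul0r subrr.
  have -> : w * (F^`M(x) * G^`M(y) - F^`M(y) * G^`M(x)) =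
    (u * F^`M(y) + w * G^`M(y)) * F^`M(x) - (u * F^`M(x) + w * G^`M(x)) * F^`M(y) by ring.
  by rewrite hx hy !mul0r subrr.
by split; apply: z; rewrite /minor; case: (val t) => [|[|?]];
  exact: (proj1 (E _ _)) || exact: (proj2 (E _ _)).
Qed.

(* The map P |-> P /\ F /\ G kills u F + w G for all sections u, w of B, and
   dim target - dim source + 2 dim H^0(B) = 3 e^2 - sum_i (3 mu_i^2 + 4 mu_i)
   when n is large. *)
Lemma jacobian_proper N s t :
  (\sum_i (3 * mu i ^ 2 + 4 * mu i) < 3 * e ^ 2)%N -> (forall i t, weight i t <= N)%N ->
  (#|I| * N <= s + e)%N -> minor (grad F) (grad G) t != 0 ->
  exists2 f, target (s + e) f & ~ jacobian (s + e) f.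
Proof.
move=> count wN hn M0; set n := (s + e)%N; apply: contrapT => none.
pose V : vectType K := {ffun 'I_3 -> dhomog 3 K n}.
pose vals (p : V) x := val (p x).
pose phi (j : {x : 'I_3 & {i : I & tri (weight i x)}}) (p : V) :=
  (L (tag (tagged j)) (vals p) (tag j))@_(tri_mon (tagged (tagged j))).
have [|UQ [hUQ _ dUQ]] := conditions_dim (phi := phi).
  move=> j c p q; rewrite /phi.
  have -> : vals (c *: p + q) = (fun x => c%:MP * vals p x + vals q x).
    by apply/funext => x; rewrite /vals !ffunE /= mul_mpolyC.
  by rewrite lframe_lin comp_mpolyC mcoeffD mcoeffCM.
have inUQ p : p \in UQ <-> source n (vals p).
  rewrite hUQ; split=> [h|[_ h] [x [i y]]].
    split=> [x|i x]; first exact: dhomog_is_dhomog.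
    by apply/tri_ordP => y; exact: (h (existT _ x (existT _ i y))).
  exact: (proj1 (tri_ordP _ _) (h i x)).
(* The source must be bounded from above, hence the need for independent conditions; for sections of
   B and for the target, lower bounds are enough. *)
have {}dUQ : (\dim UQ + \sum_x \sum_i 'C((weight i x).+1, 2) = 3 * 'C(n + 2, n))%N.
  have -> : (3 * 'C(n + 2, n) = \dim {:V})%N by rewrite dimvf /dim /= card_ord.
  have -> : (\sum_x \sum_i 'C((weight i x).+1, 2) =
      #|{: {x : 'I_3 & {i : I & tri (weight i x)}}}|)%N.
    by rewrite card_tagged sumnE big_map big_enum; apply: eq_bigr => x _; rewrite card_tri_sum.
  apply: dUQ => tau.
  pose tau' i x := \sum_(y : tri (weight i x)) tau (existT _ x (existT _ i y)) *: 'X_[tri_mon y].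
  have [P [hP oP]] := lframe_onto (N := N) tau' hn.
  exists [ffun x => DHomog (hP x)] => -[x [i y]]; rewrite /phi /=.
  have -> : vals [ffun x => DHomog (hP x)] = P by apply/funext => z; rewrite /vals ffunE.
  have ymon : (mdeg (tri_mon y) < N)%N.
    move: (wN i x); rewrite mdegE big_ord_recl big_ord1 !mnmE /=.
    by move=> hw; rewrite subnKC; [exact: leq_trans (ltn_ord (tag y)) hw | exact: (ltn_ord (tagged y))].
  have /eqP := @oP i x (tri_mon y) ymon; rewrite mcoeffB subr_eq0 => /eqP ->.
  rewrite /tau' raddf_sum (bigD1 y) //= mcoeffZ mcoeffX eqxx mulr1 big1 ?addr0 // => z zy.
  by rewrite mcoeffZ mcoeffX (inj_eq (@tri_mon_inj _)) (negPf zy) mulr0.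
have psiP (p : V) : det3 (vals p) (grad F) (grad G) \is (n + 2 * e).-homog.
  by apply: rpred_sum => x _; apply: dhomogM; rewrite ?minor_homog ?dhomog_is_dhomog.
have [|psi hpsi] := @lfun_exists K V (dhomog 3 K (n + 2 * e)) (fun p => DHomog (psiP p)).
  move=> c p q; apply: val_inj => /=.
  have -> : vals (c *: p + q) = (fun x => c%:MP * vals p x + vals q x).
    by apply/funext => x; rewrite /vals !ffunE /= mul_mpolyC.
  by rewrite det3_lin mul_mpolyC.
pose W : vectType K := (dhomog 3 K s * dhomog 3 K s)%type.
pose phiB (j : {i : I & tri b} + {i : I & tri b}) (p : W) := match j with
  | inl j => (loc (tag j) (val p.1))@_(tri_mon (tagged j))
  | inr j => (loc (tag j) (val p.2))@_(tri_mon (tagged j)) end.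
have [|UB [hUB dUB _]] := conditions_dim (phi := phiB).
  by case=> [j|j] c p q; rewrite /phiB /= comp_mpolyD comp_mpolyZ mcoeffD mcoeffZ.
have {}dUB : (2 * 'C(s + 2, s) <= \dim UB + 2 * \sum_(i : I) 'C(b.+1, 2))%N.
  by move: dUB; rewrite dimvf /dim /= card_sum (card_tri_sum (fun=> b)) !mul2n !addnn.
have thetaP (p : W) x : val p.1 * F^`M(x) + val p.2 * G^`M(x) \is n.-homog.
  by rewrite dhomogD // dhomogM ?deriv_homog ?dhomog_is_dhomog.
have [|theta htheta] := @lfun_exists K W V (fun p => [ffun x => DHomog (thetaP p x)]).
  move=> c p q; apply/ffunP => x; rewrite !ffunE; apply: val_inj => /=.
  by rewrite -!mul_mpolyC; ring.
have valsT p : vals (theta p) = (fun x => val p.1 * F^`M(x) + val p.2 * G^`M(x)).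
  by apply/funext => x; rewrite /vals htheta ffunE.
have dker : (\dim UB <= \dim (UQ :&: lker psi))%N.
  rewrite -(@limg_dim_eq _ _ _ theta UB); last first.
    apply/eqP; rewrite -subv0; apply/subvP => p; rewrite memv_cap memv_ker => /andP[_ /eqP p0].
    have h x : val p.1 * F^`M(x) + val p.2 * G^`M(x) = 0.
      by rewrite -(congr1 (fun g => g x) (valsT p)) p0 /vals ffunE.
    have [p1 p2] := grad_combination_eq0 M0 h.
    rewrite memv0 [p]surjective_pairing; apply/eqP; congr (_, _); exact: val_inj.
  apply: dimvS; apply/subvP => _ /memv_imgP[p /hUB pB ->]; rewrite memv_cap memv_ker hpsi.
  apply/andP; split; last first.
    by apply/eqP/val_inj; rewrite /= valsT det3_grad_kernel.
  apply/inUQ; rewrite valsT; split=> [x|i x]; first exact: thetaP.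
  have oB (f : dhomog 3 K s) : (forall y : tri b, (loc i (val f))@_(tri_mon y) = 0) ->
      ord_ge b (loc i (val f)) by move/tri_ordP.
  rewrite lframe_lin lframe_mul; apply: ord_geD; apply: ord_geM.
  - by apply: oB => y; exact: (pB (inl (existT _ i y))).
  - exact: (lframe_grad_ord hF (@oF i)).
  - by apply: oB => y; exact: (pB (inr (existT _ i y))).
  - exact: (lframe_grad_ord hG (@oG i)).
have := limg_ker_dim psi UQ => dpsi.
have [UT [hUT dUT]] := forms_dim k v target_ord (n + 2 * e).
have TU : (UT <= psi @: UQ)%VS.
  apply/subvP => f /hUT fT; have [P sP fP] : jacobian n (val f).
    apply: contrapT => nJ; apply: none; exists (val f) => //; split=> //.
    exact: dhomog_is_dhomog.
  pose p : V := [ffun x => DHomog (sP.1 x)].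
  have vp : vals p = P by apply/funext => z; rewrite /vals ffunE.
  have -> : f = psi p by apply: val_inj; rewrite hpsi /= vp.
  by apply: memv_img; apply/inUQ; rewrite vp.
have := dimvS TU => dTU.
have bs d : ('C(d + 2, d) * 2 = (d.+2) * d.+1)%N.
  by rewrite -two_bin2 -bin_sub ?leq_addr // addKn addn2.
(* At one point, [C(b+3mu+3,2) + 2 C(b+1,2) - C(b+mu+3,2) - 2 C(b+mu+1,2) = 3 mu^2 + 4 mu]: all
   terms in [b] cancel. Likewise the degrees contribute [3 e^2], whatever [s] is. *)
have sum_id : (\sum_i 'C((target_ord i).+1, 2) + 2 * \sum_(i : I) 'C(b.+1, 2) =
    \sum_i (3 * mu i ^ 2 + 4 * mu i) + \sum_x \sum_i 'C((weight i x).+1, 2))%N.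
  rewrite !big_ord_recl big_ord0 addn0 big_distrr -!big_split; apply: eq_bigr => i _ /=.
  rewrite /target_ord /weight /=.
  have := two_bin2 (b + (3 * mu i + 2)); have := two_bin2 b.
  have := two_bin2 (b + (mu i + 2)); have := two_bin2 (b + (mu i + 0)).
  rewrite !addn0 -!mulnn (_ : 1.*2 = 2)%N //; move: (mu i) => m.
  move: 'C(_, 2) 'C(_, 2) 'C(_, 2) 'C(_, 2) => c1 c2 c3 c4; nia.
have hn2 := bs (n + 2 * e)%N; have hn1 := bs n; have hs := bs s.
move: dUQ dUT dUB dTU dpsi dker sum_id count hn2 hn1 hs; rewrite /n -!mulnn.
move: (\dim _) (\dim _) (\dim _) (\dim _) (\dim _) => d1 d2 d3 d4 d5.
nia.
Qed.
End Weights.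

Lemma minor_morph (R1 R2 : comNzRingType) (f : {rmorphism R1 -> R2}) (u w : 'I_3 -> R1) t :
  f (minor u w t) = minor (fun x => f (u x)) (fun x => f (w x)) t.
Proof. by rewrite /minor; case: (val t) => [|[|?]]; rewrite rmorphB !rmorphM. Qed.

(** The restriction to [E_i] of entry [t] of the jet of [H], as a binary form in the tangent
    direction. *)
Definition lead i H t := pihomog mdeg (mu i + (t == o0).*2) (L i (grad H) t).

Lemma lead_lift i H j : lead i H (lift o0 j) = (pihomog mdeg (mu i).+1 (loc i H))^`M(j).
Proof. by rewrite /lead lift_eqF addn0; exact: lframe_grad_lead. Qed.

Lemma lead0_eval i s H : H \is e.+1.-homog ->
  (lead i H o0).@[s] = - e.+1%:R * (pihomog mdeg (mu i).+2 (loc i H)).@[s].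
Proof. by move=> hH; rewrite /lead eqxx addn2 (lframe_grad_lead0 (k i) (v i) (mu i) hH) mevalZ. Qed.

(** Minor [t] leaves out entry [t], so the extra 2 of the first entry is missing only for
    [t = o0]. *)
Definition minor_deg i (t : 'I_3) := if t == o0 then (2 * mu i)%N else (2 * mu i + 2)%N.

Lemma lead_minor i t :
  minor (lead i F) (lead i G) t \is (minor_deg i t).-homog /\
  pihomog mdeg (minor_deg i t) (minor (L i (grad F)) (L i (grad G)) t)
    = minor (lead i F) (lead i G) t /\
  ord_ge (minor_deg i t) (minor (L i (grad F)) (L i (grad G)) t).
Proof.
have hf := lframe_grad_ord hF (@oF i); have hg := lframe_grad_ord hG (@oG i).
have o x y d : (mu i + (x == o0).*2 + (mu i + (y == o0).*2) = d)%N ->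
   lead i F x * lead i G y \is d.-homog /\
   pihomog mdeg d (L i (grad F) x * L i (grad G) y) = lead i F x * lead i G y.
  move=> <-; rewrite /lead; split; last exact: (pihomogM (hf x) (hg y)).
  by apply: dhomogM; apply: pihomogP.
have o2 x y d : (mu i + (x == o0).*2 + (mu i + (y == o0).*2) = d)%N ->
   lead i F x * lead i G y - lead i F y * lead i G x \is d.-homog /\
   pihomog mdeg d (L i (grad F) x * L i (grad G) y - L i (grad F) y * L i (grad G) x)
     = lead i F x * lead i G y - lead i F y * lead i G x /\
   ord_ge d (L i (grad F) x * L i (grad G) y - L i (grad F) y * L i (grad G) x).
  move=> hd; have [h1 h2] := o x y d hd.
  have [|h3 h4] := o y x d; first by rewrite addnC.
  rewrite pihomogB h2 h4 dhomogD ?dhomogN //; do 2!split=> //.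
  apply: ord_geB; first by rewrite -hd; apply: ord_geM; [exact: hf | exact: hg].
  by rewrite -hd addnC; apply: ord_geM; [exact: hf | exact: hg].
by case: t => -[|[|[|//]]] ht; apply: o2; rewrite /minor_deg /=; lia.
Qed.

(** With the pull-back divided by [u^(mu+1)], the local equation near [E_i] begins with
    [f_(mu+1) + u f_(mu+2)], both taken on directions. It has order at least 2 at [s] when [s] is a
    double root of the first form and a root of the second. *)
Definition exc_singular i (H : {mpoly K[3]}) (s : 'I_2 -> K) :=
  (forall j, (pihomog mdeg (mu i).+1 (loc i H))^`M(j).@[s] = 0) /\
  (pihomog mdeg (mu i).+2 (loc i H)).@[s] = 0.

(* With m_i = mu_i + 1 and d = e + 1, the difference of the two sides is
   c_2(J^1(D)) = 3 D^2 + 2 K_X.D + e(X), the expected number of singular members. *)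
Theorem pencil_singular_member : (\sum_i (3 * mu i ^ 2 + 4 * mu i) < 3 * e ^ 2)%N ->
  exists a c, (a != 0) || (c != 0) /\
    ((exists q, [/\ exists x, q x != 0, forall i, nonprop (v i) q &
        forall x, (a *: F + c *: G)^`M(x).@[q] = 0]) \/
     (exists i s, (exists j, s j != 0) /\ exc_singular i (a *: F + c *: G) s)).
Proof.
move=> count; apply: contrapT => none.
have smooth q : (exists x, q x != 0) -> (forall i, nonprop (v i) q) ->
    exists t, (minor (grad F) (grad G) t).@[q] != 0.
  move=> q0 nq; apply: contrapT => z; apply: none.
  have [t|a [c [ac h]]] := @minor_dependent _ (fun x => F^`M(x).@[q]) (fun x => G^`M(x).@[q]).
    by rewrite -(minor_morph (meval q)); apply/eqP/negPn/negP => zt; apply: z; exists t.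
  exists a, c; split=> //; left; exists q; split=> // x.
  by rewrite mderivD !mderivZ mevalD !mevalZ.
(* On [E_i] the leading forms replace the gradients: a linear relation between their values at [s]
   gives a member singular at [s]. *)
have exc_smooth i s : (exists j, s j != 0) ->
    exists t, (minor (lead i F) (lead i G) t).@[s] != 0.
  move=> s0; apply: contrapT => z; apply: none.
  have [t|a [c [ac h]]] := @minor_dependent _ (fun x => (lead i F x).@[s]) (fun x => (lead i G x).@[s]).
    by rewrite -(minor_morph (meval s)); apply/eqP/negPn/negP => zt; apply: z; exists t.
  exists a, c; split=> //; right; exists i, s; split=> //.
  have evD (f g : {mpoly K[2]}) : (a *: f + c *: g).@[s] = a * f.@[s] + c * g.@[s].
    by rewrite mevalD !mevalZ.
  have evdD (f g : {mpoly K[2]}) j : (a *: f + c *: g)^`M(j).@[s] = a * f^`M(j).@[s] + c * g^`M(j).@[s].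
    by rewrite mderivD !mderivZ evD.
  pose comb x y := a * x + c * y.
  split=> [j|]; rewrite comp_mpolyD !comp_mpolyZ pihomog_lin.
    apply: etrans (evdD _ _ j) _; apply: etrans (h (lift o0 j)).
    exact: (congr2 comb (congr1 (meval s) (esym (lead_lift i F j)))
      (congr1 (meval s) (esym (lead_lift i G j)))).
  apply: etrans (evD _ _) _.
  have comb0 x y : comb (- e.+1%:R * x) (- e.+1%:R * y) = 0 -> comb x y = 0.
    rewrite /comb mulrCA [c * (_ * _)]mulrCA -mulrDr => /eqP.
    by rewrite mulf_eq0 oppr_eq0 pnatr_eq0 /= => /eqP.
  exact: comb0 (etrans (esym (congr2 comb (lead0_eval i s hF) (lead0_eval i s hG))) (h o0)).
have /fin_all_exists[n0 hn0] i := @binary_generation K (fun t => minor (lead i F) (lead i G) t)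
  (minor_deg i) (2 * mu i + 2) (fun t => proj1 (lead_minor i t))
  (fun t => ltac:(rewrite /minor_deg; case: ifP; lia)) (exc_smooth i).
(* With [b] at least every [n0 i], a leading form of degree [target_ord b i] at [p_i] is a
   combination of the leading minors; [N] bounds all orders that occur. *)
pose b := (\sum_i n0 i)%N; pose N := (b + 3 * (\sum_i mu i) + 3)%N.
have n0b i : (n0 i <= b)%N by rewrite /b (bigD1 i) //= leq_addr.
have muN i : (mu i <= \sum_i mu i)%N by rewrite (bigD1 i) //= leq_addr.
have wN i t : (weight b i t < N)%N.
  by have := muN i; rewrite /weight /N; case: (t == o0); lia.
have tN i : (target_ord b i <= N)%N by have := muN i; rewrite /target_ord /N; lia.
have N0 : (0 < N)%N by rewrite /N addn3.
pose B := (#|I|.+1 * N + 1 + e)%N.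
have hT := target_graded b; have hA := jacobian_graded b.
have IN : (#|I| * N <= #|I|.+1 * N)%N by rewrite leq_mul2r leqnSn orbT.
have gen n : (B <= n)%N -> forall f, target b n.+1 f ->
    exists2 g, forall x, target b n (g x) & f = \sum_x 'X_x * g x.
  case: n => [|n] hn f [hf of_]; first by rewrite /B addn1 addSn in hn.
  have hd : (#|I|.+1 * N <= n + 2 * e)%N by rewrite /B in hn; lia.
  by have [g hg ->] := ord_var_decomp vk np tN N0 hd hf of_; exists g.
have proper : proper_from (target b) (jacobian b) B.
  move=> n hn; have [q [q0 nq]] := exists_nonprop vk.
  have [t Mt] := smooth q q0 nq.
  have M0 : minor (grad F) (grad G) t != 0 by apply: contraNneq Mt => ->; rewrite meval0.
  have := @jacobian_proper b N (n - e) t count (fun i t => ltnW (wN i t)) _ M0.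
  have en : (n - e + e = n)%N by apply: subnK; rewrite /B in hn; lia.
  by rewrite en; apply; rewrite /B in hn; lia.
have [q [n [q0 hn [f [hf of_] nex]]]] := graded_point hT hA (@jacobian_target b) gen proper.
case: n hn hf of_ nex => [|n] hn hf of_ nex; first by move: hn; rewrite /B addn1 addSn.
have hd : (#|I|.+1 * N <= n + 2 * e)%N by rewrite /B in hn; lia.
have koszul kq (w : 'I_3 -> K) (a : {mpoly K[3]}) h : w kq != 0 -> (exists2 c, c != 0 & forall x, q x = c * w x) ->
    jacobian b n.+2 a ->
    (forall j, h j \is (n + 2 * e).+1.-homog /\ forall i, ord_ge (target_ord b i) (loc i (h j))) ->
    f = a + \sum_j ell kq w j * h j -> False.
  move=> wk [c c0 qc] ha hh ef; case: nex; have [|||g hg eg] := @ell_koszul K 2 kq w (target b n.+1) h wk.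
  - exact: (gs_zero hT n.+1).
  - by move=> c' f'; apply: (gsZ hT).
  - exact: hh.
  exists a, (fun i j => c^-1 *: g i j); split; [exact: ha | by move=> i j; apply: (gsZ hT) |].
  rewrite ef eg; congr (_ + _); apply: eq_bigr => i _; apply: eq_bigr => j _.
  by rewrite !qc -!scalerA -scalerBr -scalerAl -scalerAr scalerA mulfV // scale1r.
(* Away from the [p_i], some minor is nonzero at [q]. Its product with a form equal to 1 at [q] and
   vanishing to order [N] at the [p_i] is a Jacobian determinant, and a multiple of it corrects the
   value of [f] at [q]. *)
have [nq|/existsNP[i nqi]] := EM (forall i, nonprop (v i) q).
  have [t Mt] := smooth q q0 nq; have [kq qk] := q0.
  have [|u [hu uq ou]] := @interpolation_extra K I k v vk np kq q qk nq n.+2 N N0.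
    by rewrite /B in hn; lia.
  pose M := minor (grad F) (grad G) t.
  have JM c : jacobian b n.+2 (c *: (u * M)).
    apply: (gsZ hA); exists (fun x => if x == t then u else 0).
      split=> [x|i x]; first by case: ifP; rewrite ?dhomog0.
      apply: frame_ord => y; apply: ord_ge_le (ltnW (wN i x)) _.
      by case: ifP => _ //; rewrite comp_mpoly0; apply: ord_ge_zero.
    rewrite /det3 (bigD1 t) //= eqxx big1 ?addr0 // => x /negPf ->.
    by rewrite mul0r.
  pose c := f.@[q] / M.@[q].
  have [hM oM] := jacobian_target (JM c).
  have [|||h hh eh] := @vanishing_decomp K I k v (target_ord b) N vk np tN kq q qk nq
      (n + 2 * e) (f - c *: (u * M)) hd.
  - by rewrite dhomogD ?dhomogN.
  - by move=> i; rewrite comp_mpolyB; apply: ord_geB; [exact: of_ | exact: oM].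
  - by rewrite mevalB mevalZ mevalM uq mul1r divfK ?subrr.
  apply: (koszul kq q _ h qk _ (JM c) hh); last by rewrite -eh addrC subrK.
  by exists 1; rewrite ?oner_neq0 // => x; rewrite mul1r.
have qv : exists2 c, c != 0 & forall x, q x = c * v i x.
  have e1 x : q x = q (k i) / v i (k i) * v i x.
    apply/(mulIf (vk i)); rewrite mulrAC divfK ?vk //; apply/eqP/negPn/negP => ne.
    by apply: nqi; exists x, (k i); rewrite [v i x * _]mulrC [v i (k i) * _]mulrC eq_sym.
  exists (q (k i) / v i (k i)) => //; apply: contraPneq q0 => c0 [x].
  by rewrite e1 c0 mul0r eqxx.
(* At [q = p_i] the leading form of [f] takes the place of its value. It is written through the
   leading minors, and a section [P] with these coefficients as leading forms gives a determinant
   agreeing with [f] to one more order; [eps] compensates for the change of frame. *)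
pose H := pihomog mdeg (target_ord b i) (loc i f).
have eT : target_ord b i = (b + mu i + (2 * mu i + 2))%N by rewrite /target_ord; lia.
have [||a ha eH] := hn0 i (b + mu i)%N _ H.
- by rewrite (leq_trans (n0b i)) // leq_addr.
- by rewrite -eT; exact: pihomogP.
have ew t : (b + mu i + (2 * mu i + 2 - minor_deg i t) = weight b i t)%N.
  by rewrite /weight /minor_deg; case: (t == o0) => /=; lia.
have [eps eps0 heps] := det3_lframe (mu i) e (vk i).
have [|P [hP oP]] := @lframe_onto N n.+2 (fun j t => if j == i then eps *: a t else 0).
  by rewrite /B in hn; lia.
have sP : source b n.+2 P.
  split=> // j t; have := ord_ge_le (ltnW (wN j t)) (oP j t).
  case: eqP => [ji|_]; last by rewrite subr0.
  rewrite -[X in _ -> ord_ge _ X](subrK (eps *: a t)) => h; apply: ord_geD => //.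
  by apply/ord_geZ/homog_ord; rewrite ji -ew.
have leadP t : pihomog mdeg (weight b i t) (L i P t) = eps *: a t.
  have := @pihomog_ord _ _ _ _ _ (wN i t) (oP i t); rewrite eqxx pihomogB => /eqP.
  by rewrite subr_eq0 => /eqP ->; apply: pihomog_dE; rewrite dhomogZ // -ew.
have JP : jacobian b n.+2 (det3 P (grad F) (grad G)) by exists P.
have [hD oD] := jacobian_target JP.
have [|||h hh eh] := @point_decomp K I k v (target_ord b) N vk np tN i (n + 2 * e)
  (f - det3 P (grad F) (grad G)) (leq_trans IN hd).
- by rewrite dhomogD ?dhomogN.
- by move=> j; rewrite comp_mpolyB; apply: ord_geB; [exact: of_ | exact: oD].
- apply: ord_geS; first by rewrite comp_mpolyB; apply: ord_geB; [exact: of_ | exact: oD].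
  have detE : pihomog mdeg (target_ord b i) (det3 (L i P) (L i (grad F)) (L i (grad G))) = eps *: H.
    rewrite /det3 raddf_sum eH scaler_sumr; apply: eq_bigr => t _.
    have [_ [ht ot]] := lead_minor i t.
    have -> : target_ord b i = (weight b i t + minor_deg i t)%N.
      by rewrite /target_ord /weight /minor_deg; case: (t == o0) => /=; lia.
    apply: etrans (pihomogM (proj2 sP i t) ot) _; rewrite ht scalerAl.
    exact: (congr1 (fun z => z * minor (lead i F) (lead i G) t) (leadP t)).
  rewrite comp_mpolyB pihomogB; apply/eqP; rewrite subr_eq0; apply/eqP.
  apply: (scalerI eps0); apply: etrans (esym detE) _.
  apply: etrans (congr1 (pihomog mdeg (target_ord b i)) (heps _ _ _)) _; apply/mpolyP => m.
  by rewrite mcoeffZ !mcoeff_pihomog mcoeffCM; case: eqP => // _; rewrite mulr0.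
by apply: (koszul (k i) (v i) _ h (vk i) qv JP hh); rewrite -eh addrC subrK.
Qed.
End Pencil.

(** * Curves on the blow-up *)

Lemma comp_mpoly_comp (K : comNzRingType) (n l h : nat) (f : {mpoly K[n]})
    (s : n.-tuple {mpoly K[l]}) (t : l.-tuple {mpoly K[h]}) :
  (f \mPo s) \mPo t = f \mPo [tuple tnth s i \mPo t | i < n].
Proof.
rewrite [f \mPo s]comp_mpolyEX [RHS]comp_mpolyEX raddf_sum; apply: eq_bigr => m _ /=.
rewrite comp_mpolyZ !comp_mpolyX rmorph_prod; congr (_ *: _); apply: eq_bigr => i _ /=.
by rewrite rmorphXn tnth_mktuple.
Qed.

Lemma ord_ge_comp (K : idomainType) (n l N : nat) (f : {mpoly K[n]}) (t : n.-tuple {mpoly K[l]}) :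
  (forall i, ord_ge 1 (tnth t i)) -> ord_ge N f -> ord_ge N (f \mPo t).
Proof.
move=> ht of_; rewrite comp_mpolyEX big_seq; apply: ord_ge_sum => m; rewrite mcoeff_msupp => hm.
apply: ord_geZ; have /ord_ge_le : (N <= mdeg m)%N.
  by rewrite leqNgt; apply: contraNN hm => /of_ ->.
apply; rewrite comp_mpolyX mdegE; elim/big_rec2: _ => [|i d g _ hg]; first exact: ord_ge0n.
by apply: ord_geM => //; apply: ord_geXn.
Qed.

Lemma ord_ge2 (K : idomainType) n (f : {mpoly K[n]}) :
  f@_0%MM = 0 -> (forall j, f^`M(j)@_0%MM = 0) -> ord_ge 2 f.
Proof.
move=> f0 f1 m; rewrite ltnS leq_eqVlt ltnS leqn0 mdeg_eq0 => /orP[/mdeg1P[j /eqP ->]|/eqP -> //].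
by have := f1 j; rewrite mcoeff_deriv mnm0E mulr1n add0m.
Qed.

(** * Local equations on the blow-up *)

Section BlowupChart.
Variables (R : realType) (s : proj_point R 1).
Local Notation K := R[i].

Lemma pivot_neq0 n (q : proj_point R n) : val q 0 (pivot q) != 0.
Proof.
rewrite /pivot; case: pickP => [j //|h].
case/negP: (valP q); apply/eqP/rowP => j; rewrite mxE.
by have := h j; move=> /negbFE/eqP.
Qed.

(** The affine chart of the line of directions around [s], in the variable [X_1]. A form of degree
    [d] pulls back to [X_0^d] times its value on it. *)
Definition direction_chart : 2.-tuple {mpoly K[2]} :=
  [tuple tnth (chart (pivot s) (fun j => val s 0 j)) j \mPo [tuple 'X_(ord_max : 'I_2) | _ < 1] | j < 2].

Lemma blowup_chartE j : tnth (blowup_chart s) j = 'X_ord0 * tnth direction_chart j.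
Proof.
rewrite !tnth_mktuple; case: unliftP => [j' _|_].
  by rewrite comp_mpolyD comp_mpolyC comp_mpolyXi tnth_mktuple.
by rewrite comp_mpolyC mulrC mul_mpolyC.
Qed.

Lemma blowup_homog d (f : {mpoly K[2]}) : f \is d.-homog ->
  f \mPo blowup_chart s = 'X_ord0 ^+ d * (f \mPo direction_chart).
Proof.
move=> /dhomogP hf; rewrite !comp_mpolyEX mulr_sumr [LHS]big_seq [RHS]big_seq.
apply: eq_bigr => m /hf /= hm; rewrite -scalerAr; congr (_ *: _).
rewrite !comp_mpolyX -hm mdegE -prodrXr -big_split; apply: eq_bigr => i _ /=.
by rewrite blowup_chartE exprMn.
Qed.

Lemma blowup_decomp (f : {mpoly K[2]}) N : (msize f <= N)%N ->
  f \mPo blowup_chart s = \sum_(d < N) 'X_ord0 ^+ d * (pihomog mdeg d f \mPo direction_chart).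
Proof.
move=> hN; rewrite {1}(@pihomog_partitionE _ _ mdeg N f hN) raddf_sum.
by apply: eq_bigr => d _; apply: blowup_homog; apply: pihomogP.
Qed.

Lemma direction_chart_coef0 (f : {mpoly K[2]}) : (f \mPo direction_chart)@_0%MM = f.@[fun j => val s 0 j].
Proof.
rewrite -comp_mpoly_comp -meval_at0 comp_mpoly_meval.
rewrite (@meval_eq _ _ _ (fun=> 0)) ?meval_at0 ?chart_coef0 // => i.
by rewrite tnth_mktuple mevalXU.
Qed.

Lemma direction_chart_ord2 d (f : {mpoly K[2]}) : f \is d.+1.-homog ->
  (forall j, f^`M(j).@[fun j => val s 0 j] = 0) -> ord_ge 2 (f \mPo direction_chart).
Proof.
move=> hf h; rewrite -comp_mpoly_comp; apply: ord_ge_comp.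
  by move=> i; rewrite tnth_mktuple; apply: ord_geX.
apply: ord_ge2 => [|j]; last by rewrite chart_deriv chart_coef0.
rewrite chart_coef0; apply: (@mulfI _ (d.+1%:R)); first by rewrite pnatr_eq0.
rewrite mulr0 -mevalZ -(euler hf) rmorph_sum big1 // => j _.
by rewrite rmorphM /= h mulr0.
Qed.

(** The form of degree [d] pulls back with a factor [X_0^d]. Only the degrees [mu+1] and [mu+2] need
    further vanishing, of orders 2 and 1, along the directions. *)
Lemma blowup_ord (f : {mpoly K[2]}) mu : ord_ge mu.+1 f ->
  (forall j, (pihomog mdeg mu.+1 f)^`M(j).@[fun j => val s 0 j] = 0) ->
  (pihomog mdeg mu.+2 f).@[fun j => val s 0 j] = 0 ->
  ord_ge (mu.+1 + 2) (f \mPo blowup_chart s).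
Proof.
move=> of_ h1 h2; rewrite (blowup_decomp (leqnn _)); apply: ord_ge_sum => d _.
have oX : ord_ge d ('X_ord0 ^+ d : {mpoly K[2]}) by apply: ord_geXn; apply: ord_geX.
have [dm|dm] := leqP d mu.
  by rewrite (@pihomog_ord _ _ _ _ _ _ of_) // comp_mpoly0 mulr0; apply: ord_ge_zero.
have [->|d1] := eqVneq (d : nat) mu.+1.
  apply: ord_geM; first by apply: ord_geXn; apply: ord_geX.
  by apply: (@direction_chart_ord2 mu) => //; apply: pihomogP.
have [->|d2] := eqVneq (d : nat) mu.+2.
  rewrite addnS addn1 -[mu.+3]addn1; apply: ord_geM.
    by apply: ord_geXn; apply: ord_geX.
  by apply/ord_ge1P; rewrite direction_chart_coef0.
by apply: ord_geMr; apply: ord_ge_le oX; lia.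
Qed.

(** The blow-up map is dominant: a point where [f] and the pivot coordinate are nonzero lies in the
    image of the chart. *)
Lemma blowup_neq0 (f : {mpoly K[2]}) : f != 0 -> f \mPo blowup_chart s != 0.
Proof.
move=> f0; have : f * 'X_(pivot s) != 0.
  by rewrite mulf_neq0 // -msize_poly_eq0 msizeX.
case/mpoly_nonroot => x; rewrite mevalM mevalXU mulf_eq0 negb_or => /andP[fx xs].
have sp := pivot_neq0 s; pose u := x (pivot s) / val s 0 (pivot s).
have u0 : u != 0 by rewrite mulf_neq0 ?invr_eq0.
pose w := x (lift (pivot s) ord0) / u - val s 0 (lift (pivot s) ord0).
apply: contraNneq fx => e; apply/eqP.
have := meval0 (fun j : 'I_2 => if j == ord0 then u else w); rewrite -e comp_mpoly_meval.
move=> <-; apply: meval_eq => i; rewrite tnth_mktuple; case: unliftP => [j ->|->].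
  by rewrite mevalM mevalD mevalC !mevalXU /= /w ord1 addrC subrK mulrC divfK.
by rewrite mevalZ mevalXU /= mulrC divfK.
Qed.
End BlowupChart.

(** * Effective divisors and their components *)

Section Divisors.
Variables (R : realType) (r : nat) (p : 'I_r -> proj_point R 2).
Local Notation K := R[i].
Implicit Types (D C : effective_divisor p) (x : blowup_point p) (L : divisor_class R r).

Definition coords n (q : proj_point R n) : 'I_n.+1 -> K := fun j => val q 0 j.

Lemma affine_chart_neq0 d (F : {mpoly K[3]}) (q : proj_point R 2) :
  F \is d.-homog -> F != 0 -> F \mPo affine_chart q != 0.
Proof.
by move=> hF; apply: contraNneq => /(chart_inj (v := coords q) (pivot_neq0 q) hF) ->.
Qed.

Lemma local_pullback_neq0 D x : local_pullback (dpoly D) x != 0.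
Proof.
have h q := affine_chart_neq0 q (dpoly_homog D) (dpoly_neq0 D).
by case: x => [q hq|i s] /=; [exact: h | exact: blowup_neq0].
Qed.

Section Sum.
Variables D D1 D2 : effective_divisor p.
Hypothesis hD : sum_divisor D D1 D2.

Lemma mult_at_sum x : mult_at D x = mult_at D1 x + mult_at D2 x.
Proof.
have [hd he hp] := hD; rewrite /mult_at.
have -> : local_pullback (dpoly D) x = local_pullback (dpoly D1) x * local_pullback (dpoly D2) x.
  by rewrite hp; case: x => [q hq|i s] /=; rewrite !rmorphM.
have e2 : (if x is OnExc i _ then ecoef D i else 0) =
    (if x is OnExc i _ then ecoef D1 i else 0) + (if x is OnExc i _ then ecoef D2 i else 0).
  by case: x => [q hq|i s]; rewrite ?addr0.
have e1 := order0M (local_pullback_neq0 D1 x) (local_pullback_neq0 D2 x).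
apply: etrans (congr2 (fun a b => Posz a + b) e1 e2) _; rewrite PoszD; exact: addrACA.
Qed.

Lemma plane_mult_sum i : plane_mult (dpoly D) (p i) =
  (plane_mult (dpoly D1) (p i) + plane_mult (dpoly D2) (p i))%N.
Proof.
have [hd he hp] := hD; rewrite /plane_mult hp rmorphM /=.
exact: order0M (affine_chart_neq0 (p i) (dpoly_homog D1) (dpoly_neq0 D1))
  (affine_chart_neq0 (p i) (dpoly_homog D2) (dpoly_neq0 D2)).
Qed.

Lemma intersection_sum L : intersection L (class_of D) =
  intersection L (class_of D1) + intersection L (class_of D2).
Proof.
have [hd he hp] := hD; rewrite /intersection /= hd natrD mulrDr addrACA -opprD -big_split.
by congr (_ - _); apply: eq_bigr => i _; rewrite he rmorphD mulrDr.
Qed.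
End Sum.

(** The multiplicity of [E_i] as a component of [D], since the pull-back of [dpoly D] already
    contains [E_i] as often as [plane_mult] says. *)
Definition excess D i : int := ecoef D i + (plane_mult (dpoly D) (p i))%:Z.

(** Additive on sums and zero only for the zero divisor, so splitting off components terminates. *)
Definition complexity D : nat := (hdeg D + \sum_i absz (excess D i))%N.

Lemma excess_ge0 D i : 0 <= excess D i.
Proof. by have := ecoef_bound D i; rewrite lerNl -subr_ge0 opprK. Qed.

Lemma excess_sum D D1 D2 i : sum_divisor D D1 D2 -> excess D i = excess D1 i + excess D2 i.
Proof.
move=> hD; have [hd he hp] := hD.
apply: etrans (congr2 (fun a b => a + Posz b) (he i) (plane_mult_sum hD i)) _.
by rewrite PoszD; exact: addrACA.
Qed.

Lemma abszD_nneg (a b : int) : 0 <= a -> 0 <= b -> absz (a + b) = (absz a + absz b)%N.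
Proof. by case: a b => a [b|b]. Qed.

Lemma complexity_sum D D1 D2 : sum_divisor D D1 D2 ->
  complexity D = (complexity D1 + complexity D2)%N.
Proof.
move=> hD; have [hd he hp] := hD; rewrite /complexity hd addnACA -big_split; congr addn.
by apply: eq_bigr => i _; rewrite (excess_sum i hD); exact: abszD_nneg (excess_ge0 _ _) (excess_ge0 _ _).
Qed.

Lemma const_dpoly D : hdeg D = 0%N -> exists2 c, c != 0 & dpoly D = c%:MP.
Proof.
move=> h0; have := dpoly_homog D; rewrite h0 => /homog_deg_le/deg_leP/msize1_polyC e.
exists (dpoly D)@_0%MM => //; apply: contraNneq (dpoly_neq0 D) => z.
by rewrite e z mpolyC0.
Qed.

Lemma order0C n (c : K) : c != 0 -> order0 (c%:MP : {mpoly K[n]}) = 0%N.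
Proof.
move=> c0; apply/eqP; rewrite -leqn0 leqNgt; apply/negP.
have c0' : c%:MP != 0 :> {mpoly K[n]} by rewrite mpolyC_eq0.
by move=> /(order0_geP _ c0')/ord_ge1P; rewrite mcoeffC eqxx mulr1 => /eqP; rewrite (negPf c0).
Qed.

Lemma plane_mult_deg0 D q : hdeg D = 0%N -> plane_mult (dpoly D) q = 0%N.
Proof.
by case/const_dpoly => c c0 ->; rewrite /plane_mult comp_mpolyC order0C.
Qed.

Lemma complexity_eq0 D : complexity D = 0%N -> zero_divisor D.
Proof.
move=> /eqP; rewrite /complexity addn_eq0 sum_nat_eq0 => /andP[/eqP h0 /forallP he]; split=> // i.
by have := he i; rewrite /excess plane_mult_deg0 // addr0 absz_eq0 => /eqP.
Qed.

Lemma integral_component L x (t : R) D : ~ zero_divisor D ->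
  intersection L (class_of D) <= t * (mult_at D x)%:~R ->
  exists2 C, integral_curve C & intersection L (class_of C) <= t * (mult_at C x)%:~R.
Proof.
have [n] := ubnP (complexity D); elim: n D => // n IH D hn nz hD.
have [iC|niC] := EM (integral_curve D); first by exists D.
have [D1 [D2 [h12 [nz1 nz2]]]] : exists D1 D2, sum_divisor D D1 D2 /\
    ~ zero_divisor D1 /\ ~ zero_divisor D2.
  apply: contrapT => none; apply: niC; split=> // D1 D2 h12; apply: contrapT => /not_orP[n1 n2].
  by apply: none; exists D1, D2.
have pos D' : ~ zero_divisor D' -> (0 < complexity D')%N.
  by move=> nz'; rewrite lt0n; apply/eqP => /complexity_eq0.
have := complexity_sum h12; have := pos _ nz1; have := pos _ nz2 => c2 c1 c.
have aux (a1 a2 : R) (m1 m2 : int) :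
    a1 + a2 <= t * (m1 + m2)%:~R -> t * m1%:~R < a1 -> a2 <= t * m2%:~R.
  by rewrite rmorphD mulrDr /= => h1 h2; lra.
have [l1|l1] := leP (intersection L (class_of D1)) (t * (mult_at D1 x)%:~R).
  by apply: (IH D1 _ nz1 l1); lia.
apply: (IH D2 _ nz2 (aux _ _ _ _ _ l1)); first by lia.
by rewrite -(intersection_sum h12 L) -(mult_at_sum h12 x).
Qed.

Lemma proj_point_of n (w : 'I_n.+1 -> K) : (exists j, w j != 0) ->
  exists q : proj_point R n, forall j, val q 0 j = w j.
Proof.
move=> [j wj]; have w0 : \row_j w j != 0.
  by apply: contraNneq wj => /rowP/(_ j); rewrite !mxE => ->.
by exists (exist (fun u : 'rV[K]_n.+1 => u != 0) _ w0) => j'; rewrite /= mxE.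
Qed.

Lemma nonprop_not_same (u w : proj_point R 2) :
  nonprop (coords u) (coords w) -> ~~ same_point w u.
Proof.
move=> [a [b]]; apply: contraNN => /andP[/sub_rVP[c e] _].
by rewrite /coords e !mxE; apply/eqP; ring.
Qed.
End Divisors.

(** * Zeros of a form on a line *)

Section PlaneZeros.
Variable K : numClosedFieldType.

Lemma horner_mmap n (h : 'I_n -> {poly K}) (F : {mpoly K[n]}) t :
  (mmap polyC h F).[t] = F.@[fun i => (h i).[t]].
Proof.
rewrite /mmap mevalE horner_sum; apply: eq_bigr => m _; rewrite hornerM hornerC; congr (_ * _).
by rewrite /mmap1 horner_prod; apply: eq_bigr => i _; rewrite horner_exp.
Qed.

(** If neither [F(t,1)] nor [F(1,t)] has a root on the parametrised line, both are nonzero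
    constants, and comparing the parameters [(1,2)] and [(1/2,1)] by homogeneity gives
    [2^(d+1) = 1]. *)
Lemma form_zero_on_line d (F : {mpoly K[3]}) (l0 l1 l2 : K) :
  F \is d.+1.-homog -> l0 != 0 ->
  exists q : 'I_3 -> K, [/\ exists j, q j != 0, F.@[q] = 0 &
    l0 * q ord0 + l1 * q (lift ord0 ord0) + l2 * q (lift ord0 (lift ord0 ord0)) = 0].
Proof.
move=> hF hl.
pose line (a b : K) (j : 'I_3) : K := match val j with
  0 => - (l1 * a + l2 * b) / l0 | 1 => a | _ => b end.
have onl a b : l0 * line a b ord0 + l1 * line a b (lift ord0 ord0)
    + l2 * line a b (lift ord0 (lift ord0 ord0)) = 0.
  by rewrite /line /= mulrC divfK //; ring.
have hom c a b : F.@[line (c * a) (c * b)] = c ^+ d.+1 * F.@[line a b].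
  rewrite -(meval_homog _ _ hF); apply: meval_eq => -[[|[|[|//]]] ?]; rewrite /line //=.
  by ring.
pose h1 (j : 'I_3) : {poly K} := match val j with
  0 => - (l1 *: 'X + l2%:P) * l0^-1%:P | 1 => 'X | _ => 1 end.
pose h2 (j : 'I_3) : {poly K} := match val j with
  0 => - (l1%:P + l2 *: 'X) * l0^-1%:P | 1 => 1 | _ => 'X end.
have e1 t : (mmap polyC h1 F).[t] = F.@[line t 1].
  rewrite horner_mmap; apply: meval_eq => -[[|[|[|//]]] ?]; rewrite /h1 /line /= ?hornerE //.
have e2 t : (mmap polyC h2 F).[t] = F.@[line 1 t].
  rewrite horner_mmap; apply: meval_eq => -[[|[|[|//]]] ?]; rewrite /h2 /line /= ?hornerE //.
have [/closed_rootP[t]|] := boolP (size (mmap polyC h1 F) != 1%N).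
  rewrite rootE e1 => /eqP Ft; exists (line t 1); split=> //.
  by exists (lift ord0 (lift ord0 ord0)); rewrite /line /= oner_neq0.
rewrite negbK => s1; have [/closed_rootP[t]|] := boolP (size (mmap polyC h2 F) != 1%N).
  rewrite rootE e2 => /eqP Ft; exists (line 1 t); split=> //.
  by exists (lift ord0 ord0); rewrite /line /= oner_neq0.
rewrite negbK => /size_poly1P[c2 c2_neq0 E2]; case/size_poly1P: s1 => c1 c10 E1.
have v1 : F.@[line 1 1] = c1 by rewrite -(e1 1) E1 hornerC.
have v2 : F.@[line 1 2] = c1 by rewrite -[RHS](hornerC c1 2) -(hornerC c1 2) -v1 -(e2 1) E2 -(e2 2) E2 !hornerC.
have v3 : F.@[line 1 2] = 2 ^+ d.+1 * c1.
  rewrite -[c1](hornerC _ 2^-1) -E1 e1 -hom mulrC mulVf ?mulr1 ?mul1r //.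
  by rewrite pnatr_eq0.
have /eqP : (2 ^+ d.+1 - 1) * c1 = 0 by rewrite mulrBl mul1r -v3 v2 subrr.
rewrite mulf_eq0 (negPf c10) orbF subr_eq0 -natrX -[X in _ == X]/(1%:R) eqr_nat.
have : (0 < 2 ^ d)%N by rewrite expn_gt0.
by rewrite expnS; move: (2 ^ d)%N => x x0 /eqP; lia.
Qed.
End PlaneZeros.

Section Curves.
Variables (R : realType) (r : nat) (p : 'I_r -> proj_point R 2).
Local Notation K := R[i].
Local Notation o1 := (lift ord0 ord0 : 'I_3).
Local Notation o2 := (lift ord0 (lift ord0 ord0) : 'I_3).
Implicit Types (D C : effective_divisor p) (x : blowup_point p) (L : divisor_class R r).

(** A line avoiding all the [p i] still meets the curve [F = 0]. *)
Lemma exists_off_points d (F : {mpoly K[3]}) : F \is d.+1.-homog ->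
  exists q : proj_point R 2, F.@[coords q] = 0 /\ forall i, ~~ same_point q (p i).
Proof.
move=> hF; pose lin (w : 'I_3 -> K) : {mpoly K[3]} := \sum_j w j *: 'X_j.
have : 'X_ord0 * \prod_i lin (coords (p i)) != 0.
  apply: mulf_neq0; first by rewrite -msize_poly_eq0 msizeX.
  apply/prodf_neq0 => i _; apply: contraNneq (pivot_neq0 (p i)) => e.
  have := congr1 (mcoeff U_(pivot (p i))) e; rewrite mcoeff0 raddf_sum (bigD1 (pivot (p i))) //=.
  rewrite mcoeffZ mcoeffXU eqxx mulr1 big1 ?addr0 /coords => [-> //|j jp].
  by rewrite mcoeffZ mcoeffXU (negPf jp) mulr0.
case/mpoly_nonroot => l; rewrite mevalM mevalXU mulf_eq0 negb_or rmorph_prod.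
move=> /andP[l0 /prodf_neq0 hl].
have [w [w0 Fw lw]] := form_zero_on_line (l o1) (l o2) hF l0.
have [q hq] := proj_point_of w0; exists q; split.
  by rewrite -Fw; apply: meval_eq => j; rewrite /coords hq.
move=> i; apply: contraTN (hl i isT) => /andP[_ /sub_rVP[c e]]; rewrite negbK.
rewrite rmorph_sum /=; apply/eqP.
transitivity (c * (l ord0 * w ord0 + l o1 * w o1 + l o2 * w o2)); last by rewrite lw mulr0.
rewrite !big_ord_recl big_ord0 !mevalZ !mevalXU /coords e !mxE !hq; ring.
Qed.

Lemma exists_point_on D : ~ zero_divisor D -> exists x, 0 < mult_at D x.
Proof.
move=> nz; have := dpoly_homog D; case hd : (hdeg D) => [|d] hF.
  have [i ei] : exists i, ecoef D i <> 0 by apply/existsNP => h; apply: nz.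
  have [q _] : exists q : proj_point R 1, forall j, val q 0 j = 1.
    by apply: proj_point_of; exists ord0; exact: oner_neq0.
  exists (OnExc p i q); have := ecoef_bound D i; rewrite plane_mult_deg0 // oppr_le0 => e0.
  by rewrite /mult_at; apply: ltr_wpDl; rewrite // lt_neqAle e0 andbT eq_sym; apply/eqP.
have [q [Fq hq]] := exists_off_points hF; exists (OffExc hq).
rewrite /mult_at addr0 ltz_nat; apply/(order0_geP _ (local_pullback_neq0 D (OffExc hq))).
by apply/ord_ge1P; rewrite /= (chart_coef0 (pivot q) (coords q)).
Qed.

Lemma submaximal_of_divisor L D x : 0 <= intersection L L -> ~ zero_divisor D ->
  intersection L (class_of D) <= Num.sqrt (intersection L L) * (mult_at D x)%:~R ->
  admits_weakly_submaximal p L.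
Proof.
move=> L2 nz hD; split=> //; set t := Num.sqrt _ in hD *.
have t0 : 0 <= t by apply: sqrtr_ge0.
have [C iC hC] := integral_component nz hD.
have [m0|m0] := ltP 0 (mult_at C x).
  by exists C, x; split=> //; rewrite ler_pdivrMr // ltr0z.
have [y hy] := exists_point_on iC.1; exists C, y; split=> //.
apply: (le_trans _ t0); rewrite ler_pdivrMr ?ltr0z // mul0r.
by apply: le_trans hC _; rewrite mulr_ge0_le0 // lerz0.
Qed.

Lemma intersection_Lmu_class mu D :
  intersection (Lmu r mu) (class_of D) = mu * (hdeg D)%:R + \sum_i (ecoef D i)%:~R.
Proof.
rewrite /intersection /= -sumrN; congr (_ + _); apply: eq_bigr => i _.
by rewrite mulN1r opprK.
Qed.

Lemma intersection_Lmu (mu : R) : intersection (Lmu r mu) (Lmu r mu) = mu ^+ 2 - r%:R.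
Proof.
rewrite /intersection /= expr2; congr (_ - _).
by under eq_bigr do rewrite mulrNN mulr1; rewrite sumr_const card_ord.
Qed.

Lemma curve_divisor d (F : {mpoly K[3]}) (m : 'I_r -> nat) :
  F != 0 -> F \is d.-homog -> (forall i, ord_ge (m i) (F \mPo affine_chart (p i))) ->
  exists D, [/\ hdeg D = d, forall i, ecoef D i = - (m i)%:Z & dpoly D = F].
Proof.
move=> F0 hF oF.
have bd i : - - (m i)%:Z <= (plane_mult F (p i))%:Z.
  rewrite opprK lez_nat; apply/(order0_geP _ (affine_chart_neq0 (p i) hF F0)); exact: oF.
by exists (EffectiveDivisor F0 hF bd).
Qed.

Lemma curve_nonzero D d : hdeg D = d.+1 -> ~ zero_divisor D.
Proof. by move=> h [h0 _]; rewrite h in h0. Qed.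

Lemma class_of_curve mu D d (m : 'I_r -> nat) : hdeg D = d ->
  (forall i, ecoef D i = - (m i)%:Z) ->
  intersection (Lmu r mu) (class_of D) = mu * d%:R - (\sum_i m i)%:R.
Proof.
move=> hd he; rewrite intersection_Lmu_class hd natr_sum -sumrN; congr (_ + _).
by apply: eq_bigr => i _; rewrite he rmorphN.
Qed.

Lemma exc_submaximal (i : 'I_r) mu : Num.sqrt (r.+1)%:R <= mu ->
  admits_weakly_submaximal p (Lmu r mu).
Proof.
move=> hmu; have mu2 : r%:R + 1 <= mu ^+ 2.
  have s0 : 0 <= Num.sqrt (r.+1)%:R :> R by apply: sqrtr_ge0.
  by rewrite natr1 -[X in X <= _](@sqr_sqrtr R) ?ler0n // ler_sqr ?nnegrE // (le_trans s0).
have F0 : (1 : {mpoly K[3]}) != 0 by apply: oner_neq0.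
have bd j : - (i == j)%:Z <= (plane_mult (1 : {mpoly K[3]}) (p j))%:Z.
  by apply: le_trans (_ : 0 <= _) => //; rewrite oppr_le0.
have h0 : (1 : {mpoly K[3]}) \is 0.-homog by exact: dhomog1.
pose D := EffectiveDivisor F0 h0 bd.
have [s _] : exists q : proj_point R 1, forall j, val q 0 j = 1.
  by apply: proj_point_of; exists ord0; exact: oner_neq0.
apply: (@submaximal_of_divisor _ D (OnExc p i s)).
- by rewrite intersection_Lmu; lra.
- by move=> [_ /(_ i)] /=; rewrite eqxx.
rewrite intersection_Lmu_class intersection_Lmu /= mulr0 add0r.
rewrite (bigD1 i) //= eqxx big1 ?addr0 => [|j /negPf]; last by rewrite eq_sym => ->.
have hs : 1 <= Num.sqrt (mu ^+ 2 - r%:R) by rewrite -[X in X <= _]sqrtr1 ler_wsqrtr //; lra.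
have hm : (1 : R) <= (mult_at D (OnExc p i s))%:~R by rewrite /mult_at /= eqxx ler1z lerDr.
by have := ler_pM ler01 ler01 hs hm; rewrite mulr1.
Qed.

Section Forms.
Variables (d : nat) (m : 'I_r -> nat).

Definition vanishing_form (F : {mpoly K[3]}) :=
  F \is d.-homog /\ forall i, ord_ge (m i) (F \mPo affine_chart (p i)).

Lemma exists_form : (\sum_i 'C((m i).+1, 2) < 'C(d + 2, d))%N ->
  exists2 F, F != 0 & vanishing_form F.
Proof.
move=> h; have [U [hU dU]] := forms_dim (fun i => pivot (p i)) (fun i => coords (p i)) m d.
have U0 : vpick U != 0 by rewrite vpick0 -dimv_eq0 -lt0n; lia.
exists (val (vpick U)); first by apply: contraNneq U0 => e; apply/eqP/val_inj.
by split; [exact: dhomog_is_dhomog | exact: (proj1 (hU _) (memv_pick U))].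
Qed.

Lemma exists_two_forms : (\sum_i 'C((m i).+1, 2) + 1 < 'C(d + 2, d))%N ->
  exists F G, [/\ vanishing_form F, vanishing_form G &
    forall a c, (a != 0) || (c != 0) -> a *: F + c *: G != 0].
Proof.
move=> h; have [U [hU dU]] := forms_dim (fun i => pivot (p i)) (fun i => coords (p i)) m d.
have U0 : vpick U != 0 by rewrite vpick0 -dimv_eq0 -lt0n; lia.
have vf w : w \in U -> vanishing_form (val w).
  by move=> wU; split; [exact: dhomog_is_dhomog | exact: (proj1 (hU _) wU)].
have [w wU wv] : exists2 w, w \in U & w \notin <[vpick U]>%VS.
  apply/subvPn; apply/negP => /dimvS; rewrite dim_vline U0 /=; lia.
exists (val (vpick U)), (val w); split; [exact/vf/memv_pick | exact: vf | ].
move=> a c; apply: contraTneq => e; have {}e : a *: vpick U + c *: w = 0 by apply: val_inj.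
have c0 : c = 0.
  apply: contraNeq wv => c0; apply/vlineP; exists (- (c^-1 * a)).
  apply: (scalerI c0); rewrite scalerA mulrN mulVKf // scaleNr; apply/eqP.
  by rewrite -addr_eq0 addrC e.
move: e; rewrite c0 scale0r addr0 => /eqP; rewrite scaler_eq0 (negPf U0) orbF => /eqP ->.
by rewrite eqxx.
Qed.
End Forms.

Hypothesis np : forall i j, i != j -> nonprop (coords (p i)) (coords (p j)).

Lemma pencil_divisor e (mu : 'I_r -> nat) :
  (\sum_i 'C((mu i).+2, 2) + 1 < 'C(e.+1 + 2, e.+1))%N ->
  (\sum_i (3 * mu i ^ 2 + 4 * mu i) < 3 * e ^ 2)%N ->
  exists D x, [/\ hdeg D = e.+1, forall i, ecoef D i = - (mu i).+1%:Z & 2 <= mult_at D x].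
Proof.
move=> dimc count.
have [F [G [[hF oF] [hG oG] FG]]] := @exists_two_forms e.+1 (fun i => (mu i).+1) dimc.
have [a [c [ac sing]]] := @pencil_singular_member K 'I_r (fun i => pivot (p i))
  (fun i => coords (p i)) mu e F G (fun i => pivot_neq0 (p i)) np hF hG oF oG count.
set H := a *: F + c *: G in sing; have H0 : H != 0 := FG a c ac.
have hH : H \is e.+1.-homog by rewrite dhomogD ?dhomogZ.
have oH i : ord_ge (mu i).+1 (H \mPo affine_chart (p i)).
  by rewrite comp_mpolyD !comp_mpolyZ; apply: ord_geD; apply: ord_geZ; [exact: oF | exact: oG].
have [D [hd he hp]] := curve_divisor H0 hH oH; exists D.
case: sing => [[q [q0 nq Hq]]|[i [s [s0 [h1 h2]]]]].
  have [q' hq'] := proj_point_of q0; have cq : coords q' = q by apply/funext => j; rewrite /coords hq'.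
  have off i : ~~ same_point q' (p i) by apply: nonprop_not_same; rewrite cq.
  exists (OffExc off); split=> //; rewrite /mult_at addr0 lez_nat.
  apply/(order0_geP _ (local_pullback_neq0 D (OffExc off))).
  apply: ord_ge2 => [|j]; rewrite /= hp.
    rewrite (chart_coef0 (pivot q') (coords q')) cq; apply: (@mulfI _ (e.+1%:R)).
      by rewrite pnatr_eq0.
    rewrite mulr0 -mevalZ -(euler hH) rmorph_sum big1 // => x _.
    by rewrite rmorphM /= Hq mulr0.
  by rewrite (chart_deriv (pivot q') (coords q')) (chart_coef0 (pivot q') (coords q')) cq.
have [s' hs'] := proj_point_of s0.
have es : (fun j => val s' 0 j) = s by apply/funext => j; rewrite hs'.
exists (OnExc p i s'); split=> //; rewrite /mult_at he.
(* The coefficient [-(mu i + 1)] of [E_i] is added to this order, which leaves at least 2. *)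
have : ord_ge ((mu i).+1 + 2) (local_pullback (dpoly D) (OnExc p i s')).
  by move: h1 h2; rewrite -es /= hp => h1 h2; exact: (blowup_ord (oH i) h1 h2).
move/(order0_geP _ (local_pullback_neq0 D (OnExc p i s'))).
by move: (order0 _) => o; lia.
Qed.

End Curves.

(** * Thresholds *)

Section VeryGeneral.
Variables (R : realType) (r : nat).
Local Notation K := R[i].
Implicit Types p : 'I_r -> proj_point R 2.

Lemma mxvec_index_inj (m n : nat) (i i' : 'I_m) (j j' : 'I_n) :
  mxvec_index i j = mxvec_index i' j' -> i = i' /\ j = j'.
Proof. by move=> /cast_ord_inj/enum_rank_inj[-> ->]. Qed.

Definition minor_form (i j : 'I_r) (a b : 'I_3) : {mpoly K[r * 3]} :=
  'X_(mxvec_index i a) * 'X_(mxvec_index j b) - 'X_(mxvec_index i b) * 'X_(mxvec_index j a).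

Lemma minor_form_multihomog i j a b : multihomog (minor_form i j a b).
Proof.
exists (fun x => (i == x) + (j == x))%N => m /msuppB_le; rewrite -!mpolyXD !msuppX mem_cat !inE.
have h a' b' x : (\sum_(y < 3) (U_(mxvec_index i a') + U_(mxvec_index j b'))%MM (mxvec_index x y)
    = (i == x) + (j == x))%N.
  have s i' c : (\sum_(y < 3) (mxvec_index i' c == mxvec_index x y) = (i' == x))%N.
    have [->|ne] := eqVneq i' x.
      rewrite (bigD1 c) //= eqxx big1 // => y yc; apply/eqP; rewrite eqb0.
      by apply: contraNN yc => /eqP/mxvec_index_inj[_ ->].
    rewrite big1 // => y _; apply/eqP; rewrite eqb0.
    by apply: contraNN ne => /eqP/mxvec_index_inj[-> _].
  by under eq_bigr do rewrite mnmDE !mnm1E; rewrite big_split /= !s.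
by case/orP => /eqP -> x; apply: h.
Qed.

Lemma minor_form_eval p i j a b : (minor_form i j a b).@[config_coord p] =
  coords (p i) a * coords (p j) b - coords (p i) b * coords (p j) a.
Proof. by rewrite mevalB !mevalM !mevalXU /config_coord !mxvecE !mxE. Qed.

(** The condition [ij.1 != ij.2] makes the set empty on the diagonal pairs, so that it is a proper
    closed set for every pair. *)
Definition coincide (ij : 'I_r * 'I_r) p :=
  ij.1 != ij.2 /\ forall a b, coords (p ij.1) a * coords (p ij.2) b = coords (p ij.1) b * coords (p ij.2) a.

Lemma never_closed : zariski_closed (fun _ : 'I_r -> proj_point R 2 => False).
Proof.
exists (fun G => G = 1); split=> [G ->|p].
  exists (fun=> 0%N) => m; rewrite msupp1 inE => /eqP -> i.
  by rewrite big1 // => j _; rewrite mnm0E.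
by split=> // /(_ _ erefl); rewrite meval1 => /eqP; rewrite oner_eq0.
Qed.

Lemma coincide_closed ij : zariski_closed (coincide ij).
Proof.
have [e|ne] := eqVneq ij.1 ij.2.
  have -> : coincide ij = fun=> False.
    by apply/funext => p; apply/propext; split=> // -[]; rewrite e eqxx.
  exact: never_closed.
exists (fun G => exists a b, G = minor_form ij.1 ij.2 a b); split=> [G [a [b ->]]|p].
  exact: minor_form_multihomog.
split=> [[_ h] G [a [b ->]]|h]; first by rewrite minor_form_eval h subrr.
split=> // a b; apply/eqP; rewrite -subr_eq0; apply/eqP; rewrite -minor_form_eval.
by apply: h; exists a, b.
Qed.

Lemma coincide_proper ij : exists p, ~ coincide ij p.
Proof.
have pt (k : 'I_3) : exists q : proj_point R 2, forall j, val q 0 j = (j == k)%:R.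
  by apply: proj_point_of; exists k; rewrite eqxx oner_neq0.
have [[q0 h0] [q1 h1]] := (pt ord0, pt (lift ord0 ord0)).
exists (fun x => if x == ij.1 then q0 else q1) => -[ne /(_ ord0 (lift ord0 ord0))].
rewrite /coords eqxx eq_sym (negPf ne) !h0 !h1 /= => /eqP.
by rewrite mulr1 mulr0 oner_eq0.
Qed.

(** The excluded sets are the finitely many diagonals, enumerated through [pickle]; integers that
    code no pair give the empty set. *)
Lemma for_very_general_distinct (P : ('I_r -> proj_point R 2) -> Prop) :
  (forall p, (forall i j, i != j -> nonprop (coords (p i)) (coords (p j))) -> P p) ->
  for_very_general P.
Proof.
move=> hP; exists (fun k p => if unpickle k is Some ij then coincide ij p else False); split.
  move=> k; case: (unpickle k) => [ij|]; first by split; [exact: coincide_closed | exact: coincide_proper].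
  split; first exact: never_closed.
  have [q _] : exists q : proj_point R 2, forall j, val q 0 j = 1.
    by apply: proj_point_of; exists ord0; exact: oner_neq0.
  by exists (fun=> q).
move=> p hp; apply: hP => i j ij; apply: contrapT => nn; apply: (hp (pickle (i, j))).
rewrite pickleK; split=> // a b; apply/eqP/negPn/negP => h.
by apply: nn; exists a, b.
Qed.
End VeryGeneral.

(** * Numerical conditions *)

Section Thresholds.
Variable R : realType.
Implicit Types mu s : R.

Lemma le_double_sqrt (a b : R) : 0 <= b -> a ^+ 2 <= b -> a <= Num.sqrt b.
Proof.
move=> b0 ab; have [a0|a0] := leP 0 a; last exact: le_trans (ltW a0) (sqrtr_ge0 _).
by rewrite -(ler_sqr a0 (sqrtr_ge0 _)) sqr_sqrtr.
Qed.

Lemma lt_sqrt_sqr mu n : 0 <= mu -> mu < Num.sqrt n%:R -> mu ^+ 2 < n%:R.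
Proof. by move=> m0 h; rewrite -(@sqr_sqrtr R n%:R) ?ler0n // ltr_sqr ?nnegrE ?sqrtr_ge0. Qed.

Variables (r : nat) (p : 'I_r -> proj_point R 2).
Hypothesis np : forall i j, i != j -> nonprop (coords (p i)) (coords (p j)).

(** A multiplicity of at least 2 reduces the claim to [L.D / 2 <= sqrt(L^2)], and squaring makes it
    a quadratic condition on [mu]. *)
Lemma pencil_submaximal e (m : 'I_r -> nat) mu :
  (\sum_i 'C((m i).+2, 2) + 1 < 'C(e.+1 + 2, e.+1))%N ->
  (\sum_i (3 * m i ^ 2 + 4 * m i) < 3 * e ^ 2)%N ->
  r%:R <= mu ^+ 2 ->
  ((mu * e.+1%:R - (\sum_i (m i).+1)%:R) / 2) ^+ 2 <= mu ^+ 2 - r%:R ->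
  admits_weakly_submaximal p (Lmu r mu).
Proof.
move=> dimc count mu2 hs; have [D [x [hd he hm]]] := pencil_divisor np dimc count.
have L2 : 0 <= mu ^+ 2 - r%:R by rewrite subr_ge0.
apply: (@submaximal_of_divisor _ _ _ _ D x); first by rewrite intersection_Lmu.
  exact: curve_nonzero hd.
rewrite (class_of_curve mu (m := fun i => (m i).+1) hd he) intersection_Lmu.
have := le_double_sqrt L2 hs; have t0 := sqrtr_ge0 (mu ^+ 2 - r%:R).
have m2 : (2 : R) <= (mult_at D x)%:~R by rewrite -[2]/((2%:Z)%:~R) ler_int.
rewrite ler_pdivrMr // => h; apply: le_trans h _; exact: ler_wpM2l.
Qed.

Lemma cubic_submaximal (m : 'I_r -> nat) mu :
  (\sum_i 'C((m i).+1, 2) < 10)%N -> r%:R <= mu ^+ 2 ->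
  (mu * 3 - (\sum_i m i)%:R) ^+ 2 <= mu ^+ 2 - r%:R ->
  admits_weakly_submaximal p (Lmu r mu).
Proof.
move=> dimc mu2 hs; have [F F0 [hF oF]] := @exists_form R r p 3 m dimc.
have L2 : 0 <= mu ^+ 2 - r%:R by rewrite subr_ge0.
have [D [hd he hp]] := curve_divisor F0 hF oF.
have [x hx] := exists_point_on (curve_nonzero hd).
apply: (@submaximal_of_divisor _ _ _ _ D x); first by rewrite intersection_Lmu.
  exact: curve_nonzero hd.
rewrite (class_of_curve mu hd he) intersection_Lmu.
have t0 := sqrtr_ge0 (mu ^+ 2 - r%:R).
apply: le_trans (le_double_sqrt L2 hs) _; rewrite -[X in X <= _]mulr1; apply: ler_wpM2l => //.
by rewrite ler1z; rewrite -gtz0_ge1.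
Qed.
End Thresholds.

Theorem theorem2p5 (R : realType) (r : nat) (r_gt0 : (1 <= r)%N) :
  for_very_general (fun p : 'I_r -> proj_point R 2 =>
    [/\ forall mu : R, Num.sqrt (r.+1)%:R <= mu ->
          admits_weakly_submaximal p (Lmu r mu),
        r = 10%N -> forall mu : R, 77%:R / 24%:R <= mu ->
          admits_weakly_submaximal p (Lmu r mu),
        r = 11%N -> forall mu : R, 4%:R - Num.sqrt 3%:R / 3%:R <= mu ->
          admits_weakly_submaximal p (Lmu r mu)
      & r = 13%N -> forall mu : R, 6%:R^-1 * (26%:R - Num.sqrt 13%:R) <= mu ->
          admits_weakly_submaximal p (Lmu r mu)]).
Proof.
apply: for_very_general_distinct => p np.
have large mu : Num.sqrt (r.+1)%:R <= mu -> admits_weakly_submaximal p (Lmu r mu).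
  exact: exc_submaximal (Ordinal r_gt0) _.
split=> // er; subst r => mu hmu.
- have mu0 : 0 <= mu by lra.
  have [/large //|small] := leP (Num.sqrt 11%:R) mu.
  have small2 := lt_sqrt_sqr mu0 small; have mu2 : (10 : R) <= mu ^+ 2 by nra.
  (* For the cubic the condition is [8 mu^2 - 54 mu + 91 <= 0], that is, [13/4 <= mu <= 7/2], and
     [sqrt 11 < 7/2]. *)
  have [hmu'|hmu'] := leP (13%:R / 4%:R) mu.
    apply: (@cubic_submaximal R 10 p (fun i => (i < 9)%N : nat)) => //.
      by rewrite !big_ord_recl big_ord0.
    have -> : (\sum_(i < 10) ((i < 9)%N : nat) = 9)%N by rewrite !big_ord_recl big_ord0.
    by nra.
  (* Here [L.D = 10 mu - 31], and the condition [96 mu^2 - 620 mu + 1001 <= 0] has roots [77/24] and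
     [13/4]. *)
  apply: (@pencil_submaximal R 10 p np 9 (fun i => if val i == 0%N then 3 else 2)%N) => //.
  - by rewrite !big_ord_recl big_ord0.
  - by rewrite !big_ord_recl big_ord0.
  have -> : (\sum_(i < 10) (if val i == 0 then 3 else 2).+1 = 31)%N.
    by rewrite !big_ord_recl big_ord0.
  by nra.
- have s0 := sqrtr_ge0 (3%:R : R); have s2 : Num.sqrt 3%:R ^+ 2 = 3%:R :> R by rewrite sqr_sqrtr.
  (* This rational bound gives [mu >= 17/5], hence [mu^2 >= 11]. *)
  have s3 : Num.sqrt 3%:R <= 9%:R / 5%:R :> R by nra.
  have mu0 : 0 <= mu by lra.
  have [/large //|small] := leP (Num.sqrt 12%:R) mu.
  have small2 := lt_sqrt_sqr mu0 small; have mu2 : (11 : R) <= mu ^+ 2 by nra.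
  (* Here [L.D = 4 mu - 12], and [3 mu^2 - 24 mu + 47] has roots [4 - sqrt 3 / 3] and
     [4 + sqrt 3 / 3], the larger one beyond [sqrt 12]. *)
  apply: (@pencil_submaximal R 11 p np 3 (fun i => if val i == 0%N then 1 else 0)%N) => //.
  - by rewrite !big_ord_recl big_ord0.
  - by rewrite !big_ord_recl big_ord0.
  have -> : (\sum_(i < 11) (if val i == 0 then 1 else 0).+1 = 12)%N.
    by rewrite !big_ord_recl big_ord0.
  by nra.
- have s0 := sqrtr_ge0 (13%:R : R); have s2 : Num.sqrt 13%:R ^+ 2 = 13%:R :> R by rewrite sqr_sqrtr.
  have s3 : Num.sqrt 13%:R <= 37%:R / 10%:R :> R by nra.
  have mu0 : 0 <= mu by lra.
  have [/large //|small] := leP (Num.sqrt 14%:R) mu.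
  have small2 := lt_sqrt_sqr mu0 small; have mu2 : (13 : R) <= mu ^+ 2 by nra.
  (* Here [L.D = 4 mu - 13], and [12 mu^2 - 104 mu + 221] has roots [(26 - sqrt 13) / 6] and
     [(26 + sqrt 13) / 6], the larger one beyond [sqrt 14]. *)
  apply: (@pencil_submaximal R 13 p np 3 (fun=> 0%N)) => //.
  - by rewrite !big_ord_recl big_ord0.
  - by rewrite !big_ord_recl big_ord0.
  have -> : (\sum_(i < 13) 1 = 13)%N by rewrite !big_ord_recl big_ord0.
  by nra.
Qed.
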